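(* Let $d\ge3$. For $\beta>0$ sufficiently small (depending only on $d$) there is $\theta\in\left(0,\min\{\tfrac d2-1,\,-\ln(\alpha_d\lambda)\}\right)$ such that for every $(x,s)\in\mathbb{Z}^d\times\mathbb{R}$ $$\lim_{t\to\infty}(t-s)^\theta\left\langle\left(Z_{x,s}^t-Z_{x,s}^\infty\right)^2\right\rangle=0.$$
   Context: Let $d\ge 3$. Let $\eta$ be the continuous-time simple symmetric random walk on $\mathbb{Z}^d$: its jump times form a rate-1 Poisson point process and at each jump it moves to one of the $2d$ nearest neighbours with equal probability. $\mathbf{P}_{x,s}$, $\mathbf{E}_{x,s}$ denote law and expectation when $\eta_s=x$; for $t>s$, $\mathbf{E}_{x,s}^{y,t}$ is expectation under $\mathbf{P}_{x,s}$ conditioned on $\{\eta_t=y\}$. Put $p_t^z=\mathbf{P}_{0,0}(\eta_t=z)$, and let $q_n^z$ be the $n$-step transition probability from $0$ to $z$ of the discrete-time simple symmetric random walk on $\mathbb{Z}^d$. Environment: $\Omega$ is the set of functions $\omega:\mathbb{Z}^d\times\mathbb{R}\to\mathbb{R}$ such that for each $x$, $t\mapsto\omega(x,t)$ is continuous with $\omega(x,0)=0$; $(\Omega,\mathcal{F},Q)$ is the completed canonical probability space under which $W^x_t(\omega)=\omega(x,t)$, $x\in\mathbb{Z}^d$, are independent two-sided standard Wiener processes. $\langle\cdot\rangle$ is expectation under $Q$. For a walk path on $[s,t)$ with $n$ jumps at times $s<s_1<\dots<s_n<t$ and successive sites $\gamma_0,\dots,\gamma_n$, put $s_0=s$, $s_{n+1}=t$,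 and define the action $\mathcal{A}_s^t(\eta,\omega)=\sum_{j=0}^{n}(\omega(\gamma_j,s_{j+1})-\omega(\gamma_j,s_j))$. For $\beta>0$ and $s<t$ define $$Z_{x,s}^{y,t}(\omega)=e^{-\frac{\beta^2}{2}(t-s)}\,p_{t-s}^{y-x}\,\mathbf{E}_{x,s}^{y,t}e^{\beta\mathcal{A}_s^t(\cdot,\omega)},\qquad Z_{x,s}^t=\sum_{y\in\mathbb{Z}^d}Z_{x,s}^{y,t}.$$ $\alpha_d=\sum_{n=1}^\infty\sum_{z\in\mathbb{Z}^d}(q_n^z)^2<\infty$ and $\lambda=\mathbf{E}[e^{\beta^2\tau}-1]$ for $\tau$ exponential with rate $1$, i.e. $\lambda=\beta^2/(1-\beta^2)$ for $\beta<1$. When $\alpha_d\lambda<1$, $Z_{x,s}^\infty$ denotes the limit of $Z_{x,s}^t$ in $L^2(Q)$ as $t\to\infty$, which exists. *)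

(* Defs.v *)
From HB Require Import structures.
From mathcomp Require Import all_boot all_order all_algebra finmap.
From mathcomp Require Import all_classical all_reals all_analysis.

Set Implicit Arguments.
Unset Strict Implicit.
Unset Printing Implicit Defensive.

Import Order.TTheory GRing.Theory Num.Def Num.Theory.
Import numFieldNormedType.Exports.

Local Open Scope classical_set_scope.
Local Open Scope ring_scope.

Section independence.
Context {dT : measure_display} {T : measurableType dT} {R : realType}.
Variable P : probability T R.

(* Mutual independence of a family of classes of events: the product rule over
   every finite subfamily. *)
Definition independent {I : choiceType} (G : I -> set_system T) :=
  forall (F : {fset I}) (A : I -> set T),
    (forall i, i \in F -> G i (A i)) ->
    P (\bigcap_(i in [set` F]) A i) = (\prod_(i <- F) P (A i))%E.

Definition rv_events (X : T -> R) : set_system T :=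
  preimage_set_system setT X measurable.

Definition discrete_events {U : Type} (X : T -> U) : set_system T :=
  [set X @^-1` B | B in [set: set U]].

Definition process_events {I : Type} (X : I -> T -> R) : set_system T :=
  <<s \bigcup_(i in [set: I]) rv_events (X i) >>.

End independence.

Section brownian_environment.
Context {R : realType} {d : nat}.
Context {dO : measure_display} {Omega : measurableType dO}.
Variable Q : probability Omega R.

(* Two-sided standard Wiener process on [R], started from [0] at time [0]. *)
Record wiener (X : R -> Omega -> R) : Prop := Wiener {
  wiener_measurable : forall t, measurable_fun setT (X t);
  wiener_start : forall om, X 0 om = 0;
  wiener_continuous : forall om, continuous (X ^~ om);
  wiener_gaussian : forall (s t : R) (B : set R), s < t -> measurable B ->
    Q [set om | B (X t om - X s om)] = normal_prob 0 (Num.sqrt (t - s)) B;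
  wiener_independent : forall u : nat -> R,
    {homo u : i j / (i < j)%N >-> i < j} ->
    independent Q (fun k => rv_events (fun om => X (u k.+1) om - X (u k) om))
}.

Record wiener_environment (W : 'rV[int]_d -> R -> Omega -> R) : Prop :=
  WienerEnvironment {
  environment_wiener : forall x, wiener (W x);
  environment_independent : independent Q (fun x => process_events (W x))
}.

End brownian_environment.

(* [unit_vec (i, b)] is [(-1)^b e_i]; these are the [2d] neighbours of [0]. *)
Definition unit_vec {d : nat} (a : 'I_d * bool) : 'rV[int]_d :=
  (-1) ^+ a.2 *: delta_mx 0 a.1.

Section random_walk.
Context {R : realType} {d : nat}.
Context {dE : measure_display} {E : measurableType dE}.
Variable P : probability E R.
Variables (tau : nat -> E -> R) (xi : nat -> E -> 'rV[int]_d).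

(* number of points of [{tau 0, tau 1, ...}] in [A]; only used for bounded [A],
   where this set of indices is finite *)
Definition count_points (A : set R) (w : E) : nat :=
  #|` fset_set [set k | A (tau k w)] |.

(* [tau 0 < tau 1 < ...] enumerates a rate-1 Poisson point process on [(0, oo)].
   The Poisson weights are spelled out because the library's [poisson_pmf 0 k]
   is [1] for all [k], whereas [A] may have measure [0]. *)
Record poisson_process : Prop := PoissonProcess {
  points_measurable : forall k, measurable_fun setT (tau k);
  points_gt0 : forall k w, 0 < tau k w;
  points_increasing : forall k w, tau k w < tau k.+1 w;
  points_unbounded : forall w, tau ^~ w @ \oo --> +oo;
  count_poisson : forall (A : set R) (M : R) (n : nat),
    measurable A -> A `<=` `]0, M] ->
    let m := fine (lebesgue_measure A) in
    P [set w | count_points A w = n] = (m ^+ n / n`!%:R * expR (- m))%:E;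
  count_independent : forall A : nat -> set R,
    (forall k, measurable (A k)) ->
    (forall k, exists M : R, A k `<=` `]0, M]) ->
    trivIset setT A ->
    independent P (fun k => discrete_events (count_points (A k)))
}.

(* jump times [tau] and displacements [xi] of the continuous-time simple
   symmetric random walk started at time [0] *)
Record simple_random_walk : Prop := SimpleRandomWalk {
  walk_jump_times : poisson_process;
  step_measurable : forall k z, measurable (xi k @^-1` [set z]);
  step_uniform : forall k (a : 'I_d * bool),
    P (xi k @^-1` [set unit_vec a]) = ((2 * d)%:R^-1)%:E;
  (* the process [tau], [xi 0], [xi 1], ... are mutually independent *)
  walk_independent : independent P (fun o : option nat =>
    if o is Some k then discrete_events (xi k) else process_events tau)
}.

Definition site (x : 'rV[int]_d) (j : nat) (w : E) : 'rV[int]_d :=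
  x + \sum_(i < j) xi i w.

(* The law of [walk x s] under [P] is the law of [eta] under [P_{x,s}]: the walk
   from [x] at time [s] jumps at the times [s + tau k]. *)
Definition walk (x : 'rV[int]_d) (s t : R) (w : E) : 'rV[int]_d :=
  site x (count_points `]0, t - s] w) w.

Definition transition (t : R) (z : 'rV[int]_d) : \bar R :=
  P [set w | walk 0 0 t w = z].

(* expectation of [F] under [P_{x,s}] conditioned on [eta_t = y] *)
Definition bridge_expectation (x : 'rV[int]_d) (s : R) (y : 'rV[int]_d) (t : R)
    (F : E -> \bar R) : \bar R :=
  let arrival := [set w | walk x s t w = y] in
  ((\int[P]_(w in arrival) F w) / P arrival)%E.

(* [s_j]: [s_0 = s], then the [n] jump times, then [s_{n+1} = t] *)
Definition path_time (s t : R) (n : nat) (w : E) (j : nat) : R :=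
  if j is i.+1 then (if (i < n)%N then s + tau i w else t) else s.

Section partition_function.
Context {dO : measure_display} {Omega : measurableType dO}.
Variable Q : probability Omega R.
Variable W : 'rV[int]_d -> R -> Omega -> R.

Definition action (x : 'rV[int]_d) (s t : R) (w : E) (om : Omega) : R :=
  let n := count_points `]0, t - s[ w in
  \sum_(0 <= j < n.+1)
    (W (site x j w) (path_time s t n w j.+1) om -
     W (site x j w) (path_time s t n w j) om).

Definition Zpp (beta : R) (x : 'rV[int]_d) (s : R) (y : 'rV[int]_d) (t : R)
    (om : Omega) : \bar R :=
  ((expR (- (beta ^+ 2 / 2) * (t - s)))%:E * transition (t - s) (y - x) *
   bridge_expectation x s y t
     (fun w => (expR (beta * action x s t w om))%:E))%E.

(* Finite only almost surely, hence extended-real valued. *)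
Definition Z (beta : R) (x : 'rV[int]_d) (s t : R) (om : Omega) : \bar R :=
  \esum_(y in [set: 'rV[int]_d]) Zpp beta x s y t om.

Definition mean_square_dist (X : Omega -> \bar R) (f : Omega -> R) : \bar R :=
  (\int[Q]_om (X om - (f om)%:E) ^+ 2)%E.

Definition Z_L2_limit (beta : R) (x : 'rV[int]_d) (s : R) : set (Omega -> R) :=
  [set f : Omega -> R | [/\ measurable_fun setT f,
    (\int[Q]_om ((f om) ^+ 2)%:E < +oo)%E &
    mean_square_dist (Z beta x s t) f @[t --> +oo] --> 0%E]].

(* A chosen version of the [L^2(Q)]-limit; the junk value [0] is used when
   there is no limit. *)
Definition Zinf (beta : R) (x : 'rV[int]_d) (s : R) : Omega -> R :=
  xget (cst 0) (Z_L2_limit beta x s).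

End partition_function.
End random_walk.

(* transition probability from [0] to [z] in [n] steps of the discrete-time walk *)
Fixpoint step_transition (R : realType) (d n : nat) (z : 'rV[int]_d) : R :=
  if n is m.+1 then
    \sum_(a : 'I_d * bool) (2 * d)%:R^-1 * step_transition R m (z - unit_vec a)
  else (z == 0)%:R.

Definition alpha (R : realType) (d : nat) : \bar R :=
  (\sum_(1 <= n <oo)
    \esum_(z in [set: 'rV[int]_d]) ((step_transition R n z) ^+ 2)%:E)%E.

(* [E[e^(beta^2 tau) - 1]] for [tau] exponential with rate [1] *)
Definition lambda (R : realType) (beta : R) : \bar R :=
  (\int[lebesgue_measure]_u
    ((expR (beta ^+ 2 * u) - 1) * exponential_pdf 1 u)%:E)%E.

(* Main.v *)
Require Import Defs.
From HB Require Import structures.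
From mathcomp Require Import all_boot all_order all_algebra finmap.
From mathcomp Require Import all_classical all_reals all_analysis.
From mathcomp Require Import measurable_realfun.
From mathcomp Require Import ring lra zify.

Set Implicit Arguments.
Unset Strict Implicit.
Unset Printing Implicit Defensive.

Import Order.TTheory GRing.Theory Num.Def Num.Theory.
Import numFieldNormedType.Exports.

Local Open Scope classical_set_scope.
Local Open Scope ring_scope.

(** The partition function is an average over walks of exponential weights, so
    its covariance in time can be computed by averaging over the environment
    first: this gives the expected exponential of the overlap of two independent
    walks, and the second moment of an increment of the partition function is
    the part of that expectation which the walks gain from meeting after the
    earlier time. In dimension at least three the walk is at a prescribed site
    at time [u] with probability of order [u^(-3/2)], late meetings are rare, and
    for small [beta] a perturbative argument shows that they contribute at most
    of order [(1 + t - s)^(-1/4)]. Hence every [theta < 1/4] below the two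
    prescribed bounds is admissible.

    To avoid stochastic integration and continuous-time conditioning, the walk
    is first watched at the multiples of a mesh [h] only ([grid_action]). The
    environment then enters through finitely many independent Gaussian
    increments ([two_path_exp_moment]), and the covariance of the weights of two
    grid paths is the product of [1 + g] over the time slots in which they are
    at the same site, with [g = exp (beta^2 h) - 1] ([grid_weight_cov]). The
    expansion [prod (1 + g 1_i) = 1 + g sum_j 1_j prod_(i < j) (1 + g 1_i)]
    together with the Markov property ([markov]) bounds the summands by a
    renewal inequality whose kernel is the heat kernel bound
    ([visit_mean_renewal]). Its solution is summable against the weight
    [(1 + k h)^(1/4)] when [beta] is small, uniformly in the mesh
    ([renewal_bound], [visit_mean_tail]); this is [grid_Z_dist].

    The heat kernel bound itself comes from counting: given how often each
    coordinate was chosen, the coordinates are independent walks on the line,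
    each of which is at a given site with probability of order [m^(-1/2)], and
    three of them suffice ([step_transition_ub]). The same bound makes [alpha]
    finite.

    Letting the mesh tend to [0], the grid actions converge for every path and
    every environment ([grid_action_cvg]), and uniformly bounded fourth moments
    turn this into mean-square convergence ([L2_cvg]). The estimate therefore
    passes to the continuous-time partition function
    ([partition_function_dist]), shows that it is Cauchy in mean square, and by
    Fatou's lemma holds for the distance to the limit as well
    ([partition_function_limit]). *)

(** * Heat kernel of the discrete-time walk *)

Lemma bin_le_central n j : ('C(n.*2, j) <= 'C(n.*2, n))%N.
Proof.
have up i : (i < n)%N -> ('C(n.*2, i) <= 'C(n.*2, i.+1))%N.
  move=> lin; rewrite -(@leq_pmul2l i.+1)// mul_bin_left leq_mul2r.
  by apply/orP; right; lia.
have below k : (k <= n)%N -> ('C(n.*2, n - k) <= 'C(n.*2, n))%N.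
  elim: k => [|k IH] kn; first by rewrite subn0.
  apply: leq_trans (IH (ltnW kn)).
  by rewrite -(subnSK kn) up//; lia.
have [jn|nj] := leqP j n; first by rewrite -(subKn jn) below// leq_subr.
have [j2n|] := leqP j n.*2; last by move=> /bin_small ->.
rewrite -bin_sub// (_ : n.*2 - j = n - (j - n))%N; last by lia.
by rewrite below; lia.
Qed.

(** The left-hand side divided by [16 ^ n] decreases with [n]: one step
    multiplies it by [(2 n + 1) (2 n + 3) / (2 n + 2) ^ 2]. *)
Lemma central_bin_sqr n : ('C(n.*2, n) ^ 2 * n.*2.+1 <= 16 ^ n)%N.
Proof.
elim: n => [|n IH]; first by rewrite bin0.
have step : (n.+1 * 'C(n.+1.*2, n.+1) = 2 * n.*2.+1 * 'C(n.*2, n))%N.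
  have h1 := mul_bin_diag n.*2.+2 n.
  have h2 := mul_bin_down n.*2.+1 n.
  have e : (n.*2.+1 - n = n.+1)%N by lia.
  rewrite e /= in h1 h2; rewrite doubleS -h1.
  have -> : (n.*2.+2 = 2 * n.+1)%N by lia.
  by rewrite -mulnA -h2 mulnA.
rewrite -(@leq_pmul2l (n.+1 ^ 2)) ?expn_gt0// mulnA -expnMn step expnS.
rewrite !expnMn.
have : (n.*2.+1 * (n.*2.+1 * n.+1.*2.+1) * 'C(n.*2, n) ^ 2 <= 4 * n.+1 ^ 2 * 16 ^ n)%N.
  apply: (@leq_trans ((n.*2.+1 * n.+1.*2.+1) * 16 ^ n)).
    by rewrite -(leq_pmul2l (_ : 0 < n.+1.*2.+1)%N) // in IH; nia.
  by rewrite leq_mul2r; apply/orP; right; nia.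
by rewrite !expn1 !expnS; nia.
Qed.

Lemma bin_sqr_bound m j : ('C(m, j) ^ 2 * m.+1 <= 2 * 4 ^ m)%N.
Proof.
have even_case n i : ('C(n.*2, i) ^ 2 * n.*2.+1 <= 16 ^ n)%N.
  apply: leq_trans (central_bin_sqr n).
  by rewrite leq_mul2r leq_exp2r// bin_le_central orbT.
have e4 n : (4 ^ n.*2 = 16 ^ n)%N by rewrite -mul2n expnM.
rewrite -(odd_double_half m); case: (odd m) => /=; last first.
  by rewrite add0n e4 (leq_trans (even_case _ _))// leq_pmull.
set n := m./2; rewrite add1n (expnS 4) e4.
have: ('C(n.*2.+1, j) <= 2 * 'C(n.*2, n))%N.
  case: j => [|j]; first by rewrite bin0 muln_gt0 bin_gt0; lia.
  by rewrite binS mulSn mul1n leq_add ?bin_le_central.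
rewrite -(leq_exp2r _ _ (ltn0Sn 1)) expnMn => h.
have := central_bin_sqr n.
move: ('C(_, _) ^ 2)%N h => a h; move: ('C(_, _) ^ 2)%N h => b h h'.
by nia.
Qed.

Section line_walk.
Context {R : realType}.

(** Transition probabilities of the simple symmetric walk on [int]. *)
Fixpoint line_walk (m : nat) (k : int) : R :=
  if m is n.+1 then 2^-1 * (line_walk n (k - 1) + line_walk n (k + 1))
  else (k == 0)%:R.

(** After [m] steps, [j] of them upwards, the walk is at [2 j - m]. *)
Lemma line_walk_bin m :
  (forall j : nat, line_walk m (j.*2%:Z - m%:Z) = 'C(m, j)%:R / 2 ^+ m) /\
  (forall k, (forall j : nat, k <> j.*2%:Z - m%:Z) -> line_walk m k = 0).
Proof.
elim: m => [|m [IH1 IH2]]; split => /=.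
- case=> [|j]; first by rewrite subr0 bin0 divr1.
  by rewrite subr0 bin0n mul0r.
- move=> k; case: eqVneq => // -> /(_ 0%N)/=; by rewrite subr0.
- case=> [|j].
    have e1 : (0.*2%:Z - m.+1%:Z + 1 = 0.*2%:Z - m%:Z) by lia.
    rewrite e1 IH1 IH2 ?bin0 ?add0r ?exprS; first by field; rewrite expf_neq0.
    by move=> j; lia.
  have e1 : (j.+1.*2%:Z - m.+1%:Z + 1 = j.+1.*2%:Z - m%:Z) by lia.
  have e2 : (j.+1.*2%:Z - m.+1%:Z - 1 = j.*2%:Z - m%:Z) by lia.
  rewrite e1 e2 !IH1 binS natrD exprS; by field; rewrite expf_neq0.
- move=> k hk; rewrite !IH2 ?addr0 ?mulr0// => j hj.
    by apply: (hk j); lia.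
  by apply: (hk j.+1); lia.
Qed.

Lemma line_walk_ge0 m k : 0 <= line_walk m k.
Proof. by elim: m k => //= m IH k; rewrite mulr_ge0// addr_ge0. Qed.

Lemma line_walk_le1 m k : line_walk m k <= 1.
Proof.
elim: m k => /= [|m IH] k; first by case: (_ == _); rewrite ?ler01.
by have := IH (k - 1); have := IH (k + 1); lra.
Qed.

Lemma line_walk_sqr m k : line_walk m k ^+ 2 <= 2 / m.+1%:R.
Proof.
have [h1 h2] := line_walk_bin m.
have [[j ->]|nj] := pselect (exists j : nat, k = j.*2%:Z - m%:Z); last first.
  by rewrite h2 ?expr0n ?divr_ge0// => j jk; apply: nj; exists j.
rewrite h1 expr_div_n ler_pdivrMr ?exprn_gt0// mulrAC ler_pdivlMr//.
have := bin_sqr_bound m j; rewrite -(ler_nat R) natrM natrX natrM natrX.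
have -> : 4 = 2 ^+ 2 :> R by rewrite -natrX.
by rewrite -!exprM mulnC.
Qed.

End line_walk.

Section coordinates.
Context {R : realType} {d : nat}.

(** Average of [F] over all words of [n] coordinate choices, [F] seeing how
    often each coordinate was chosen. Given these numbers, the coordinates of
    the walk are independent walks on the line. *)
Fixpoint coord_avg (n : nat) (F : ('I_d -> nat) -> R) : R :=
  if n is m.+1 then
    d%:R^-1 * \sum_(i < d) coord_avg m (fun nu => F (fun l => nu l + (l == i))%N)
  else F (fun=> 0%N).

Lemma eq_coord_avg n F G : (forall nu, F nu = G nu) -> coord_avg n F = coord_avg n G.
Proof.
by elim: n F G => [|n IH] F G FG /=; rewrite ?FG//; congr (_ * _);
  apply: eq_bigr => i _; apply: IH.
Qed.

Lemma coord_avgD n F G :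
  coord_avg n (fun nu => F nu + G nu) = coord_avg n F + coord_avg n G.
Proof.
elim: n F G => [//|n IH] F G /=; rewrite -mulrDr -big_split/=; congr (_ * _).
by apply: eq_bigr => i _; rewrite IH.
Qed.

Lemma coord_avgZ n c F : coord_avg n (fun nu => c * F nu) = c * coord_avg n F.
Proof.
elim: n F => [//|n IH] F /=; rewrite mulrCA; congr (_ * _).
by rewrite mulr_sumr; apply: eq_bigr => i _; rewrite IH.
Qed.

Lemma ler_coord_avg n F G :
  (forall nu, F nu <= G nu) -> coord_avg n F <= coord_avg n G.
Proof.
elim: n F G => [|n IH] F G FG //=; rewrite ler_wpM2l ?invr_ge0//.
by apply: ler_sum => i _; apply: IH.
Qed.

Lemma coord_avg_le1 n F : (forall nu, F nu <= 1) -> coord_avg n F <= 1.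
Proof.
elim: n F => [|n IH] F F1 //=.
have [->|d0] := eqVneq d%:R (0 : R); first by rewrite invr0 mul0r.
rewrite mulrC ler_pdivrMr ?lt_def ?d0//= mul1r.
rewrite (le_trans (ler_sum _ (G := fun=> 1) _))//.
  by move=> i _; apply: IH.
by rewrite sumr_const card_ord.
Qed.

(** A uniform neighbour is a uniform coordinate together with a fair sign. *)
Lemma step_transition_coord n (z : 'rV[int]_d) : step_transition R n z =
  coord_avg n (fun nu => \prod_l line_walk (nu l) (z 0 l)).
Proof.
elim: n z => [|n IH] z /=.
  have [->|/rV0Pn[l zl]] := eqVneq z 0.
    by rewrite big1// => l _; rewrite mxE eqxx.
  by rewrite (bigD1 l)//= (negbTE zl) mul0r.
rewrite (eq_bigr (fun a : 'I_d * bool => (2 * d)%:R^-1 *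
   coord_avg n (fun nu => \prod_l line_walk (nu l) ((z - unit_vec (a.1, a.2)) 0 l)))); last first.
  by case=> i b _; rewrite IH.
rewrite -(pair_big xpredT xpredT (fun i b => (2 * d)%:R^-1 *
   coord_avg n (fun nu => \prod_l line_walk (nu l) ((z - unit_vec (i, b)) 0 l))))/=.
rewrite mulr_sumr; apply: eq_bigr => i _.
rewrite big_bool/= natrM invfM -mulrDr -coord_avgD -mulrA mulrCA -coord_avgZ.
congr (_ * _); apply: eq_coord_avg => nu.
have offi b l : l != i -> (z - unit_vec (i, b)) 0 l = z 0 l.
  by move=> li; rewrite !mxE eqxx (negbTE li) mulr0 subr0.
rewrite !(bigD1 i (P := xpredT))//= eqxx addn1 /=.
rewrite (eq_bigr (fun l => line_walk (nu l) (z 0 l))) => [|l /offi -> //].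
rewrite [in X in _ + X](eq_bigr (fun l => line_walk (nu l) (z 0 l))); last first.
  by move=> l /offi ->.
rewrite [RHS](_ : _ = 2^-1 * (line_walk (nu i) (z 0 i - 1) + line_walk (nu i) (z 0 i + 1)) *
  \prod_(l | l != i) line_walk (nu l) (z 0 l)); last first.
  by congr (_ * _); apply: eq_bigr => l /negbTE ->; rewrite addn0.
rewrite !mxE !eqxx/= expr0 expr1 mul1r mulr1 opprK; ring.
Qed.

End coordinates.

Section heat_kernel.
Context {R : realType} {d : nat}.
Implicit Types (n : nat) (l : 'I_d) (h : nat -> R).

(** Size biasing: [nu l] is a sum of [n.+1] indicators, each of mean [d^-1]. *)
Lemma coord_avg_size_bias n l h :
  coord_avg n.+1 (fun nu => (nu l)%:R * h (nu l)) =
  n.+1%:R / d%:R * coord_avg n (fun nu => h (nu l).+1).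
Proof.
elim: n h => [|n IH] h.
  rewrite /= mul1r; congr (_ * _); rewrite (bigD1 l)//= eqxx big1 ?addr0 ?mul1r//.
  by move=> i; rewrite eq_sym => /negbTE ->; rewrite mul0r.
transitivity (d%:R^-1 * \sum_(i < d)
   ((l == i)%:R * coord_avg n.+1 (fun nu => h (nu l).+1) +
    n.+1%:R / d%:R * coord_avg n (fun nu => h (nu l + (l == i))%N.+1))).
  congr (_ * _); apply: eq_bigr => i _.
  have IHi := IH (fun k => h (k + (l == i))%N).
  transitivity (coord_avg n.+1 (fun nu =>
      (nu l)%:R * h (nu l + (l == i))%N + (l == i)%:R * h (nu l).+1)).
    rewrite -[LHS]/(coord_avg n.+1 (fun nu =>
      (nu l + (l == i))%:R * h (nu l + (l == i))%N)).
    apply: eq_coord_avg => nu.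
    case: eqP => _; rewrite ?addn0 ?addn1 ?mul0r ?addr0//.
    by rewrite -[in LHS]natr1 mulrDl.
  by rewrite coord_avgD coord_avgZ IHi addrC.
rewrite big_split/= -mulr_suml -mulr_sumr.
rewrite (_ : \sum_(i < d) (l == i)%:R = 1); last first.
  rewrite (bigD1 l)//= eqxx big1 ?addr0// => i.
  by rewrite eq_sym => /negbTE ->.
rewrite mul1r mulrDr [X in _ + X]mulrCA -[(n.+2)%:R]natr1; rewrite /=; ring.
Qed.

(** Size biasing turns [1 / (nu + 1)] into the probability that [nu] is not [0]. *)
Lemma coord_avg_inv n l :
  coord_avg n (fun nu => (nu l).+1%:R^-1 : R) <= d%:R / n.+1%:R.
Proof.
have d0 : (0 : R) < d%:R by rewrite ltr0n (leq_ltn_trans _ (ltn_ord l)).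
rewrite -[leRHS]mul1r mulrA ler_pdivlMr ?ltr0n// mulrC.
rewrite -(@ler_pM2l _ d%:R^-1) ?invr_gt0// mulrA [_ * n.+1%:R]mulrC.
rewrite -(coord_avg_size_bias n l (fun k => k%:R^-1)) mul1r mulVf ?gt_eqF//.
apply: coord_avg_le1 => nu; have [->|k0] := eqVneq (nu l)%:R (0 : R).
  by rewrite mul0r.
by rewrite mulfV.
Qed.

Lemma coord_avg_inv2 n l :
  coord_avg n (fun nu => ((nu l).+1%:R * (nu l).+2%:R)^-1 : R) <=
  d%:R ^+ 2 / (n.+1%:R * n.+2%:R).
Proof.
have d0 : (0 : R) < d%:R by rewrite ltr0n (leq_ltn_trans _ (ltn_ord l)).
rewrite -[leRHS]mul1r expr2 -mulf_div [d%:R / _]mulrC mulrCA.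
rewrite -(@ler_pM2l _ (n.+1%:R / d%:R)) ?divr_gt0// mulrA.
rewrite -(coord_avg_size_bias n l (fun k => (k%:R * k.+1%:R)^-1)).
rewrite [leRHS](_ : _ = d%:R / n.+2%:R); last by field; rewrite !gt_eqF.
apply: le_trans (coord_avg_inv n.+1 l); apply: ler_coord_avg => nu.
have [->|k0] := eqVneq (nu l)%:R (0 : R); first by rewrite mul0r invr_ge0.
by rewrite invfM mulVKf.
Qed.

End heat_kernel.

Section heat_kernel_bound.
Context {R : realType} {d : nat}.

(** Three coordinates suffice: the probability that a walk on the line is at a
    given site after [m] steps is at most of order [m ^ (-1/2)]. Products of
    order [n ^ (-3/2)] are encoded by their family of upper bounds
    [l / n + 1 / (l n ^ 2)], which averages well over the random number of
    steps of a coordinate and, later, over the number of jumps. *)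
Lemma step_transition_ub n (z : 'rV[int]_d) (l : R) : (3 <= d)%N -> 0 < l ->
  step_transition R n z <=
  4 * d%:R ^+ 2 * (l / n.+1%:R + (l * (n.+1%:R * n.+2%:R))^-1).
Proof.
case: d z => [//|[//|[//|d']]] z _ l0; set D := d'.+3.
pose i0 : 'I_D := ord0; pose i1 : 'I_D := inord 1; pose i2 : 'I_D := inord 2.
have i10 : i1 != i0 by rewrite -val_eqE/= inordK.
have i20 : i2 != i0 by rewrite -val_eqE/= inordK.
have i21 : i2 != i1 by rewrite -val_eqE/= !inordK.
pose B (k : nat) : R := l / k.+1%:R + 4 * (l * (k.+1%:R * k.+2%:R))^-1.
have cube x k : 0 <= x -> x ^+ 2 <= 2 / k.+1%:R -> x ^+ 3 <= B k.
  move=> x0 xk; have y0 : 0 <= x ^+ 2 by rewrite exprn_ge0.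
  (* arithmetic-geometric mean of [l x^2] and [x^4 / l] *)
  have h1 : x ^+ 3 <= 2^-1 * (l * x ^+ 2 + l^-1 * (x ^+ 2) ^+ 2).
    rewrite -subr_ge0.
    rewrite (_ : _ - _ = 2^-1 * l^-1 * x ^+ 2 * (x - l) ^+ 2).
      by rewrite mulr_ge0 ?sqr_ge0// mulr_ge0// mulr_ge0// invr_ge0 ltW.
    by field; rewrite gt_eqF.
  apply: (le_trans h1); rewrite /B.
  have h2 : l * x ^+ 2 <= l * (2 / k.+1%:R) by rewrite ler_wpM2l// ltW.
  have h3 : (x ^+ 2) ^+ 2 <= 2 / k.+1%:R * (2 / k.+1%:R) by rewrite expr2 ler_pM.
  have h4 : 2 / k.+1%:R * (2 / k.+1%:R) <= 8 * (k.+1%:R * k.+2%:R)^-1 :> R.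
    rewrite -subr_ge0 -(natr1 k.+1).
    have k1 : 0 < k.+1%:R :> R by rewrite ltr0n.
    rewrite (_ : _ - _ = 4 * (k.+1%:R - 1) / (k.+1%:R ^+ 2 * (k.+1%:R + 1))).
      have k2 : 0 <= k.+1%:R - 1 :> R by rewrite subr_ge0 ler1n.
      by rewrite divr_ge0// mulr_ge0// ?sqr_ge0// addr_ge0.
    by move: (k.+1%:R) k1 => a a0; field; rewrite !gt_eqF// addr_gt0.
  have h5 : l^-1 * (x ^+ 2) ^+ 2 <= l^-1 * (8 * (k.+1%:R * k.+2%:R)^-1).
    by rewrite ler_wpM2l ?(le_trans h3)// invr_ge0 ltW.
  rewrite [(l * _)^-1]invfM.
  move: h2 h5; move: (k.+1%:R^-1) ((k.+1%:R * k.+2%:R)^-1) => u v.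
  move: (x ^+ 2) => w h2; move: (l^-1) (w ^+ 2) => l' w' h5; lra.
rewrite step_transition_coord.
have : coord_avg n (fun nu => \prod_l line_walk (nu l) (z 0 l)) <=
    coord_avg n (fun nu => 3^-1 * (B (nu i0) + B (nu i1) + B (nu i2))).
  apply: ler_coord_avg => nu.
  rewrite (bigD1 i0)//= (bigD1 i1)//= (bigD1 i2) ?i20//=.
  set P := \prod_(_ | _) _.
  have P0 : 0 <= P by apply: prodr_ge0 => i _; exact: line_walk_ge0.
  have P1 : P <= 1.
    suff /andP[] : 0 <= P <= 1 by [].
    rewrite /P; elim/big_ind : _ => [|x y|i _]; first by rewrite ler01 lexx.
      by move=> /andP[x0 x1] /andP[y0 y1]; rewrite mulr_ge0// mulr_ile1.
    by rewrite line_walk_ge0 line_walk_le1.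
  have c i : line_walk (nu i) (z 0 i) ^+ 3 <= B (nu i).
    by apply: cube; [exact: line_walk_ge0|exact: line_walk_sqr].
  have lw0 i : 0 <= line_walk (nu i) (z 0 i) :> R by exact: line_walk_ge0.
  move: (lw0 i0) (lw0 i1) (lw0 i2) (c i0) (c i1) (c i2).
  move: (line_walk _ (z 0 i0)) (line_walk _ (z 0 i1)) (line_walk _ (z 0 i2)).
  move=> x y w x0 y0 w0 hx hy hw.
  have h : x * (y * (w * P)) <= x * (y * w).
    by rewrite !ler_wpM2l// ler_piMr.
  apply: (le_trans h).
  have : 0 <= (x + y + w) * ((x - y) ^+ 2 + (y - w) ^+ 2 + (x - w) ^+ 2).
    by rewrite mulr_ge0 ?addr_ge0 ?sqr_ge0.
  nra.
move=> /le_trans; apply.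
rewrite coord_avgZ 2!coord_avgD.
have BE (i : 'I_D) : coord_avg n (fun nu => B (nu i)) <=
    4 * D%:R ^+ 2 * (l / n.+1%:R + (l * (n.+1%:R * n.+2%:R))^-1).
  have -> : coord_avg n (fun nu => B (nu i)) = coord_avg n (fun nu =>
      l * (nu i).+1%:R^-1 + 4 * l^-1 * ((nu i).+1%:R * (nu i).+2%:R)^-1).
    by apply: eq_coord_avg => nu; rewrite /B invfM mulrA.
  rewrite coord_avgD !coord_avgZ.
  have h1 := coord_avg_inv (R := R) n i.
  have h2 := coord_avg_inv2 (R := R) n i.
  have h3 : l * coord_avg n (fun nu => (nu i).+1%:R^-1 : R) <= l * (D%:R / n.+1%:R) by rewrite ler_wpM2l// ltW.
  have h4 : 4 * l^-1 * coord_avg n (fun nu => ((nu i).+1%:R * (nu i).+2%:R)^-1 : R) <= 4 * l^-1 * (D%:R ^+ 2 / (n.+1%:R * n.+2%:R)).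
    by rewrite ler_wpM2l// mulr_ge0// invr_ge0 ltW.
  apply: (le_trans (lerD h3 h4)).
  rewrite [leRHS]mulrDr lerD//.
    rewrite mulrCA ler_wpM2r ?divr_ge0 ?ltW//.
    have D1 : 1 <= D%:R :> R by rewrite ler1n.
    nra.
  rewrite [(l * _)^-1]invfM; move: (_ * _)^-1 (l^-1) => u v; lra.
move: (BE i0) (BE i1) (BE i2); move: (4 * _ * _) => K.
move: (coord_avg n (fun nu => B (nu i0))) (coord_avg n (fun nu => B (nu i1))).
move: (coord_avg n (fun nu => B (nu i2))) => u v w; lra.
Qed.

Lemma step_transition_ge0 n (z : 'rV[int]_d) : 0 <= step_transition R n z.
Proof.
elim: n z => [|n IH] z //=; apply: sumr_ge0 => a _.
by rewrite mulr_ge0 ?invr_ge0.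
Qed.

End heat_kernel_bound.

(** * The constants [alpha] and [lambda] *)

Section alpha.
Context {R : realType} {d : nat}.

Lemma step_transition_mass n (s : seq 'rV[int]_d) : uniq s ->
  \sum_(z <- s) step_transition R n z <= 1.
Proof.
elim: n s => [|n IH] s us /=.
  have [s0|s0] := boolP (0 \in s); last first.
    rewrite big_seq big1 ?ler01// => z zs; case: eqP zs => // -> .
    by rewrite (negbTE s0).
  rewrite (perm_big _ (perm_to_rem s0)) big_cons eqxx/= big_seq big1 ?addr0//.
  move=> z; rewrite mem_rem_uniq// inE => /andP[/negbTE/= h _].
  by move: h => /= ->.
rewrite exchange_big/=.
apply: (@le_trans _ _ (\sum_(a : 'I_d * bool) (2 * d)%:R^-1)).
  apply: ler_sum => a _; rewrite -mulr_sumr ler_piMr ?invr_ge0//.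
  rewrite -(big_map (fun z => z - unit_vec a) xpredT (step_transition R n)).
  by apply: IH; rewrite map_inj_uniq//; exact: addIr.
rewrite sumr_const card_prod card_ord card_bool mulnC -[leLHS]mulr_natr.
have [->|d0] := eqVneq (d * 2)%:R (0 : R); first by rewrite mulr0.
by rewrite mulVf.
Qed.

(** Telescoping: the summand is at most [2 / sqrt n - 2 / sqrt (n + 1)]. *)
Lemma sum_inv_sqrt3 N :
  \sum_(1 <= n < N.+1) (n.+1%:R * Num.sqrt (n.+1%:R : R))^-1 <=
  2 - 2 / Num.sqrt N.+1%:R.
Proof.
elim: N => [|N IH].
  by rewrite big_geq// sqrtr1 divr1 subrr.
rewrite big_nat_recr//= (le_trans (lerD IH (lexx _)))//.
have y0 : 0 < Num.sqrt (N.+1%:R : R) by rewrite sqrtr_gt0.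
have yN : Num.sqrt (N.+1%:R : R) ^+ 2 = N.+1%:R by rewrite sqr_sqrtr.
have w0 : 0 < Num.sqrt (N.+2%:R : R) by rewrite sqrtr_gt0.
have wN : Num.sqrt (N.+2%:R : R) ^+ 2 = N.+2%:R by rewrite sqr_sqrtr.
have yw : Num.sqrt (N.+1%:R : R) <= Num.sqrt N.+2%:R by rewrite ler_sqrt// ler_nat.
have wy : Num.sqrt (N.+2%:R : R) ^+ 2 = Num.sqrt (N.+1%:R : R) ^+ 2 + 1.
  by rewrite wN yN natr1.
rewrite -[X in (X * _)^-1]wN; move: wy yw y0 w0; clear.
move: (Num.sqrt _) (Num.sqrt _) => y w wy yw y0 w0.
rewrite -subr_ge0.
have -> : 2 - 2 / w - (2 - 2 / y + (w ^+ 2 * w)^-1) =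
  (2 * w ^+ 2 * (w - y) - y) / (y * w ^+ 3).
  by field; rewrite !gt_eqF.
apply: divr_ge0; last by rewrite mulr_ge0 ?exprn_ge0 ?ltW.
have h : (w - y) * (w + y) = 1 by rewrite -subr_sqr wy addrAC subrr add0r.
have : 0 <= (w - y) * (w ^+ 2 - y * (w + y) + w ^+ 2).
  apply: mulr_ge0; first by rewrite subr_ge0.
  nra.
nra.
Qed.

(** [step_transition_ub] with the optimal [l], of order [n ^ (-1/2)]. *)
Lemma step_transition_sqrt n (z : 'rV[int]_d) : (3 <= d)%N ->
  step_transition R n z <=
  8 * d%:R ^+ 2 * (n.+1%:R * Num.sqrt (n.+1%:R : R))^-1.
Proof.
move=> d3; set y := Num.sqrt _.
have y0 : 0 < y by rewrite sqrtr_gt0.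
have yN : y ^+ 2 = n.+1%:R by rewrite sqr_sqrtr.
apply: le_trans (step_transition_ub n z d3 (_ : 0 < y^-1)) _; first by rewrite invr_gt0.
rewrite (_ : 8 * _ = 4 * d%:R ^+ 2 * 2); last by ring.
rewrite -[leRHS]mulrA ler_wpM2l ?mulr_ge0 ?sqr_ge0//.
rewrite -(natr1 n.+1) -yN -subr_ge0.
rewrite (_ : _ - _ = 1 / (y ^+ 3 * (y ^+ 2 + 1))); last first.
  by field; rewrite (gt_eqF y0) andbT gt_eqF// ltr_wpDl// sqr_ge0.
by rewrite divr_ge0// mulr_ge0 ?exprn_ge0 ?addr_ge0 ?sqr_ge0// ltW.
Qed.

(** The sum of [q_n^2] over sites is at most the maximum of [q_n], which is
    summable in dimension three; positivity is seen after one step. *)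
Lemma alpha_fin_gt0 : (3 <= d)%N ->
  alpha R d \is a fin_num /\ 0 < fine (alpha R d).
Proof.
move=> d3; set k : R := 8 * d%:R ^+ 2.
have k0 : 0 <= k by rewrite mulr_ge0// sqr_ge0.
have term n : (\esum_(z in [set: 'rV[int]_d]) ((step_transition R n z) ^+ 2)%:E
    <= (k * (n.+1%:R * Num.sqrt (n.+1%:R : R))^-1)%:E)%E.
  set b := _ * _^-1.
  have b0 : 0 <= b by rewrite mulr_ge0// invr_ge0 mulr_ge0// sqrtr_ge0.
  apply: ge_ereal_sup => _ [X [fX _] <-].
  rewrite fsbig_finite//= sumEFin lee_fin.
  apply: (@le_trans _ _ (\sum_(z <- fset_set X) b * step_transition R n z)).
    apply: ler_sum => z _; rewrite expr2 ler_wpM2r ?step_transition_ge0//.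
    exact: step_transition_sqrt.
  by rewrite -mulr_sumr ler_piMr// step_transition_mass// fset_uniq.
have term0 n : (0 <= \esum_(z in [set: 'rV[int]_d]) ((step_transition R n z) ^+ 2)%:E)%E.
  by apply: esum_ge0 => z _; rewrite lee_fin sqr_ge0.
have up : (alpha R d <= (2 * k)%:E)%E.
  apply: lime_le; first exact: is_cvg_nneseries.
  near=> N.
  have [->|N0] := posnP N; first by rewrite big_geq// lee_fin mulr_ge0.
  rewrite -(prednK N0); move: N.-1 => N'.
  apply: (@le_trans _ _ (\sum_(1 <= n < N'.+1) (k * (n.+1%:R * Num.sqrt (n.+1%:R : R))^-1)%:E)%E).
    by apply: lee_sum => i _; exact: term.
  rewrite sumEFin lee_fin -mulr_sumr mulrC ler_wpM2r//.
  apply: le_trans (sum_inv_sqrt3 N') _.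
  by rewrite lerBlDr lerDl divr_ge0// sqrtr_ge0.
(* one step to a fixed neighbour *)
have lo : ((((2 * d)%:R^-1) ^+ 2)%:E <= alpha R d)%E.
  apply: le_trans (nneseries_lim_ge 2%N _); last by [].
  rewrite big_nat1; apply: esum_ge.
  pose a : 'I_d * bool := (Ordinal (leq_trans (ltn0Sn 2) d3), false).
  exists [set unit_vec a]; first by split.
  rewrite fsbig_set1 lee_fin ler_sqr ?nnegrE ?invr_ge0 ?step_transition_ge0//=.
  rewrite (bigD1 a)//= subrr eqxx mulr1 lerDl sumr_ge0//.
have af : alpha R d \is a fin_num.
  rewrite ge0_fin_numE; first by rewrite (le_lt_trans up)// ltry.
  by rewrite (le_trans _ lo)// lee_fin sqr_ge0.
split=> //; rewrite -lte_fin fineK// (lt_le_trans _ lo)// lte_fin.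
by rewrite exprn_gt0// invr_gt0 ltr0n muln_gt0/= (leq_trans _ d3).
Unshelve. all: by end_near. Qed.

(** The integrand is [1 / (1 - beta^2)] times the exponential density of rate
    [1 - beta^2] minus that of rate [1]. *)
Lemma lambdaE (beta : R) : 0 < beta < 1 ->
  lambda beta = (beta ^+ 2 / (1 - beta ^+ 2))%:E.
Proof.
move=> /andP[b0 b1].
have r0 : 0 < 1 - beta ^+ 2 by rewrite subr_gt0 expr_lt1// ltW.
rewrite /lambda.
under eq_integral => u _.
  rewrite (_ : _ * _ = (1 - beta ^+ 2)^-1 * exponential_pdf (1 - beta ^+ 2) u - exponential_pdf 1 u); last first.
    have [u0|u0] := leP 0 u; last by rewrite !lt0_exponential_pdf// !mulr0 subr0.
    rewrite !exponential_pdfE//.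
    rewrite mulKf ?gt_eqF// mul1r mulrBl -expRD mul1r; congr (expR _ - _); ring.
  rewrite EFinB EFinM.
  over.
have i1 : lebesgue_measure.-integrable setT (EFin \o exponential_pdf (1 - beta ^+ 2)).
  exact: integrable_exponential_pdf.
have i2 : lebesgue_measure.-integrable setT (EFin \o exponential_pdf (1 : R)).
  exact: integrable_exponential_pdf.
rewrite integralB//=; last exact: integrableZl.
rewrite integralZl// !integral_exponential_pdf// mule1 -EFinB; congr EFin.
by field; rewrite gt_eqF.
Qed.

End alpha.

(** * Discrete random elements *)

Section countable_fibres.
Context {dT : measure_display} {T : measurableType dT}.

(** The walk, its jump numbers and its past take countably many values, so
    measurability and conditioning reduce to their fibres. *)
Definition countable_rv {U : countType} (V : T -> U) :=
  forall v, measurable (V @^-1` [set v]).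

Lemma countable_rv_preimage (U : countType) (V : T -> U) (B : set U) :
  countable_rv V -> measurable (V @^-1` B).
Proof.
move=> mV; rewrite (_ : V @^-1` B = \bigcup_v (V @^-1` ([set v] `&` B))).
  apply: countable_bigcupT_measurable => [|v]; first exact: countableP.
  rewrite preimage_setI; have [Bv|Bv] := pselect (B v).
    rewrite (_ : _ `&` _ = V @^-1` [set v])//.
    by apply/seteqP; split=> [x []//|x /= xv]; split=> //; rewrite /= xv.
  rewrite (_ : _ `&` _ = set0); first exact: measurable0.
  by apply/seteqP; split=> [x [/= -> //]|//].
by apply/seteqP; split=> [x Bx|x [v _ []//]]; exists (V x).
Qed.

Lemma countable_rv_comp (U U' : countType) (V : T -> U) (f : U -> U') :
  countable_rv V -> countable_rv (f \o V).
Proof.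
by move=> mV v; rewrite comp_preimage; apply: countable_rv_preimage.
Qed.

Lemma countable_rv_pair (U U' : countType) (V : T -> U) (V' : T -> U') :
  countable_rv V -> countable_rv V' -> countable_rv (fun w => (V w, V' w)).
Proof.
move=> mV mV' [u u'].
rewrite (_ : _ @^-1` _ = V @^-1` [set u] `&` V' @^-1` [set u']).
  exact: measurableI.
by apply/seteqP; split=> w /= => [[-> ->]|[-> ->]].
Qed.

Lemma countable_rv_cst (U : countType) (u : U) : countable_rv (fun _ : T => u).
Proof.
move=> v; have [->|uv] := eqVneq u v.
  by rewrite (_ : _ @^-1` _ = setT)//; apply/seteqP; split.
rewrite (_ : _ @^-1` _ = set0)//; apply/seteqP; split=> // x /= uv'.
by rewrite uv' eqxx in uv.
Qed.

Lemma countable_rv_seq (U : countType) (V : nat -> T -> U) (s : seq nat) :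
  (forall i, countable_rv (V i)) -> countable_rv (fun w => [seq V i w | i <- s]).
Proof.
move=> mV; elim: s => [|i s IH]; first exact: countable_rv_cst.
apply: (@countable_rv_comp (U * seq U)%type (seq U)
   (fun w => (V i w, [seq V i w | i <- s])) (fun p => p.1 :: p.2)).
exact: countable_rv_pair.
Qed.

Lemma countable_rv_index (U U' : countType) (N : T -> U) (V : U -> T -> U') :
  countable_rv N -> (forall n, countable_rv (V n)) -> countable_rv (fun w => V (N w) w).
Proof.
move=> mN mV v.
rewrite (_ : _ @^-1` _ = \bigcup_n (N @^-1` [set n] `&` V n @^-1` [set v])).
  apply: countable_bigcupT_measurable => [|n]; first exact: countableP.
  by apply: measurableI; [exact: mN|exact: mV].
apply/seteqP; split=> [w /= <-|w [n _ [/= -> //]]].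
by exists (N w).
Qed.

Lemma measurable_fun_countable_rv (d' : measure_display) (Y : measurableType d')
    (U : countType) (V : T -> U) (f : U -> Y) :
  countable_rv V -> measurable_fun setT (f \o V).
Proof.
by move=> mV _ B mB; rewrite setTI comp_preimage; exact: countable_rv_preimage.
Qed.

Lemma measurable_fun_countable_rv_pair (d1 d2 : measure_display)
    (S : measurableType d1) (Y : measurableType d2) (U : countType) (V : T -> U)
    (f : U -> S -> Y) :
  countable_rv V -> (forall u, measurable_fun setT (f u)) ->
  measurable_fun setT (fun p : T * S => f (V p.1) p.2).
Proof.
move=> mV mf _ B mB; rewrite setTI.
rewrite (_ : _ @^-1` _ = \bigcup_u ((V @^-1` [set u]) `*` (f u @^-1` B))).
  apply: countable_bigcupT_measurable => [|u]; first exact: countableP.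
  by apply: measurableX => //; rewrite -[X in measurable X]setTI; apply: mf.
apply/seteqP; split=> [[w s] /= Bw|[w s] [u _ [/= -> //]]].
by exists (V w).
Qed.

Context {R : realType}.

Lemma esum_countType (U : countType) (a : U -> \bar R) :
  (forall u, 0 <= a u)%E -> (\esum_(u in [set: U]) a u =
  \sum_(n <oo) (if pickle_inv (T := U) n is Some u then a u else 0))%E.
Proof.
move=> a0; rewrite nneseries_esumT; last by move=> n; case: pickle_inv.
transitivity (\esum_(n in range (@choice.pickle U)) (if pickle_inv (T := U) n is Some u then a u else 0))%E.
  rewrite (esum_image setT (@choice.pickle U)); last first.
    by move=> x y _ _; exact: (pcan_inj choice.pickleK).
  by apply: eq_esum => u _; rewrite pickleK_inv.
rewrite esum_mkcond; apply: eq_esum => n _; case: ifPn => // /negP nr.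
case E : (pickle_inv (T := U) n) => [u|]//; exfalso; apply: nr.
by rewrite inE; exists u => //; have := @pickle_invK U n; rewrite /oapp E.
Qed.

(** Stands for conditional expectation throughout. *)
Lemma ge0_integral_countable_rv (mu : {measure set T -> \bar R}) (U : countType)
    (V : T -> U) (f : T -> \bar R) : countable_rv V ->
  measurable_fun setT f -> (forall w, 0 <= f w)%E ->
  (\int[mu]_w f w = \esum_(v in [set: U]) \int[mu]_(w in V @^-1` [set v]) f w)%E.
Proof.
move=> mV mf f0; rewrite esum_countType; last by move=> v; apply: integral_ge0.
pose F n := if pickle_inv (T := U) n is Some u then V @^-1` [set u] else set0.
transitivity (\int[mu]_(w in \bigcup_n F n) f w)%E.
  congr integral; apply/seteqP; split=> // w _.
  by exists (choice.pickle (V w)) => //; rewrite /F pickleK_inv.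
rewrite ge0_integral_bigcup//.
- by apply: eq_eseriesr => n _; rewrite /F; case: pickle_inv => //; rewrite integral_set0.
- by move=> n; rewrite /F; case: pickle_inv => //.
- exact: measurable_funTS.
- apply/trivIsetP => i j _ _ ij; apply/seteqP; split=> // w; rewrite /F => -[].
  move: ij; have := @pickle_invK U i; have := @pickle_invK U j.
  case: pickle_inv => [u|]//=; case: pickle_inv => [u'|]//= <- <- ij uu uu'.
  by rewrite -uu -uu' eqxx in ij.
Qed.

End countable_fibres.

(** * Products of independent random variables *)

Section layer_cake.
Context {dT : measure_display} {T : measurableType dT} {R : realType}.

Lemma measurable_level (mu : {sigma_finite_measure set T -> \bar R})
    (H : T -> \bar R) (X : T -> R) :
  measurable_fun setT H -> (forall w, 0 <= H w)%E -> measurable_fun setT X ->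
  measurable_fun setT (fun t : R => \int[mu]_(w in [set w | (t < X w)%R]) H w)%E.
Proof.
move=> mH H0 mX; pose A : set (T * R) := [set p | p.2 < X p.1].
have mA : measurable A.
  rewrite -[X in measurable X]setTI.
  apply: (@measurable_fun_ltr _ _ R setT snd (X \o fst)) => //.
  exact: measurableT_comp.
pose F (p : T * R) : \bar R := (H p.1 * (\1_A p)%:E)%E.
have mF : measurable_fun setT F.
  apply: emeasurable_funM; first exact: measurableT_comp.
  by apply/measurable_EFinP; exact: measurable_indic.
have F0 p : (0 <= F p)%E by rewrite mule_ge0// lee_fin.
have := @measurable_fun_fubini_tonelli_G _ _ _ _ R mu F mF F0.
congr measurable_fun; apply/funext => t; rewrite [RHS]integral_mkcond.
apply: eq_integral => w _; rewrite /F patchE indicE.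
rewrite (_ : ((w, t) \in A) = (w \in [set w | t < X w])); last first.
  by apply/idP/idP; rewrite !inE.
by case: ifPn => _; rewrite ?mule1 ?mule0.
Qed.

(** Integrals against a weight [H] only see the weights of the level sets of
    [X]. This replaces changes of variables and approximations by simple
    functions. *)
Lemma layer_cake (mu : {sigma_finite_measure set T -> \bar R})
    (H : T -> \bar R) (X : T -> R) :
  measurable_fun setT H -> (forall w, 0 <= H w)%E ->
  measurable_fun setT X -> (forall w, 0 <= X w) ->
  (\int[mu]_w (H w * (X w)%:E) =
   \int[lebesgue_measure]_(t in `[0%R, +oo[) \int[mu]_(w in [set w | (t < X w)%R]) H w)%E.
Proof.
move=> mH H0 mX X0.
pose A : set (T * R) := [set p | 0 <= p.2 /\ p.2 < X p.1].
have mA : measurable A.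
  rewrite (_ : A = [set p | 0 <= p.2] `&` [set p | p.2 < X p.1]); last first.
    by apply/seteqP; split=> p [].
  apply: measurableI.
    rewrite -[X in measurable X]setTI.
    apply: (@measurable_fun_ler _ _ R setT (cst 0) snd) => //.
  rewrite -[X in measurable X]setTI.
  apply: (@measurable_fun_ltr _ _ R setT snd (X \o fst)) => //.
  exact: measurableT_comp.
pose F (p : T * R) : \bar R := (H p.1 * (\1_A p)%:E)%E.
have mF : measurable_fun setT F.
  apply: emeasurable_funM; first exact: measurableT_comp.
  by apply/measurable_EFinP; exact: measurable_indic.
have F0 p : (0 <= F p)%E by rewrite mule_ge0// lee_fin.
transitivity (\int[mu]_w \int[lebesgue_measure]_t F (w, t))%E.
  apply: eq_integral => w _; rewrite /F/=.
  rewrite ge0_integralZl//; last first.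
  - apply/measurable_EFinP; have mI := @measurable_indic _ _ R _ _ mA.
    exact: (measurableT_comp (mI setT) (pair1_measurable w)).
  - congr (_ * _)%E.
    transitivity (\int[lebesgue_measure]_(t in [set: R])
        (\1_(`[0, X w[%classic : set R) t)%:E)%E.
      transitivity (lebesgue_measure (`[0, X w[%classic : set R)).
        rewrite lebesgue_measure_itv/= lte_fin; have := X0 w; rewrite le_eqVlt.
        by move=> /predU1P[<-|->]; rewrite ?ltxx// oppr0 adde0.
      by rewrite integral_indic// setIT.
    apply: eq_integral => t _; congr EFin; rewrite !indicE.
    congr (nat_of_bool _)%:R; apply/idP/idP; rewrite !inE /A/= in_itv/=.
      by move=> /andP.
    by move=> [-> ->].
rewrite fubini_tonelli// [RHS]integral_mkcond; apply: eq_integral => t _.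
rewrite patchE mem_setE in_itv/= andbT; case: ifPn => t0; last first.
  apply: integral0_eq => w _; rewrite /F indicE memNset ?mule0// => -[/= t0' _].
  by rewrite t0' in t0.
rewrite [RHS]integral_mkcond; apply: eq_integral => w _.
rewrite /F patchE indicE; have [tX|tX] := boolP (w \in [set w | t < X w]).
  by rewrite mem_set ?mule1//; split=> //; move: tX; rewrite inE.
by rewrite memNset ?mule0// => -[_ /= h]; move: tX; rewrite notin_setE.
Qed.

End layer_cake.

Section independence.
Context {dT : measure_display} {T : measurableType dT} {R : realType}.
Variable P : probability T R.

Lemma independent_prod (I : choiceType) (G : I -> set_system T) (s : seq I)
    (A : I -> set T) : independent P G -> uniq s ->
  (forall i, i \in s -> G i (A i)) ->
  P (\bigcap_(i in [set` s]) A i) = (\prod_(i <- s) P (A i))%E.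
Proof.
move=> iG us GA.
have := iG [fset i in s]%fset A; rewrite (_ : [set` _] = [set` s]); last first.
  by apply/seteqP; split=> i /=; rewrite !inE.
move=> -> => [|i]; last by rewrite !inE; exact: GA.
apply: perm_big; apply: uniq_perm => // i; by rewrite !inE.
Qed.

(** The factors are turned one by one into indicators of their level sets, for
    which independence is assumed: the list [s1] holds the factors still to be
    treated, [s2] those already replaced by events. *)
Lemma independent_expectation_prod (I : choiceType) (G : I -> set_system T)
    (X : I -> T -> R) (s : seq I) : independent P G -> uniq s ->
  (forall i, G i `<=` measurable) ->
  (forall i w, 0 <= X i w) ->
  (forall i B, measurable B -> G i (X i @^-1` B)) ->
  (\int[P]_w (\prod_(i <- s) X i w)%:E = \prod_(i <- s) \int[P]_w (X i w)%:E)%E.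
Proof.
move=> iG us mG X0 GX.
have mX i : measurable_fun setT (X i).
  by move=> _ B mB; rewrite setTI; apply: mG; exact: GX.
suff claim (s1 s2 : seq I) (A : I -> set T) : uniq (s1 ++ s2) ->
    (forall i, i \in s2 -> G i (A i)) ->
    (\int[P]_(w in \bigcap_(i in [set` s2]) A i) (\prod_(i <- s1) X i w)%:E =
     (\prod_(i <- s1) \int[P]_w (X i w)%:E) * \prod_(i <- s2) P (A i))%E.
  have := claim s [::] (fun=> setT); rewrite cats0 big_nil mule1 => <-//.
  by rewrite (_ : [set` [::]] = set0) ?bigcap_set0//; apply/seteqP; split.
elim: s1 s2 A => [|i s1 IH] s2 A us12 GA.
  under eq_integral do rewrite big_nil.
  have mA : measurable (\bigcap_(i in [set` s2]) A i).
    apply: fin_bigcap_measurable => // j /= js; apply: mG; exact: GA.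
  by rewrite integral_cst// !mul1e -(independent_prod iG)//; rewrite big_nil mul1e.
have /= /andP[is12 us12'] := us12.
have is2 : i \notin s2 by move: is12; rewrite mem_cat negb_or => /andP[].
set D := \bigcap_(_ in _) _.
have mD : measurable D.
  apply: fin_bigcap_measurable => // j /= js; apply: mG; exact: GA.
pose H w : \bar R := ((\prod_(j <- s1) X j w)%:E * (\1_D w)%:E)%E.
have mp : measurable_fun setT (fun w => (\prod_(j <- s1) X j w)%:E).
  by apply/measurable_EFinP; apply: measurable_prod => j _; exact: mX.
have p0 w : (0 <= (\prod_(j <- s1) X j w)%:E)%E by rewrite lee_fin prodr_ge0.
have mH : measurable_fun setT H.
  apply: emeasurable_funM => //.
  by apply/measurable_EFinP; exact: measurable_indic.
have H0 w : (0 <= H w)%E by rewrite mule_ge0// lee_fin.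
have E0 j : (0 <= \int[P]_w (X j w)%:E)%E by apply: integral_ge0 => w _; rewrite lee_fin.
set c := (\prod_(j <- s1) \int[P]_w (X j w)%:E)%E.
set q := (\prod_(j <- s2) P (A j))%E.
have c0 : (0 <= c)%E by apply: prode_ge0 => j _.
have q0 : (0 <= q)%E by apply: prode_ge0 => j _.
transitivity (\int[P]_w (H w * (X i w)%:E))%E.
  rewrite integral_mkcond; apply: eq_integral => w _.
  rewrite patchE /H indicE; case: ifPn => wD.
    by rewrite mule1 -EFinM big_cons mulrC.
  by rewrite mule0 mul0e.
rewrite layer_cake//.
transitivity (\int[lebesgue_measure]_(t in `[0%R, +oo[) ((c * q) * \int[P]_(w in [set w | (t < X i w)%R]) (cst 1 w)))%E.
  apply: eq_integral => t _.
  pose A' j := if j == i then [set w | t < X i w] else A j.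
  have := IH (i :: s2) A'; rewrite -cat_rcons -cats1 -catA/=.
  have -> : uniq (s1 ++ i :: s2) by rewrite -(perm_uniq (permEl (perm_catCA [:: i] s1 s2))).
  move=> /(_ isT) IH'.
  have mt : G i [set w | t < X i w].
    rewrite (_ : [set w | _] = X i @^-1` `]t, +oo[%classic); first exact: GX.
    by apply/seteqP; split=> w /=; rewrite in_itv/= andbT.
  rewrite integral_cst; last exact: mG mt.
  rewrite mul1e; transitivity (c * \prod_(j <- i :: s2) P (A' j))%E.
    rewrite -IH'; last first.
      move=> j; rewrite inE /A'; case: eqVneq => [-> //|ji /=]; exact: GA.
    rewrite integral_mkcond [RHS]integral_mkcond; apply: eq_integral => w _.
    rewrite !patchE /H indicE.
    have -> : w \in \bigcap_(j in [set` (i :: s2)]) A' j =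
        (w \in [set w | t < X i w]) && (w \in D).
      apply/idP/andP => [|[]]; rewrite !inE/= => h.
        split.
          by have := h i; rewrite /= inE eqxx /A' eqxx; apply.
        move=> j /= js; have := h j; rewrite /= inE js orbT /A'.
        have /negbTE -> : j != i by apply: contraNneq is2 => <-.
        exact.
      move=> h2 j /=; rewrite inE /A'.
      by case: eqVneq => [_ _ //|_ /= js]; exact: h2.
    case: ifPn => //= _; case: ifPn => _; by rewrite ?mule1 ?mule0.
  rewrite big_cons /A' eqxx -muleA [(P _ * _)%E]muleC; congr (_ * (_ * _))%E.
  rewrite big_seq [in RHS]/q big_seq; apply: eq_bigr => j js.
  by have /negbTE -> : j != i by apply: contraNneq is2 => <-.
rewrite ge0_integralZl//; last 2 first.
- by move=> t _; apply: integral_ge0.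
- by rewrite mule_ge0.
- rewrite -(layer_cake P (H := cst 1%E))//.
  under eq_integral do rewrite mul1e.
  by rewrite muleC big_cons muleA.
- by apply: measurable_funTS; apply: measurable_level.
Qed.

(** Exponential tilting of the normal density shifts its mean. *)
Lemma gaussian_exp_moment (X : T -> R) (h c : R) : 0 < h ->
  measurable_fun setT X ->
  (forall B, measurable B -> P (X @^-1` B) = normal_prob 0 (Num.sqrt h) B) ->
  (\int[P]_w (expR (c * X w))%:E = (expR (c ^+ 2 * h / 2))%:E)%E.
Proof.
move=> h0 mX lawX.
have s0 : Num.sqrt h != 0 by rewrite gt_eqF// sqrtr_gt0.
have me : measurable_fun setT (fun x : R => expR (c * x)).
  by apply: measurableT_comp => //; exact: measurable_funM.
transitivity (\int[P]_w (cst 1 w * (expR (c * X w))%:E))%E.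
  by apply: eq_integral => w _; rewrite mul1e.
rewrite layer_cake//; last exact: (measurableT_comp me mX).
transitivity (\int[lebesgue_measure]_(x in [set: R])
    ((normal_pdf 0 (Num.sqrt h) x)%:E * (expR (c * x))%:E))%E.
  rewrite layer_cake//.
  - apply: eq_integral => t _.
    have mt : measurable [set x : R | t < expR (c * x)].
      rewrite -[X in measurable X]setTI.
      exact: (@measurable_fun_ltr _ _ R setT (cst t) (fun x => expR (c * x))).
    have := lawX _ mt; rewrite /normal_prob => <-.
    rewrite integral_cst ?mul1e//.
    by rewrite -[X in measurable X]setTI; exact: (mX measurableT _ mt).
  - by apply/measurable_EFinP; exact: measurable_normal_pdf.
  - by move=> x; rewrite lee_fin normal_pdf_ge0.
transitivity (\int[lebesgue_measure]_(x in [set: R])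
    ((expR (c ^+ 2 * h / 2))%:E * (normal_pdf (c * h) (Num.sqrt h) x)%:E))%E.
  apply: eq_integral => x _; rewrite -!EFinM; congr EFin.
  rewrite !normal_pdfE// [RHS]mulrCA -[LHS]mulrA; congr (_ * _).
  rewrite /normal_fun -!expRD sqr_sqrtr ?ltW//; congr expR.
  by field; rewrite gt_eqF.
rewrite ge0_integralZl ?lee_fin ?expR_ge0//.
- by rewrite integral_normal_pdf mule1.
- by apply/measurable_EFinP; exact: measurable_normal_pdf.
- by move=> x _; rewrite lee_fin normal_pdf_ge0.
Qed.

End independence.

(** * Exponential moments of the environment *)

Section environment_moments.
Context {R : realType} {d : nat} {dO : measure_display}
  {Omega : measurableType dO}.
Variables (Q : probability Omega R) (W : 'rV[int]_d -> R -> Omega -> R).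
Hypothesis envW : wiener_environment Q W.
Variables (s h : R).
Hypothesis h0 : 0 < h.

Definition incr (i : nat) (x : 'rV[int]_d) (om : Omega) : R :=
  W x (s + i.+1%:R * h) om - W x (s + i%:R * h) om.

Lemma measurable_environment x t : measurable_fun setT (W x t).
Proof. by case: envW => wW _; case: (wW x). Qed.

Lemma measurable_incr i x : measurable_fun setT (incr i x).
Proof. by apply: measurable_funB; exact: measurable_environment. Qed.

Lemma incr_exp_moment i x (c : R) :
  (\int[Q]_om (expR (c * incr i x om))%:E = (expR (c ^+ 2 * h / 2))%:E)%E.
Proof.
apply: gaussian_exp_moment => //; first exact: measurable_incr.
move=> B mB; case: envW => wW _; case: (wW x) => _ _ _ gW _.
have lt : s + i%:R * h < s + i.+1%:R * h by rewrite ltrD2l ltr_pM2r// ltr_nat.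
rewrite /preimage/= (gW _ _ _ lt mB); congr (normal_prob 0 (Num.sqrt _) B).
by rewrite -natr1; ring.
Qed.

Lemma wiener_exp_moment x n (c : nat -> R) :
  (\int[Q]_om (expR (\sum_(0 <= i < n) c i * incr i x om))%:E =
   (expR (h / 2 * \sum_(0 <= i < n) c i ^+ 2))%:E)%E.
Proof.
case: envW => wW _; case: (wW x) => mW _ _ gW iW.
have u_incr : {homo (fun k : nat => s + k%:R * h) : i j / (i < j)%N >-> i < j}.
  by move=> i j ij; rewrite ltrD2l ltr_pM2r// ltr_nat.
under eq_integral do rewrite expR_sum.
rewrite (independent_expectation_prod (iW _ u_incr)).
- under eq_bigr do rewrite incr_exp_moment.
  rewrite prodEFin -expR_sum mulr_sumr; congr (expR _)%:E.
  by apply: eq_bigr => i _; ring.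
- exact: iota_uniq.
- move=> i A [B mB <-]; exact: (measurable_incr i x measurableT mB).
- by move=> i om; exact: expR_ge0.
- move=> i B mB; exists ((fun y => expR (c i * y)) @^-1` B).
    rewrite -[X in measurable X]setTI.
    have me : measurable_fun setT (fun y : R => expR (c i * y)).
      by apply: measurableT_comp => //; exact: measurable_funM.
    exact: me.
  by rewrite setTI.
Qed.

Lemma process_events_measurable (I : Type) (X : I -> Omega -> R) (Y : Omega -> R) :
  measurable_fun [set: g_sigma_algebraType (\bigcup_(i in [set: I]) rv_events (X i))] Y ->
  forall B, measurable B -> process_events X (Y @^-1` B).
Proof. by move=> mY B mB; have := mY measurableT B mB; rewrite setTI. Qed.

(** Independence is used twice: between sites here, between time slots at one
    site in [wiener_exp_moment]. *)
Lemma environment_exp_moment (S : seq 'rV[int]_d) n (c : 'rV[int]_d -> nat -> R) :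
  uniq S ->
  (\int[Q]_om (expR (\sum_(x <- S) \sum_(0 <= i < n) c x i * incr i x om))%:E =
   (expR (h / 2 * \sum_(x <- S) \sum_(0 <= i < n) c x i ^+ 2))%:E)%E.
Proof.
move=> uS; case: (envW) => wW iW.
under eq_integral do rewrite expR_sum.
rewrite (independent_expectation_prod iW) => //.
- under eq_bigr do rewrite wiener_exp_moment.
  by rewrite prodEFin -expR_sum mulr_sumr.
- move=> x; apply: smallest_sub; first exact: sigma_algebra_measurable.
  move=> A [t _ [B mB <-]]; exact: (measurable_environment x t measurableT mB).
- move=> x; apply: process_events_measurable.
  apply: measurableT_comp => //; apply: measurable_sum => i.
  have mW t : measurable_fun
      [set: g_sigma_algebraType (\bigcup_(i in [set: R]) rv_events (W x i))] (W x t).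
    move=> _ B mB; apply: sub_sigma_algebra; exists t => //; by exists B.
  by apply: measurable_funM => //; apply: measurable_funB.
Qed.

Lemma sum_delta_seq (S : seq 'rV[int]_d) (y : 'rV[int]_d) (F : 'rV[int]_d -> R) :
  uniq S -> y \in S -> \sum_(x <- S) (y == x)%:R * F x = F y.
Proof.
move=> uS yS; rewrite (bigD1_seq y)//= eqxx mul1r big1 ?addr0// => x.
by rewrite eq_sym => /negbTE ->; rewrite mul0r.
Qed.

(** Two paths through the environment interact exactly where they visit the
    same site during the same time slot. *)
Lemma two_path_exp_moment n (z z' : nat -> 'rV[int]_d) (a b : nat -> R) :
  (\int[Q]_om (expR (\sum_(0 <= i < n)
      (a i * incr i (z i) om + b i * incr i (z' i) om)))%:E =
   (expR (h / 2 * \sum_(0 <= i < n)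
      (a i ^+ 2 + b i ^+ 2 + 2 * a i * b i * (z i == z' i)%:R)))%:E)%E.
Proof.
pose S := undup ([seq z i | i <- iota 0 n] ++ [seq z' i | i <- iota 0 n]).
have uS : uniq S by exact: undup_uniq.
have zS i : (i < n)%N -> z i \in S.
  by move=> i_n; rewrite mem_undup mem_cat map_f// mem_iota.
have z'S i : (i < n)%N -> z' i \in S.
  by move=> i_n; rewrite mem_undup mem_cat orbC map_f// mem_iota.
pose c x i := (z i == x)%:R * a i + (z' i == x)%:R * b i.
have := environment_exp_moment n c uS.
rewrite [X in (expR (_ * X))%:E]exchange_big/=.
under eq_integral do rewrite exchange_big/=.
have -> : \sum_(0 <= i < n) \sum_(x <- S) c x i ^+ 2 = \sum_(0 <= i < n)
      (a i ^+ 2 + b i ^+ 2 + 2 * a i * b i * (z i == z' i)%:R).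
  apply: eq_big_nat => i /= i_n.
  transitivity (\sum_(x <- S) ((z i == x)%:R * (a i ^+ 2 + 2 * a i * b i * (z' i == x)%:R) + (z' i == x)%:R * b i ^+ 2)).
    apply: eq_bigr => x _; rewrite /c.
    by case: (z i == x); case: (z' i == x); rewrite ?mul0r ?mul1r ?mulr0 ?mulr1; ring.
  rewrite big_split/= (sum_delta_seq (fun x => a i ^+ 2 + 2 * a i * b i * (z' i == x)%:R))// ?zS//.
  by rewrite (sum_delta_seq (fun=> b i ^+ 2))// ?z'S// eq_sym addrAC.
move=> <-; apply: eq_integral => om _; congr (expR _)%:E.
apply: eq_big_nat => i /= i_n.
transitivity (\sum_(x <- S) ((z i == x)%:R * (a i * incr i x om) + (z' i == x)%:R * (b i * incr i x om))).
  by rewrite big_split/= !(sum_delta_seq (fun x => _ * incr i x om))// ?zS ?z'S.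
by apply: eq_bigr => x _; rewrite /c; ring.
Qed.

End environment_moments.

(** * Counting the jumps of the walk *)

Section counting.
Context {R : realType} {dE : measure_display} {E : measurableType dE}.
Variable tau : nat -> E -> R.

Lemma count_points_seq (A : set R) (s : seq nat) w : uniq s ->
  (forall k, A (tau k w) <-> k \in s) -> count_points tau A w = size s.
Proof.
move=> us As; rewrite /count_points.
rewrite (_ : [set k | _] = [set` [fset k in s]%fset]); last first.
  by apply/seteqP; split=> k /=; rewrite !inE => /As.
by rewrite set_fsetK card_fseq undup_id.
Qed.

Definition jumps (u : R) (w : E) : nat := count_points tau `]0, u] w.
Definition jumps_before (u : R) (w : E) : nat := count_points tau `]0, u[ w.
Definition jumps_in (u v : R) (w : E) : nat := count_points tau `]u, v] w.

Hypothesis tau_gt0 : forall k w, 0 < tau k w.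
Hypothesis tau_increasing : forall k w, tau k w < tau k.+1 w.
Hypothesis tau_unbounded : forall w, tau ^~ w @ \oo --> +oo.

(** The jump times are listed in increasing order, so the indices of those up to
    a given time form an initial segment. *)
Lemma down_closed_rank (p : nat -> bool) : (forall k, p k.+1 -> p k) ->
  (exists k, ~~ p k) -> exists n, forall k, p k = (k < n)%N.
Proof.
move=> pS ex; case: (ex_minnP ex) => n pn nmin; exists n => k.
have down i j : p (i + j)%N -> p i.
  by elim: j => [|j IH]; rewrite ?addn0// addnS => /pS.
have [kn|nk] := ltnP k n; first by apply/negPn/negP => /nmin; rewrite leqNgt kn.
by apply/negbTE; apply: contra pn; rewrite -(subnKC nk) => /down.
Qed.

Lemma tau_eventually_gt u w : exists k, u < tau k w.
Proof.
have /cvgryPgt/(_ u) := tau_unbounded w; move=> [k _ kP].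
by exists k; apply: kP => /=.
Qed.

Lemma count_oc u w k : (tau k w <= u) = (k < jumps u w)%N.
Proof.
have [||n nP] := @down_closed_rank (fun k => tau k w <= u).
- by move=> i; apply: le_trans; exact: ltW.
- by have [i ui] := tau_eventually_gt u w; exists i; rewrite -ltNge.
rewrite nP; congr (_ < _)%N; rewrite /jumps /jumps_before (@count_points_seq _ (iota 0 n)) ?size_iota ?iota_uniq// => i.
by rewrite mem_iota add0n /= in_itv/= tau_gt0 nP.
Qed.

Lemma count_oo u w k : (tau k w < u) = (k < jumps_before u w)%N.
Proof.
have [||n nP] := @down_closed_rank (fun k => tau k w < u).
- by move=> i; apply: lt_trans; exact: tau_increasing.
- by have [i ui] := tau_eventually_gt u w; exists i; rewrite -leNgt ltW.
rewrite nP; congr (_ < _)%N; rewrite /jumps /jumps_before (@count_points_seq _ (iota 0 n)) ?size_iota ?iota_uniq// => i.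
by rewrite mem_iota add0n /= in_itv/= tau_gt0 nP.
Qed.

Lemma count_oc_mono u v w : u <= v ->
  (jumps u w <= jumps v w)%N.
Proof.
move=> uv; rewrite leqNgt -count_oc -ltNge.
by rewrite (le_lt_trans uv)// ltNge count_oc ltnn.
Qed.

Lemma count_oc_split u v w : 0 <= u -> u <= v ->
  jumps v w =
  (jumps u w + jumps_in u v w)%N.
Proof.
move=> u0 uv; set m := jumps u w; set n := jumps v w.
have mn : (m <= n)%N by exact: count_oc_mono.
rewrite /jumps_in (@count_points_seq _ (iota m (n - m))) ?size_iota ?subnKC ?iota_uniq// => k.
rewrite mem_iota subnKC//= in_itv/= ltNge !count_oc -/m -/n -leqNgt.
by split.
Qed.

Lemma count_oc0 w : jumps 0 w = 0%N.
Proof. by apply/eqP; rewrite -leqn0 leqNgt -count_oc -ltNge. Qed.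

Hypothesis tau_measurable : forall k, measurable_fun setT (tau k).

Lemma countable_rv_count u : countable_rv (jumps u).
Proof.
have mle k : measurable [set w | tau k w <= u].
  rewrite -[X in measurable X]setTI.
  exact: (@measurable_fun_ler _ _ R setT (tau k) (cst u)).
move=> n.
rewrite (_ : _ @^-1` _ = ~` [set w | tau n w <= u] `&`
   (if n is m.+1 then [set w | tau m w <= u] else setT)).
  by apply: measurableI; [exact: measurableC|case: n].
apply/seteqP; split=> w /= => [wn|].
  split; first by rewrite count_oc wn ltnn.
  by case: n wn => //= m wm; rewrite count_oc wm.
rewrite count_oc => -[/negP]; rewrite -leqNgt => Nn h; apply/eqP.
by rewrite eqn_leq Nn/=; case: n Nn h => //= m _; rewrite count_oc.
Qed.

End counting.

Section jump_events.
Context {R : realType} {dE : measure_display} {E : measurableType dE}.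
Variables (P : probability E R) (tau : nat -> E -> R).
Hypothesis PP : poisson_process P tau.

Let T' := g_sigma_algebraType (\bigcup_(k in [set: nat]) rv_events (tau k)).

Lemma process_events_count u (B : set nat) :
  process_events tau (jumps tau u @^-1` B).
Proof.
apply: (@countable_rv_preimage _ T' nat (jumps tau u)).
apply: (@countable_rv_count R _ T' tau).
- exact: points_gt0 PP.
- exact: points_increasing PP.
- exact: points_unbounded PP.
- move=> k _ B' mB'; apply: sub_sigma_algebra; exists k => //; by exists B'.
Qed.

Lemma process_eventsI (A B : set E) :
  process_events tau A -> process_events tau B -> process_events tau (A `&` B).
Proof. by move=> mA mB; exact: (@measurableI _ T'). Qed.

Lemma process_events_all (B : nat -> set E) n :
  (forall i, process_events tau (B i)) ->
  process_events tau [set w | forall i, (i < n)%N -> B i w].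
Proof.
move=> mB; rewrite (_ : [set w | _] = \bigcap_(i in [set k | (k < n)%N]) B i); last first.
  by apply/seteqP; split.
apply: (@fin_bigcap_measurable _ T'); first exact: finite_II.
by move=> i _; exact: mB.
Qed.

Lemma process_events_meas (A : set E) : process_events tau A -> measurable A.
Proof.
apply: smallest_sub; first exact: sigma_algebra_measurable.
move=> B [t _ [B' mB' <-]]; exact: (points_measurable PP t measurableT mB').
Qed.

(** The law of the jump times enters here only. The family of disjoint sets
    consists of the time slots before [j h] and the block from [j h] to [k h],
    followed by empty sets. *)
Lemma count_increments (j k : nat) (h : R) (m : nat -> nat) r : 0 < h -> (j < k)%N ->
  P ([set w | forall i, (i < j)%N -> jumps_in tau (i%:R * h) (i.+1%:R * h) w = m i]
     `&` [set w | jumps_in tau (j%:R * h) (k%:R * h) w = r]) =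
  (P [set w | forall i, (i < j)%N -> jumps_in tau (i%:R * h)%R (i.+1%:R * h)%R w = m i] *
   (((k - j)%:R * h) ^+ r / r`!%:R * expR (- ((k - j)%:R * h)))%:E)%E.
Proof.
move=> h0 jk.
have mulh i i' : (i <= i')%N -> i%:R * h <= i'%:R * h.
  by move=> ii; rewrite ler_wpM2r ?ler_nat// ltW.
pose A i : set R := if (i < j)%N then `](i%:R * h), (i.+1%:R * h)]%classic
   else if i == j then `](j%:R * h), (k%:R * h)]%classic else set0.
have mA i : measurable (A i) by rewrite /A; do 2?case: ifP => // _.
have Asub i (y z : R) : 0 <= y -> `]y, z]%classic `<=` `]0, z]%classic.
  by move=> y0 x /=; rewrite !in_itv/= => /andP[/(le_lt_trans y0) -> ->].
have bA i : exists M : R, A i `<=` `]0, M].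
  rewrite /A; case: ifP => _; first by exists (i.+1%:R * h); apply: Asub => //; rewrite mulr_ge0// ltW.
  case: ifP => _; first by exists (k%:R * h); apply: Asub => //; rewrite mulr_ge0// ltW.
  by exists 0.
have tA : trivIset setT A.
  apply/trivIsetP => i i' _ _; wlog ii : i i' / (i < i')%N.
    move=> wl; rewrite neq_ltn => /orP[ii|ii]; first by apply: wl => //; rewrite neq_ltn ii.
    by rewrite setIC; apply: wl => //; rewrite neq_ltn ii.
  move=> _; rewrite /A; have [i'j|] := ltnP i' j.
    rewrite (ltn_trans ii i'j); apply/seteqP; split=> // x /= [].
    rewrite !in_itv/= => /andP[_ x1] /andP[x2 _].
    by have := lt_le_trans x2 x1; rewrite ltNge mulh.
  rewrite leq_eqVlt => /predU1P[ji'|ji']; last by rewrite [i' == j]gtn_eqF// setI0.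
  move: ii; rewrite -ji' => ii; rewrite ii eqxx; apply/seteqP; split=> // x /= [].
  rewrite !in_itv/= => /andP[_ x1] /andP[x2 _].
  by have := lt_le_trans x2 x1; rewrite ltNge mulh.
have ind := count_independent PP mA bA tA.
pose C i := count_points tau (A i) @^-1` [set (if (i < j)%N then m i else r)].
have Ci s : uniq s -> P (\bigcap_(i in [set` s]) C i) = (\prod_(i <- s) P (C i))%E.
  by move=> us; apply: (independent_prod ind) => // i _; exists [set (if (i < j)%N then m i else r)].
have E1 : [set w | forall i, (i < j)%N -> jumps_in tau (i%:R * h)%R (i.+1%:R * h)%R w = m i]
    = \bigcap_(i in [set` iota 0 j]) C i.
  apply/seteqP; split=> w /= wm i.
    by move=> /=; rewrite mem_iota add0n /C/A/= => ij; rewrite ij; exact: wm.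
  by move=> ij; have := wm i; rewrite /= mem_iota add0n ij /C/A/= ij; apply.
have E2 : [set w | jumps_in tau (j%:R * h) (k%:R * h) w = r] = C j.
  by rewrite /C /A ltnn eqxx.
rewrite E1 E2 setIC.
have -> : C j `&` \bigcap_(i in [set` iota 0 j]) C i = \bigcap_(i in [set` j :: iota 0 j]) C i.
  apply/seteqP; split=> w /= => [[wj wi] i /=|wm].
    by rewrite inE => /predU1P[-> //|]; exact: wi.
  by split; [apply: wm; rewrite /= inE eqxx|move=> i /= ij; apply: wm; rewrite /= inE ij orbT].
rewrite !Ci ?iota_uniq//=; last by rewrite mem_iota add0n ltnn iota_uniq.
rewrite big_cons muleC; congr (_ * _)%E; rewrite -E2.
have jkh : j%:R * h < k%:R * h by rewrite ltr_pM2r// ltr_nat.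
have := @count_poisson _ _ _ _ _ PP `](j%:R * h), (k%:R * h)]%classic (k%:R * h) r.
rewrite lebesgue_measure_itv/= lte_fin jkh/= -mulrBl -natrB ?(ltnW jk)//; apply => //.
by apply: Asub; rewrite ?mulr_ge0// ltW.
Qed.

End jump_events.

(** * The Markov property of the walk *)

Section le_measure_bigsetU.
Context {dT : measure_display} {T : measurableType dT} {R : realType}.

Lemma le_measure_bigsetU (mu : {measure set T -> \bar R}) (I : Type)
    (s : seq I) (F : I -> set T) : (forall i, measurable (F i)) ->
  (mu (\big[setU/set0]_(i <- s) F i) <= \sum_(i <- s) mu (F i))%E.
Proof.
move=> mF; elim: s => [|i s IH]; first by rewrite !big_nil measure0.
rewrite !big_cons; apply: (le_trans (measureU2 _ _ _)) => //.
  exact: bigsetU_measurable.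
by rewrite leeD2l.
Qed.

End le_measure_bigsetU.

Lemma unit_vec_inj (d : nat) : injective (@unit_vec d).
Proof.
move=> [i b] [i' b'] /rowP e; have := e i; have := e i'; rewrite !mxE !eqxx/=.
have [->|ii'] := eqVneq i i'.
  by case: b b' {e} => -[].
by rewrite mulr0n mulr0 mulr1 => /esym/eqP; rewrite signr_eq0.
Qed.

Section steps.
Context {R : realType} {d : nat} {dE : measure_display} {E : measurableType dE}.
Variables (P : probability E R) (tau : nat -> E -> R) (xi : nat -> E -> 'rV[int]_d).
Hypothesis srw : simple_random_walk P tau xi.
Hypothesis d0 : (0 < d)%N.

Lemma countable_rv_step l : countable_rv (xi l).
Proof. by move=> v; exact: (step_measurable srw). Qed.

Definition cylinder (B : set E) (M : nat) (a : nat -> 'rV[int]_d) : set E :=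
  B `&` [set w | forall l, (l < M)%N -> xi l w = a l].

Lemma measurable_cylinder B M a : process_events tau B -> measurable (cylinder B M a).
Proof.
move=> /(process_events_meas (walk_jump_times srw)) mB.
apply: measurableI => //.
rewrite (_ : [set w | _] = \bigcap_(l in [set k | (k < M)%N]) (xi l @^-1` [set a l])); last first.
  by apply/seteqP; split.
apply: fin_bigcap_measurable; first exact: finite_II.
by move=> l _; exact: countable_rv_step.
Qed.

Lemma cylinderE B M a : process_events tau B ->
  (P (cylinder B M a) = P B * \prod_(l <- iota 0 M) P (xi l @^-1` [set a l]))%E.
Proof.
move=> pB.
pose A o := if o is Some l then xi l @^-1` [set a l] else B.
have us : uniq (None :: [seq Some l | l <- iota 0 M]).
  rewrite /= map_inj_uniq ?iota_uniq ?andbT; last by move=> ? ? [].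
  by apply/negP => /mapP[].
have := independent_prod (A := A) (walk_independent srw) us.
rewrite big_cons big_map => <-.
  congr (P _); apply/seteqP; split=> w /=.
    move=> [Bw wa] o /=; rewrite inE => /predU1P[->//|/mapP[l]].
    by rewrite mem_iota add0n => lM -> /=; exact: wa.
  move=> wA; split; first by apply: (wA None); rewrite /= inE eqxx.
  by move=> l lM; apply: (wA (Some l)); rewrite /= inE/= map_f// mem_iota.
by move=> [l|] _ //=; exists [set a l].
Qed.

(** The [2 d] prescribed probabilities add up to [1]. *)
Lemma step_not_unit l : P (~` [set w | exists u, xi l w = unit_vec u]) = 0%E.
Proof.
have -> : [set w | exists u, xi l w = unit_vec u] =
    \bigcup_(u in [set: 'I_d * bool]) (xi l @^-1` [set unit_vec u]).
  by apply/seteqP; split=> [w [u wu]|w [u _ wu]]; exists u.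
have mU : measurable (\bigcup_(u in [set: 'I_d * bool]) (xi l @^-1` [set unit_vec u])).
  apply: fin_bigcup_measurable => // u _; exact: countable_rv_step.
rewrite probability_setC// measure_fin_bigcup//.
- rewrite (_ : [set: 'I_d * bool] = [set` index_enum ('I_d * bool)%type]); last first.
    by apply/seteqP; split=> // u _; rewrite /= mem_index_enum.
  rewrite -fsbig_seq ?index_enum_uniq// (eq_bigr (fun=> ((2 * d)%:R^-1)%:E)); last first.
    by move=> u _; exact: (step_uniform srw).
  rewrite sumEFin sumr_const card_prod card_ord card_bool mulnC.
  by rewrite -[X in (_ - X%:E)%E]mulr_natr mulVf ?subee// pnatr_eq0 muln_eq0 orbF -lt0n.
- exact: finite_finset.
- apply/trivIsetP => u v _ _ uv; apply/seteqP; split=> // w /= [-> /unit_vec_inj uv'].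
  by rewrite uv' eqxx in uv.
- by move=> u _; exact: countable_rv_step.
Qed.

Lemma countable_rv_sum M r :
  countable_rv (fun w => \sum_(i < r) xi (M + i)%N w).
Proof.
elim: r => [|r IH].
  rewrite (_ : (fun w => _) = (fun=> 0)); first exact: countable_rv_cst.
  by apply/funext => w; rewrite big_ord0.
rewrite (_ : (fun w => _) = (fun p => p.1 + p.2) \o (fun w => (\sum_(i < r) xi (M + i)%N w, xi (M + r)%N w))).
  apply: countable_rv_comp; apply: countable_rv_pair => //.
  exact: countable_rv_step.
by apply/funext => w; rewrite big_ord_recr.
Qed.

(** The steps after the [M]-th one form a fresh walk. *)
Lemma fresh_steps B M a r z : process_events tau B ->
  (P (cylinder B M a `&` [set w | \sum_(i < r) xi (M + i)%N w = z]%R) <=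
   P (cylinder B M a) * (step_transition R r z)%:E)%E.
Proof.
move=> pB; elim: r M a z => [|r IH] M a z /=.
  rewrite (_ : [set w | _] = [set w | 0 = z]); last first.
    by apply/seteqP; split=> w /=; rewrite big_ord0.
  have [->|z0] := eqVneq z 0.
    rewrite (_ : [set w | _] = setT) ?setIT ?mule1//.
    by apply/seteqP; split.
  rewrite (_ : [set w | _] = set0) ?setI0 ?measure0 ?mule0//.
  by apply/seteqP; split=> w //= zz; rewrite -zz eqxx in z0.
pose a' u l := if l == M then unit_vec u else a l.
have mS M' r' z' : measurable [set w | \sum_(i < r') xi (M' + i)%N w = z'].
  exact: (countable_rv_sum M' r' z').
have mC u := measurable_cylinder M.+1 (a' u) pB.
pose F u := cylinder B M.+1 (a' u) `&` [set w | \sum_(i < r) xi (M.+1 + i)%N w = z - unit_vec u].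
have mF u : measurable (F u) by apply: measurableI.
pose N := ~` [set w | exists u, xi M w = unit_vec u].
have mN : measurable N.
  apply: measurableC; apply: (@countable_rv_preimage _ _ _ (xi M) [set v | exists u, v = unit_vec u]).
  exact: countable_rv_step.
apply: (@le_trans _ _ (P ((\big[setU/set0]_(u : 'I_d * bool) F u) `|` N))).
  apply: le_measure; rewrite ?inE.
  - by apply: measurableI; [exact: measurable_cylinder pB|exact: mS].
  - by apply: measurableU => //; exact: bigsetU_measurable.
  - move=> w [[Bw wa] /= wz]; have [[u wu]|nu] := pselect (exists u, xi M w = unit_vec u); last by right.
    left; rewrite -bigcup_seq; exists u; first by rewrite /= mem_index_enum.
    split.
      split=> // l /=; rewrite ltnS leq_eqVlt /a' => /predU1P[->|lM].
        by rewrite eqxx.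
      by rewrite ltn_eqF//; exact: wa.
    rewrite /= -wu -wz big_ord_recl addn0 addrC addKr.
    by apply: eq_bigr => i _; rewrite addSnnS.
rewrite measureU0//; [|exact: bigsetU_measurable|exact: step_not_unit].
apply: le_trans (le_measure_bigsetU _ _ mF) _.
rewrite (le_trans (lee_sum _ (fun u _ => IH M.+1 (a' u) (z - unit_vec u))))//.
rewrite -sumEFin ge0_sume_distrr; last first.
  by move=> u _; rewrite lee_fin mulr_ge0 ?invr_ge0// step_transition_ge0.
apply: lee_sum => u _; rewrite EFinM muleA.
apply: lee_wpmul2r; first by rewrite lee_fin step_transition_ge0.
rewrite !cylinderE// -addn1 iotaD/= add0n big_cat/= big_seq1 /a' eqxx (step_uniform srw).
rewrite muleA [X in (_ * X * _ <= _)%E](_ : _ = \prod_(l <- iota 0 M) P (xi l @^-1` [set a l]))%E//.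
by rewrite !big_seq; apply: eq_bigr => l; rewrite mem_iota add0n => /ltn_eqF ->.
Qed.

End steps.

Section poisson_average.
Context {R : realType} {d : nat}.
Hypothesis d3 : (3 <= d)%N.

Lemma sum_exp_le (u : R) n : 0 <= u -> \sum_(r < n) u ^+ r / r`!%:R <= expR u.
Proof.
move=> u0; have := @nondecreasing_cvgn_le _ (series (exp_coeff u)).
rewrite /expR => /(_ _ _ n); rewrite /series/= big_mkord; apply.
- apply: nondecreasing_series => i _ _; exact: exp_coeff_ge0.
- exact: is_cvg_series_exp_coeff.
Qed.

(** The summand [4] makes the bound trivial up to time [1]; the other one comes
    from averaging [step_transition_ub] over a Poisson number of jumps. *)
Definition heat_bound (u : R) : R :=
  (4 + 24 * d%:R ^+ 2) / (Num.sqrt (1 + u) ^+ 3).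

(** The denominators of [step_transition_ub] are absorbed by the factorial, which
    shifts the exponential series; [l] is of order [u ^ (-1/2)]. *)
Lemma poisson_step_transition (u : R) (z : nat -> 'rV[int]_d) : 1 <= u ->
  (\sum_(r <oo) (u ^+ r / r`!%:R * expR (- u) * step_transition R r (z r))%:E <=
   (heat_bound u)%:E)%E.
Proof.
move=> u1; have u0 : 0 < u by rewrite (lt_le_trans ltr01).
set s := Num.sqrt (1 + u).
have s2 : s ^+ 2 = 1 + u by rewrite sqr_sqrtr// addr_ge0// ltW.
have s0 : 0 < s by rewrite sqrtr_gt0 addr_gt0.
apply: lime_le.
  apply: is_cvg_nneseries => r _ _; rewrite lee_fin mulr_ge0 ?step_transition_ge0//.
  by rewrite mulr_ge0 ?expR_ge0// divr_ge0// exprn_ge0// ltW.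
apply: nearW => n; rewrite sumEFin lee_fin big_mkord.
pose C : R := 4 * d%:R ^+ 2.
have C0 : 0 <= C by rewrite mulr_ge0// sqr_ge0.
have e0 : 0 < expR (- u) by exact: expR_gt0.
apply: (@le_trans _ _ (\sum_(r < n) (expR (- u) * C * (s^-1 * u^-1 * (u ^+ r.+1 / r.+1`!%:R) + s * u^-2 * (u ^+ r.+2 / r.+2`!%:R))))).
  apply: ler_sum => r _.
  have := step_transition_ub r (z r) d3 (_ : 0 < s^-1); rewrite invr_gt0 => /(_ s0) h.
  have h' : 0 <= u ^+ r / r`!%:R * expR (- u).
    by rewrite mulr_ge0 ?expR_ge0// divr_ge0// exprn_ge0// ltW.
  apply: le_trans (ler_wpM2l h' h) _.
  rewrite -/C !factS !natrM !exprS le_eqVlt; apply/orP; left; apply/eqP.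
  have f0 : (r`!%:R : R) != 0 by rewrite pnatr_eq0 -lt0n fact_gt0.
  move: (expR _) (r`!%:R) f0 (r.+1%:R) (r.+2%:R) (pnatr_eq0 R r.+1) (pnatr_eq0 R r.+2) => e f f0 r1 r2 /= r10 r20.
  by field; rewrite f0 r10 r20 (gt_eqF s0) (gt_eqF u0).
rewrite -mulr_sumr big_split/= -!mulr_sumr.
have b1 : \sum_(r < n) (u ^+ r.+1 / r.+1`!%:R) <= expR u.
  apply: le_trans (sum_exp_le n.+1 (ltW u0)); rewrite big_ord_recl lerDr.
  by rewrite divr_ge0.
have b2 : \sum_(r < n) (u ^+ r.+2 / r.+2`!%:R) <= expR u.
  apply: le_trans (sum_exp_le n.+2 (ltW u0)); rewrite 2!big_ord_recl addrA lerDr.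
  by rewrite addr_ge0 ?divr_ge0// exprn_ge0// ltW.
apply: (@le_trans _ _ (expR (- u) * C * (s^-1 * u^-1 * expR u + s * u^-2 * expR u))).
  rewrite ler_wpM2l ?mulr_ge0 ?expR_ge0//.
  by rewrite lerD// ler_wpM2l// ?mulr_ge0 ?invr_ge0 ?exprn_ge0// ltW.
rewrite (_ : _ * _ = C * (u + s ^+ 2) / (s * u ^+ 2)); last first.
  rewrite expRN; field.
  by rewrite (gt_eqF s0) (gt_eqF u0) (gt_eqF (expR_gt0 _)).
rewrite /heat_bound -/s ler_pdivrMr ?mulr_gt0 ?exprn_gt0//.
rewrite [leRHS]mulrAC ler_pdivlMr ?exprn_gt0//.
rewrite (_ : s ^+ 3 = s * s ^+ 2); last by rewrite -exprS.
rewrite s2 /C; set D := d%:R ^+ 2; have D0 : 0 <= D by rewrite sqr_ge0.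
have h1 : (u + (1 + u)) * (1 + u) <= 6 * u ^+ 2 by nra.
have h2 := ler_wpM2l (mulr_ge0 (mulr_ge0 (ler0n _ 4) D0) (ltW s0)) h1.
have h3 : 0 <= 4 * (s * u ^+ 2) by rewrite !mulr_ge0// ?ltW// sqr_ge0.
lra.
Qed.

Lemma heat_bound_ge1 (u : R) : 0 <= u <= 1 -> 1 <= heat_bound u.
Proof.
move=> /andP[u0 u1]; rewrite /heat_bound; set s := Num.sqrt _.
have s2 : s ^+ 2 = 1 + u by rewrite sqr_sqrtr// addr_ge0.
have s0 : 0 < s by rewrite sqrtr_gt0 ltr_pwDl.
rewrite ler_pdivlMr ?exprn_gt0// mul1r.
rewrite (@le_trans _ _ 4)//; last by rewrite lerDl mulr_ge0// sqr_ge0.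
have : s <= 2 by rewrite leNgt; apply/negP => h; nra.
by rewrite exprS s2; nra.
Qed.

End poisson_average.

Section markov.
Context {R : realType} {d : nat} {dE : measure_display} {E : measurableType dE}.
Variables (P : probability E R) (tau : nat -> E -> R) (xi : nat -> E -> 'rV[int]_d).
Hypothesis srw : simple_random_walk P tau xi.
Hypothesis d3 : (3 <= d)%N.
Variables (x : 'rV[int]_d) (h : R).
Hypothesis h0 : 0 < h.

Let PP := walk_jump_times srw.
Let d0 : (0 < d)%N := leq_trans (ltn0Sn 2) d3.

Definition grid_jumps (i : nat) (w : E) : nat := jumps tau (i%:R * h) w.

Definition grid_site (i : nat) (w : E) : 'rV[int]_d := site xi x (grid_jumps i w) w.

(** The past of the walk, encoded by countably many values: jump numbers at the
    grid times and the list of steps taken. *)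
Definition history (j : nat) (w : E) : seq nat * seq 'rV[int]_d :=
  ([seq grid_jumps i w | i <- iota 0 j.+1],
   [seq xi l w | l <- iota 0 (grid_jumps j w)]).

Definition history_site (v : seq nat * seq 'rV[int]_d) (i : nat) : 'rV[int]_d :=
  x + \sum_(a <- take (nth 0%N v.1 i) v.2) a.

Lemma grid_jumps_mono i j w : (i <= j)%N -> (grid_jumps i w <= grid_jumps j w)%N.
Proof.
move=> ij; apply: (count_oc_mono (points_gt0 PP) (points_increasing PP) (points_unbounded PP)).
by rewrite ler_wpM2r ?ler_nat// ltW.
Qed.

Lemma grid_jumps_split i j w : (i <= j)%N ->
  grid_jumps j w = (grid_jumps i w + jumps_in tau (i%:R * h) (j%:R * h) w)%N.
Proof.
move=> ij.
apply: (count_oc_split (points_gt0 PP) (points_increasing PP) (points_unbounded PP)).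
  by rewrite mulr_ge0// ltW.
by rewrite ler_wpM2r ?ler_nat// ltW.
Qed.

Lemma grid_jumps0 w : grid_jumps 0 w = 0%N.
Proof.
rewrite /grid_jumps mul0r.
exact: (count_oc0 (points_gt0 PP) (points_increasing PP) (points_unbounded PP)).
Qed.

Lemma nth_history i j w : (i <= j)%N -> nth 0%N (history j w).1 i = grid_jumps i w.
Proof. by move=> ij; rewrite (nth_map 0%N) ?size_iota// nth_iota. Qed.

Lemma history_siteE i j w : (i <= j)%N ->
  grid_site i w = history_site (history j w) i.
Proof.
move=> ij; rewrite /history_site nth_history// /grid_site /site; congr (_ + _).
rewrite -map_take take_iota (minn_idPl _) ?grid_jumps_mono//.
by rewrite big_map -(big_mkord xpredT (fun l => xi l w)) /index_iota subn0.
Qed.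

Lemma countable_rv_grid_jumps i : countable_rv (grid_jumps i).
Proof.
apply: countable_rv_count.
- exact: points_gt0 PP.
- exact: points_increasing PP.
- exact: points_unbounded PP.
- exact: points_measurable PP.
Qed.

Lemma countable_rv_history j : countable_rv (history j).
Proof.
apply: countable_rv_pair.
  by apply: countable_rv_seq => i; exact: countable_rv_grid_jumps.
apply: (@countable_rv_index _ _ nat (seq 'rV[int]_d) (grid_jumps j)
  (fun n w => [seq xi l w | l <- iota 0 n])).
  exact: countable_rv_grid_jumps.
by move=> n; apply: countable_rv_seq => l; exact: (countable_rv_step srw).
Qed.

Lemma countable_rv_grid_site i : countable_rv (grid_site i).
Proof.
rewrite (_ : grid_site i = (history_site^~ i) \o history i).
  by apply: countable_rv_comp; exact: countable_rv_history.
by apply/funext => w /=; rewrite -history_siteE.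
Qed.

Lemma process_events_jumps_in i j m : (i <= j)%N ->
  process_events tau [set w | jumps_in tau (i%:R * h) (j%:R * h) w = m].
Proof.
move=> ij.
rewrite (_ : [set w | _] = \bigcup_(p in [set: nat * nat])
   (if p.2 - p.1 == m then (grid_jumps i @^-1` [set p.1] `&` grid_jumps j @^-1` [set p.2]) else set0)%N).
  apply: (@countable_bigcupT_measurable _ (g_sigma_algebraType (\bigcup_(k in [set: nat]) rv_events (tau k)))).
    exact: countableP.
  move=> [p q] /=; case: ifP => _.
    by apply: process_eventsI; exact: (process_events_count PP).
  by have := process_events_count PP 0 set0; rewrite preimage_set0.
apply/seteqP; split=> w /=.
  move=> wm; exists (grid_jumps i w, grid_jumps j w) => //=.
  by rewrite {1}(grid_jumps_split w ij) addKn wm eqxx.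
move=> [[p q] _ /=]; case: ifP => // /eqP <- [<- <-].
by rewrite (grid_jumps_split w ij) addKn.
Qed.

(** A value of the history prescribes the numbers of jumps in each slot and the
    first steps, two independent pieces of information. *)
Lemma history_fibre j w0 :
  history j @^-1` [set history j w0] =
  cylinder xi [set w | forall i, (i < j)%N ->
     jumps_in tau (i%:R * h) (i.+1%:R * h) w = jumps_in tau (i%:R * h) (i.+1%:R * h) w0]
   (grid_jumps j w0) (xi^~ w0).
Proof.
apply/seteqP; split=> w /=.
  move=> hw.
  have jw i : (i <= j)%N -> grid_jumps i w = grid_jumps i w0.
    by move=> ij; rewrite -(nth_history w ij) -(nth_history w0 ij) hw.
  split=> [i ij|l lM] /=.
    have := grid_jumps_split w (leqnSn i); have := grid_jumps_split w0 (leqnSn i).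
    by rewrite !jw ?(ltnW ij)// => -> /addnI ->.
  have := congr1 (fun v : seq nat * seq 'rV[int]_d => nth 0 v.2 l) hw.
  by rewrite /= !(nth_map 0%N) ?size_iota ?jw// !nth_iota ?jw.
move=> [/= Bw xiw].
have jw i : (i <= j)%N -> grid_jumps i w = grid_jumps i w0.
  elim: i => [|i IH] ij; first by rewrite !grid_jumps0.
  by rewrite !(grid_jumps_split _ (leqnSn i)) IH ?(ltnW ij)// Bw.
rewrite /history; congr (_, _).
  by apply/eq_in_map => i; rewrite mem_iota add0n ltnS => /andP[_]; exact: jw.
by rewrite jw//; apply/eq_in_map => l; rewrite mem_iota add0n => /andP[_]; exact: xiw.
Qed.

(** The numbers of later jumps and the later steps are independent of the
    history; sum over the number of jumps between the two grid times. *)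
Lemma markov_fibre j k v z : (j < k)%N ->
  (P (history j @^-1` [set v] `&` grid_site k @^-1` [set z]) <=
   P (history j @^-1` [set v]) * (heat_bound (d := d) ((k - j)%:R * h))%:E)%E.
Proof.
move=> jk; set u := (k - j)%:R * h.
have u0 : 0 < u by rewrite mulr_gt0// ltr0n subn_gt0.
have mV : measurable (history j @^-1` [set v]) by exact: countable_rv_history.
have mz : measurable (grid_site k @^-1` [set z]) by exact: countable_rv_grid_site.
have [u1|/ltW u1] := leP 1 u; last first.
  apply: (@le_trans _ _ (P (history j @^-1` [set v]))).
    by apply: le_measure; rewrite ?inE//; apply: measurableI.
  rewrite -[leLHS]mule1; apply: lee_wpmul2l => //.
  by rewrite lee_fin heat_bound_ge1// ltW.
have [[w0 wv]|nw] := pselect (exists w0, history j w0 = v); last first.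
  rewrite (_ : history j @^-1` [set v] = set0) ?set0I ?measure0 ?mul0e//.
  by apply/seteqP; split=> // w /= wv; apply: nw; exists w.
rewrite -wv history_fibre; set M := grid_jumps j w0; set a := xi^~ w0.
set B := [set w | _].
have pB : process_events tau B.
  by apply: process_events_all => i; exact: process_events_jumps_in.
pose B' r := B `&` [set w | jumps_in tau (j%:R * h) (k%:R * h) w = r].
have pB' r : process_events tau (B' r).
  by apply: process_eventsI => //; apply: process_events_jumps_in; exact: ltnW.
pose z' := z - (x + \sum_(l < M) xi l w0).
pose F r := cylinder xi (B' r) M a `&` [set w | \sum_(i < r) xi (M + i)%N w = z'].
have mF r : measurable (F r).
  apply: measurableI; first exact: (measurable_cylinder srw).
  exact: (countable_rv_sum srw M r z').
have mC : measurable (cylinder xi B M a) by exact: (measurable_cylinder srw).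
apply: (@le_trans _ _ (\sum_(r <oo) P (F r))%E).
  apply: measure_sigma_subadditive => //; first exact: measurableI.
  move=> w [[Bw xiw] /= wz]; exists (jumps_in tau (j%:R * h) (k%:R * h) w) => //.
  have Mw : grid_jumps j w = M.
    have : (history j @^-1` [set history j w0]) w by rewrite history_fibre.
    by move=> /= e; rewrite -(nth_history w (leqnn j)) e nth_history.
  split; first by split.
  rewrite /= /z' -wz /grid_site /site (grid_jumps_split w (ltnW jk)) Mw.
  rewrite big_split_ord/= opprD addrACA subrr add0r addrC.
  have -> : \sum_(l < M) xi l w0 = \sum_(l < M) xi l w.
    by apply: eq_bigr => l _; rewrite xiw.
  by rewrite addKr.
apply: (@le_trans _ _ (\sum_(r <oo) (P (cylinder xi B M a) *
    (u ^+ r / r`!%:R * expR (- u) * step_transition R r z')%:E))%E).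
  apply: lee_nneseries => [r _ _|r _]; first exact: measure_ge0.
  apply: le_trans (fresh_steps srw d0 M a r z' (pB' r)) _.
  rewrite (EFinM (_ * _)) muleA; apply: lee_wpmul2r.
    by rewrite lee_fin step_transition_ge0.
  rewrite !(cylinderE srw)// -muleA [X in (_ <= _ * X)%E]muleC muleA.
  apply: lee_wpmul2r; first by apply: prode_ge0.
  by rewrite (count_increments PP).
have Cf : P (cylinder xi B M a) \is a fin_num by exact: fin_num_measure.
rewrite -(fineK Cf) nneseriesZl; last first.
  move=> r _; rewrite lee_fin !mulr_ge0 ?step_transition_ge0 ?expR_ge0 ?invr_ge0//.
  by rewrite exprn_ge0// ltW.
apply: lee_wpmul2l; first by rewrite fineK.
exact: (poisson_step_transition d3 (fun=> z') u1).
Qed.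

Lemma markov j k z (G : seq nat * seq 'rV[int]_d -> R) : (j < k)%N ->
  (forall v, 0 <= G v) ->
  (\int[P]_w ((grid_site k w == z)%:R * G (history j w))%:E <=
   (heat_bound (d := d) ((k - j)%:R * h))%:E * \int[P]_w (G (history j w))%:E)%E.
Proof.
move=> jk G0.
have mG : measurable_fun setT (fun w => (G (history j w))%:E).
  exact: (measurable_fun_countable_rv (fun v => (G v)%:E) (countable_rv_history j)).
have mV v : measurable (history j @^-1` [set v]) by exact: countable_rv_history.
have mz : measurable (grid_site k @^-1` [set z]) by exact: countable_rv_grid_site.
have hb0 : 0 <= heat_bound (R := R) (d := d) ((k - j)%:R * h).
  rewrite divr_ge0 ?exprn_ge0 ?sqrtr_ge0// addr_ge0// mulr_ge0// sqr_ge0.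
rewrite -ge0_integralZl//; last by move=> w _; rewrite lee_fin.
have mL : measurable_fun setT (fun w => ((grid_site k w == z)%:R * G (history j w))%:E).
  exact: (measurable_fun_countable_rv (fun p : 'rV[int]_d * (seq nat * seq 'rV[int]_d) => ((p.1 == z)%:R * G p.2)%:E)
    (countable_rv_pair (countable_rv_grid_site k) (countable_rv_history j))).
rewrite (ge0_integral_countable_rv P (countable_rv_history j) mL); last first.
  by move=> w; rewrite lee_fin mulr_ge0.
rewrite [leRHS](ge0_integral_countable_rv P (countable_rv_history j)); last 2 first.
- exact: measurable_funeM.
- by move=> w; rewrite mule_ge0// lee_fin.
apply: le_esum => v _.
rewrite [leRHS](_ : _ = \int[P]_(w in history j @^-1` [set v])
   (cst ((heat_bound (d := d) ((k - j)%:R * h))%:E * (G v)%:E) w))%E; last first.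
  by apply: eq_integral => w; rewrite inE/= => ->.
rewrite integral_cst//.
rewrite [leLHS](_ : _ = \int[P]_(w in history j @^-1` [set v])
   ((G v)%:E * (\1_(grid_site k @^-1` [set z]) w)%:E))%E; last first.
  apply: eq_integral => w; rewrite inE/= => ->; rewrite -EFinM mulrC indicE.
  congr (_ * _%:R)%:E; congr nat_of_bool.
  by apply/eqP/idP; rewrite inE.
rewrite ge0_integralZl//; last first.
- by rewrite lee_fin.
- by apply/measurable_EFinP; exact: measurable_indic.
rewrite integral_indic// setIC [X in (_ <= X * _)%E]muleC -muleA.
apply: lee_wpmul2l; first by rewrite lee_fin.
by rewrite [leRHS]muleC; exact: markov_fibre.
Qed.

End markov.

(** * The renewal inequality *)

Section renewal_sequence.
Context {R : realType}.
Implicit Types f g : nat -> R.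

Lemma sum_shifted g j n :
  \sum_(0 <= k < n) (j < k)%:R * g (k - j)%N = \sum_(1 <= i < n - j) g i.
Proof.
elim: n => [|n IH]; first by rewrite sub0n !big_geq.
rewrite big_nat_recr//= IH; have [jn|nj] := ltnP j n.
  by rewrite mul1r subSn ?(ltnW jn)// big_nat_recr//= subn_gt0.
rewrite mul0r addr0 !big_geq//; first by rewrite leq_subLR; lia.
by rewrite leq_subLR; lia.
Qed.

Lemma sum_convolution_le f g n : (forall k, 0 <= f k) -> (forall k, 0 <= g k) ->
  \sum_(0 <= k < n) \sum_(0 <= j < k) f j * g (k - j)%N <=
  (\sum_(0 <= j < n) f j) * \sum_(1 <= i < n) g i.
Proof.
move=> f0 g0.
have -> : \sum_(0 <= k < n) \sum_(0 <= j < k) f j * g (k - j)%N =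
  \sum_(0 <= j < n) f j * \sum_(0 <= k < n) (j < k)%:R * g (k - j)%N.
  under [RHS]eq_bigr do rewrite mulr_sumr.
  rewrite [RHS]exchange_big/=; apply: eq_big_nat => k /= kn.
  rewrite [RHS](big_cat_nat (n := k))//=; last exact: ltnW.
  rewrite [X in _ + X]big_nat_cond [X in _ + X]big1 ?addr0; last first.
    by move=> j; rewrite andbT => /andP[kj _]; rewrite ltnNge kj mul0r mulr0.
  by apply: eq_big_nat => j /= jk; rewrite jk mul1r.
rewrite mulr_suml; apply: ler_sum => j _; rewrite ler_wpM2l// sum_shifted.
have [/eqP n0|n0] := leqP n 1; first by rewrite !big_geq//; lia.
have [jn|nj] := leqP 1 (n - j); last by rewrite big_geq ?sumr_ge0//; lia.
by rewrite [leRHS](big_cat_nat (n := n - j))//= ?leq_subr// lerDl sumr_ge0.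
Qed.

(** A submultiplicative weight distributes over the two factors of the
    convolution, whose sum is then at most a product of two sums; smallness of
    [b A] absorbs the unknown sum on the right. *)
Lemma renewal_bound (U H w : nat -> R) (A b : R) n :
  (forall k, 0 <= U k) -> (forall k, 0 <= H k) -> (forall k, 0 <= w k) ->
  (forall j k, (j <= k)%N -> w k <= w j * w (k - j)%N) ->
  0 <= b -> b * A <= 2^-1 -> \sum_(1 <= k < n) w k * H k <= A ->
  w 0%N * U 0%N <= 1 ->
  (forall k, (0 < k)%N -> U k <= H k + b * \sum_(0 <= j < k) H (k - j)%N * U j) ->
  \sum_(0 <= k < n) w k * U k <= 2 * (1 + A).
Proof.
move=> U0 H0 w0 wM b0 bA HA wU0 UH.
have A0 : 0 <= A by apply: le_trans HA; apply: sumr_ge0 => k _; rewrite mulr_ge0.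
case: n HA => [|n] HA; first by rewrite big_geq// mulr_ge0// addr_ge0.
set S := \sum_(0 <= k < n.+1) w k * U k.
have S0 : 0 <= S by apply: sumr_ge0 => k _; rewrite mulr_ge0.
suff : S <= 1 + A + b * (S * A) by nra.
have conv := sum_convolution_le n.+1 (fun k => mulr_ge0 (w0 k) (U0 k)) (fun k => mulr_ge0 (w0 k) (H0 k)).
apply: (@le_trans _ _ (1 + \sum_(1 <= k < n.+1) w k * H k +
   b * \sum_(0 <= k < n.+1) \sum_(0 <= j < k) (w j * U j) * (w (k - j)%N * H (k - j)%N))); last first.
  by rewrite lerD ?lerD2l// ler_wpM2l// (le_trans conv)// ler_wpM2l.
rewrite /S big_ltn// [in leRHS](big_ltn (m := 0))// [in leRHS](big_geq (m := 0) (n := 0))// add0r.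
rewrite -addrA lerD// mulr_sumr -big_split/=.
apply: ler_sum_nat => k /andP[k0 _].
apply: le_trans (ler_wpM2l (w0 k) (UH _ k0)) _.
rewrite mulrDr lerD2l mulrCA ler_wpM2l// mulr_sumr.
apply: ler_sum_nat => j /andP[_ jk].
have := ler_wpM2r (mulr_ge0 (H0 (k - j)%N) (U0 j)) (wM _ _ (ltnW jk)).
by move=> /le_trans; apply; rewrite le_eqVlt; apply/orP; left; apply/eqP; ring.
Qed.

End renewal_sequence.

Section heat_sums.
Context {R : realType} {d : nat}.
Variable h : R.
Hypothesis h0 : 0 < h.

(** The weight [(1 + k h) ^ (1/4)]: any exponent in [(0, 1/2)] would do. *)
Definition weight (k : nat) : R := Num.sqrt (Num.sqrt (1 + k%:R * h)).

Lemma weight_gt0 k : 0 < weight k.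
Proof. by rewrite /weight !sqrtr_gt0 ltr_pwDl// mulr_ge0// ltW. Qed.

Lemma weight_sqr k : weight k ^+ 2 = Num.sqrt (1 + k%:R * h).
Proof. by rewrite sqr_sqrtr// sqrtr_ge0. Qed.

Lemma weight4 k : weight k ^+ 4 = 1 + k%:R * h.
Proof.
rewrite (exprM _ 2 2) weight_sqr sqr_sqrtr// addr_ge0// mulr_ge0// ltW//.
Qed.

Lemma weight0 : weight 0 = 1.
Proof. by rewrite /weight mul0r addr0 !sqrtr1. Qed.

Lemma weight_mono j k : (j <= k)%N -> weight j <= weight k.
Proof.
move=> jk; rewrite /weight ler_wsqrtr// ler_wsqrtr//.
by rewrite lerD2l ler_wpM2r ?ler_nat// ltW.
Qed.

Lemma weight_split j k : (j <= k)%N -> weight k <= weight j * weight (k - j).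
Proof.
move=> jk; rewrite -(@ler_pXn2r _ 4)// ?nnegrE ?mulr_ge0 ?(ltW (weight_gt0 _))//.
rewrite exprMn !weight4 natrB// -subr_ge0.
rewrite (_ : _ - _ = (j%:R * h) * ((k%:R - j%:R) * h)); last by ring.
by rewrite !mulr_ge0 ?subr_ge0 ?ler_nat// ltW.
Qed.

(** With [y < w] consecutive weights and [h = w^4 - y^4], the summand is at most
    a constant times [1 / y - 1 / w]: the sum telescopes. *)
Lemma weight_heat_sum n : \sum_(1 <= k < n.+1)
    weight k * heat_bound (d := d) (k%:R * h) <=
  4 * (4 + 24 * d%:R ^+ 2) / h * (1 - (weight n)^-1).
Proof.
set K : R := 4 + 24 * d%:R ^+ 2.
have K0 : 0 <= K by rewrite addr_ge0// mulr_ge0// sqr_ge0.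
elim: n => [|n IH]; first by rewrite big_geq// weight0 invr1 subrr mulr0.
rewrite big_nat_recr//=; apply: (le_trans (lerD IH (lexx _))).
rewrite /heat_bound -/K -weight_sqr.
have y0 := weight_gt0 n; have w0 := weight_gt0 n.+1.
have yw : weight n <= weight n.+1 by exact: weight_mono.
have e : weight n.+1 ^+ 4 = weight n ^+ 4 + h by rewrite !weight4 -natr1; ring.
move: (weight n) (weight n.+1) y0 w0 yw e => y w y0 w0 yw e.
have hE : h = (w - y) * (w ^+ 3 + w ^+ 2 * y + w * y ^+ 2 + y ^+ 3).
  by rewrite -[h](addKr (y ^+ 4)) -e; ring.
have wy0 : 0 <= w - y by rewrite subr_ge0.
have key : h / (4 * w ^+ 5) <= y^-1 - w^-1.
  rewrite -subr_ge0 (_ : _ - _ = (w - y) * (4 * w ^+ 4 - y * (w ^+ 3 + w ^+ 2 * y + w * y ^+ 2 + y ^+ 3)) / (4 * w ^+ 5 * y)).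
    apply: divr_ge0; last by rewrite !mulr_ge0 ?exprn_ge0// ltW.
    apply: mulr_ge0 => //; rewrite subr_ge0.
    have h1 : y * w ^+ 3 <= w ^+ 4 by rewrite (exprS w 3) ler_wpM2r ?exprn_ge0// ltW.
    have h2 : y * (w ^+ 2 * y) <= w ^+ 4.
      rewrite mulrCA -expr2 (_ : w ^+ 4 = w ^+ 2 * w ^+ 2); last by rewrite -exprD.
      by rewrite ler_wpM2l ?sqr_ge0// ler_sqr ?nnegrE// ltW.
    have h3 : y * (w * y ^+ 2) <= w ^+ 4.
      rewrite mulrCA -exprS (exprS w 3) ler_wpM2l ?(ltW w0)//.
      by rewrite lerXn2r ?nnegrE// ltW.
    have h4 : y * y ^+ 3 <= w ^+ 4 by rewrite -exprS lerXn2r ?nnegrE// ltW.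
    by rewrite !mulrDr; lra.
  by rewrite {1}hE; field; rewrite (gt_eqF y0) (gt_eqF w0).
have c0 : 0 <= 4 * K / h by rewrite divr_ge0 ?mulr_ge0// ltW.
have := ler_wpM2l c0 key.
rewrite (_ : w * (K / (w ^+ 2) ^+ 3) = 4 * K / h * (h / (4 * w ^+ 5))); last first.
  by field; rewrite (gt_eqF h0) (gt_eqF w0).
move=> le; rewrite -lerBrDl -mulrBr (_ : 1 - w^-1 - (1 - y^-1) = y^-1 - w^-1); last by ring.
by [].
Qed.

End heat_sums.

Lemma integral_prob_one (R : realType) (dT : measure_display) (T : measurableType dT)
    (P : probability T R) : (\int[P]_(w in [set: T]) 1 = 1)%E.
Proof. by rewrite integral_cst// mul1e; exact: probability_setT. Qed.

Lemma integral_prob_cst (R : realType) (dT : measure_display) (T : measurableType dT)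
    (P : probability T R) (c : R) : (\int[P]_(w in [set: T]) c%:E = c%:E)%E.
Proof. by rewrite integral_cst// -[RHS]mule1; congr (_ * _)%E; exact: probability_setT. Qed.

Section visits.
Context {R : realType} {d : nat} {dE : measure_display} {E : measurableType dE}.
Variables (P : probability E R) (tau : nat -> E -> R) (xi : nat -> E -> 'rV[int]_d).
Hypothesis srw : simple_random_walk P tau xi.
Hypothesis d3 : (3 <= d)%N.
Variables (x : 'rV[int]_d) (h : R).
Hypothesis h0 : 0 < h.
Variables (gam : nat -> 'rV[int]_d) (b : R).
Hypothesis b0 : 0 <= b.

(** Encounters with a fixed path [gam]; the second walk is integrated out
    later. *)
Definition meeting (i : nat) (w : E) : R := (grid_site tau xi x h i w == gam i)%:R.

Definition visit (k : nat) (w : E) : R :=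
  meeting k w * \prod_(0 <= i < k) (1 + b * meeting i w).

Let history := history tau xi h.

Definition history_visit (k : nat) (v : seq nat * seq 'rV[int]_d) : R :=
  (history_site x v k == gam k)%:R *
  \prod_(0 <= i < k) (1 + b * (history_site x v i == gam i)%:R).

Lemma prod_meeting_ge0 k w : 0 <= \prod_(0 <= i < k) (1 + b * meeting i w).
Proof. by apply: prodr_ge0 => i _; rewrite addr_ge0 ?mulr_ge0. Qed.

Lemma history_visit_ge0 k v : 0 <= history_visit k v.
Proof. by rewrite mulr_ge0//; apply: prodr_ge0 => i _; rewrite addr_ge0 ?mulr_ge0. Qed.

Lemma visitE k w : visit k w = history_visit k (history k w).
Proof.
rewrite /visit /history_visit /meeting -(history_siteE srw x h0)//; congr (_ * _).
apply: eq_big_nat => i /andP[_ ik]; rewrite -(history_siteE srw x h0)//.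
exact: ltnW.
Qed.

Lemma visit_ge0 k w : 0 <= visit k w.
Proof. by rewrite visitE history_visit_ge0. Qed.

Lemma visit_le k w : visit k w <= (1 + b) ^+ k.
Proof.
have le1 i : meeting i w <= 1 by rewrite /meeting; case: eqP.
apply: (@le_trans _ _ (\prod_(0 <= i < k) (1 + b * meeting i w))).
  by rewrite ler_piMl ?prod_meeting_ge0.
rewrite -[k in leRHS]subn0 -prodr_const_nat; apply: ler_prod => i _.
by rewrite addr_ge0 ?mulr_ge0//= lerD2l ler_piMr.
Qed.

(** Expansion according to the last factor that is not replaced by [1]. *)
Lemma prod_meeting k w :
  \prod_(0 <= i < k) (1 + b * meeting i w) = 1 + b * \sum_(0 <= j < k) visit j w.
Proof.
elim: k => [|k IH]; first by rewrite !big_geq// mulr0 addr0.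
rewrite !big_nat_recr//= {2}/visit IH; ring.
Qed.

Lemma measurable_visit k : measurable_fun setT (visit k).
Proof.
rewrite (_ : visit k = history_visit k \o history k); last first.
  by apply/funext => w; rewrite visitE.
apply: measurable_fun_countable_rv; exact: (countable_rv_history srw).
Qed.

Definition visit_mean (k : nat) : R := fine (\int[P]_w (visit k w)%:E)%E.

Lemma visit_meanE k : (\int[P]_w (visit k w)%:E = (visit_mean k)%:E)%E.
Proof.
rewrite /visit_mean fineK// ge0_fin_numE; last by apply: integral_ge0 => w _; rewrite lee_fin visit_ge0.
apply: (@le_lt_trans _ _ (\int[P]_w (cst ((1 + b) ^+ k)%:E w))%E).
  apply: ge0_le_integral => //.
  - by move=> w _; rewrite lee_fin visit_ge0.
  - by apply/measurable_EFinP; exact: measurable_visit.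
  - by move=> w _; rewrite lee_fin visit_le.
rewrite integral_cst//.
by rewrite lte_mul_pinfty ?lee_fin ?exprn_ge0 ?addr_ge0// ltey_eq fin_num_measure.
Qed.

Lemma visit_mean_ge0 k : 0 <= visit_mean k.
Proof.
by rewrite -lee_fin -visit_meanE; apply: integral_ge0 => w _; rewrite lee_fin visit_ge0.
Qed.

Lemma visit_mean0 : visit_mean 0 <= 1.
Proof.
rewrite -lee_fin -visit_meanE.
apply: (@le_trans _ _ (\int[P]_w (cst 1%E w))%E).
  apply: ge0_le_integral => //.
  - by move=> w _; rewrite lee_fin visit_ge0.
  - by apply/measurable_EFinP; exact: measurable_visit.
  - by move=> w _; rewrite lee_fin (le_trans (visit_le 0 w)).
by rewrite integral_cst// mul1e probability_le1.
Qed.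

(** Expand the product in [visit k] and apply the Markov property from the time
    [j] of the last recorded encounter to time [k]. *)
Lemma visit_mean_renewal k : (0 < k)%N ->
  visit_mean k <= heat_bound (d := d) (k%:R * h) +
    b * \sum_(0 <= j < k) heat_bound (d := d) ((k - j)%:R * h) * visit_mean j.
Proof.
move=> k0; rewrite -lee_fin -visit_meanE.
pose f j w := meeting k w * history_visit j (history j w).
have f0 j w : 0 <= f j w by rewrite mulr_ge0// history_visit_ge0.
have mmeets i : measurable_fun setT (meeting i).
  exact: (measurable_fun_countable_rv (fun z => (z == gam i)%:R : R) (countable_rv_grid_site srw x h0 i)).
have mf j : measurable_fun setT (f j).
  apply: measurable_funM => //.
  exact: (measurable_fun_countable_rv (history_visit j) (countable_rv_history srw h j)).
have -> : (\int[P]_w (visit k w)%:E =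
    \int[P]_w ((meeting k w)%:E + b%:E * \sum_(0 <= j < k) (f j w)%:E))%E.
  apply: eq_integral => w _; rewrite sumEFin -EFinM -EFinD; congr EFin.
  rewrite /visit prod_meeting mulrDr mulr1 mulrCA mulr_sumr; congr (_ + _ * _).
  by apply: eq_bigr => j _; rewrite visitE.
have mS : measurable_fun setT (fun w => \sum_(0 <= j < k) (f j w)%:E)%E.
  by apply: emeasurable_sum => j; apply/measurable_EFinP.
rewrite ge0_integralD//=; last 4 first.
- by move=> w _; rewrite lee_fin.
- exact/measurable_EFinP.
- by move=> w _; rewrite mule_ge0 ?lee_fin// sume_ge0// => j _; rewrite lee_fin.
- exact: measurable_funeM.
rewrite EFinD; apply: leeD.
  have := markov srw d3 x h0 (gam k) k0 (G := fun=> 1) (fun=> ler01).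
  rewrite subn0 integral_prob_one mule1.
  by under eq_integral do rewrite mulr1.
rewrite ge0_integralZl//; last first.
  by move=> w _; rewrite sume_ge0// => j _; rewrite lee_fin.
rewrite ge0_integral_sum//; last 2 first.
- by move=> j; exact/measurable_EFinP.
- by move=> j w _; rewrite lee_fin.
rewrite EFinM lee_wpmul2l ?lee_fin// -sumEFin big_nat_cond [leRHS]big_nat_cond.
apply: lee_sum => j /andP[/andP[_ jk] _].
apply: le_trans (markov srw d3 x h0 (gam k) jk (history_visit_ge0 j)) _.
rewrite [leRHS]EFinM -visit_meanE le_eqVlt; apply/orP; left; apply/eqP.
by congr (_ * _)%E; apply: eq_integral => w _; rewrite visitE.
Qed.

End visits.

Section overlap.
Context {R : realType} {d : nat} {dE : measure_display} {E : measurableType dE}.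
Variables (P : probability E R) (tau : nat -> E -> R) (xi : nat -> E -> 'rV[int]_d).
Hypothesis srw : simple_random_walk P tau xi.
Hypothesis d3 : (3 <= d)%N.
Variables (x : 'rV[int]_d) (h : R).
Hypothesis h01 : 0 < h <= 1.
Variable beta : R.
Hypothesis beta_small : 16 * (4 + 24 * d%:R ^+ 2) * beta ^+ 2 <= 1.

(** The excess factor for every time slot that two walks share. *)
Definition slot_gain : R := expR (beta ^+ 2 * h) - 1.

Lemma slot_gain_ge0 : 0 <= slot_gain.
Proof.
rewrite subr_ge0 -expR0 ler_expR mulr_ge0 ?sqr_ge0//.
by case/andP: h01 => /ltW.
Qed.

Lemma beta2_le : beta ^+ 2 <= 64^-1.
Proof.
have := beta_small; have := sqr_ge0 beta; have := sqr_ge0 (d%:R : R).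
move: (beta ^+ 2) (d%:R ^+ 2) => u v v0 u0; nra.
Qed.

Lemma slot_gain_le : slot_gain <= 2 * beta ^+ 2 * h.
Proof.
case/andP: h01 => h0 h1; have b2 := beta2_le.
set u := beta ^+ 2 * h; have u0 : 0 <= u by rewrite mulr_ge0 ?sqr_ge0// ltW.
have u1 : u <= 2^-1 by rewrite /u; nra.
have : 1 - u <= expR (- u) by rewrite (le_trans _ (expR_ge1Dx _))//.
rewrite expRN => h2; rewrite lerBlDr -mulrA -/u.
have e0 := expR_gt0 u.
have : (1 - u) * expR u <= 1 by rewrite -ler_pdivlMr// div1r.
nra.
Qed.

(** The weight is increasing, so the tail is at most the weighted sum divided by
    the weight at [m]. *)
Lemma visit_mean_tail (gam : nat -> 'rV[int]_d) m n : (m <= n)%N ->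
  slot_gain * \sum_(m <= k < n) visit_mean P tau xi x h gam slot_gain k <=
  5 / weight h m.
Proof.
case/andP: h01 => h0 h1 mn; have g0 := slot_gain_ge0.
set U := visit_mean P tau xi x h gam slot_gain.
have U0 k : 0 <= U k by exact: (visit_mean_ge0 srw).
have w0 k : 0 < weight h k by exact: weight_gt0.
set K : R := 4 + 24 * d%:R ^+ 2.
have K0 : 0 < K by rewrite ltr_pwDl// mulr_ge0// sqr_ge0.
pose H k := heat_bound (R := R) (d := d) (k%:R * h).
have gA : slot_gain * (4 * K / h) <= 2^-1.
  apply: le_trans (ler_wpM2r _ slot_gain_le) _.
    by rewrite divr_ge0 ?mulr_ge0// ltW.
  rewrite [leLHS](_ : _ = 8 * K * beta ^+ 2); last by field; rewrite gt_eqF.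
  have := beta_small; rewrite -/K; lra.
have HA : \sum_(1 <= k < n) weight h k * H k <= 4 * K / h.
  have [n0|n0] := leqP n 1; first by rewrite big_geq// divr_ge0 ?mulr_ge0// ltW.
  rewrite -(ltn_predK n0); apply: le_trans (weight_heat_sum h0 _) _.
  rewrite -/K ler_piMr ?divr_ge0 ?mulr_ge0 ?(ltW h0) ?(ltW K0)//.
  by rewrite lerBlDr lerDl invr_ge0 ltW.
have UH k : (0 < k)%N -> U k <= H k + slot_gain * \sum_(0 <= j < k) H (k - j)%N * U j.
  by move=> k0; exact: (visit_mean_renewal srw).
have H0 k : 0 <= H k.
  by rewrite divr_ge0 ?exprn_ge0 ?sqrtr_ge0// ltW.
have wU0 : weight h 0 * U 0%N <= 1 by rewrite weight0 mul1r (visit_mean0 srw).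
have := @renewal_bound R U H (weight h) (4 * K / h) slot_gain n U0 H0 (fun k => ltW (w0 k))
  (fun j k => @weight_split R h h0 j k) g0 gA HA wU0 UH.
set S := \sum_(0 <= k < n) _ => HS.
have S0 : 0 <= S by apply: sumr_ge0 => k _; rewrite mulr_ge0// ltW.
have US : \sum_(m <= k < n) U k <= S / weight h m.
  apply: (@le_trans _ _ (\sum_(m <= k < n) weight h k * U k / weight h m)).
    apply: ler_sum_nat => k /andP[mk _].
    rewrite mulrAC ler_peMl// ler_pdivlMr// mul1r; exact: weight_mono.
  rewrite -mulr_suml ler_wpM2r ?invr_ge0 ?(ltW (w0 m))//.
  rewrite /S [leRHS](big_cat_nat (n := m))//= lerDr sumr_ge0// => k _.
  by rewrite mulr_ge0// ltW.
apply: le_trans (ler_wpM2l g0 US) _; rewrite mulrA ler_wpM2r ?invr_ge0 ?(ltW (w0 m))//.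
apply: le_trans (ler_wpM2l g0 HS) _.
have g2 : slot_gain <= 2.
  apply: le_trans slot_gain_le _; have := beta2_le; have := sqr_ge0 beta.
  by move: (beta ^+ 2) => v v0 v1; nra.
by rewrite mulrCA mulrDr mulr1; lra.
Qed.

(** The expected overlap of the walk with a given path between the [m]-th and
    the [n]-th time slot decays like a power of [m], uniformly in the path. *)
Lemma overlap_tail (gam : nat -> 'rV[int]_d) m n : (m <= n)%N ->
  (\int[P]_w (\prod_(0 <= i < n) (1 + slot_gain * meeting tau xi x h gam i w))%:E <=
   \int[P]_w (\prod_(0 <= i < m) (1 + slot_gain * meeting tau xi x h gam i w))%:E +
   (5 / weight h m)%:E)%E.
Proof.
move=> mn; have g0 := slot_gain_ge0; case/andP: (h01) => h0 h1.
have mv k : measurable_fun setT (fun w => (visit tau xi x h gam slot_gain k w)%:E).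
  by apply/measurable_EFinP; exact: (measurable_visit srw).
have v0 k w : (0 <= (visit tau xi x h gam slot_gain k w)%:E)%E.
  by rewrite lee_fin (visit_ge0 srw).
have p0 k w : (0 <= (\prod_(0 <= i < k) (1 + slot_gain * meeting tau xi x h gam i w))%:E)%E.
  by rewrite lee_fin prod_meeting_ge0.
have IE k : (\int[P]_w (\prod_(0 <= i < k) (1 + slot_gain * meeting tau xi x h gam i w))%:E =
    (1 + slot_gain * \sum_(0 <= j < k) visit_mean P tau xi x h gam slot_gain j)%:E)%E.
  rewrite (eq_integral (fun w => cst 1%E w + slot_gain%:E *
      \sum_(0 <= j < k) (visit tau xi x h gam slot_gain j w)%:E)%E); last first.
    by move=> w _; rewrite prod_meeting sumEFin.
  have mS : measurable_fun setT (fun w => \sum_(0 <= j < k) (visit tau xi x h gam slot_gain j w)%:E)%E.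
    exact: emeasurable_sum.
  have S0 w : (0 <= \sum_(0 <= j < k) (visit tau xi x h gam slot_gain j w)%:E)%E.
    by rewrite sume_ge0.
  rewrite ge0_integralD//=; last 2 first.
  - by move=> w _; rewrite mule_ge0.
  - exact: measurable_funeM.
  rewrite integral_prob_one ge0_integralZl//.
  rewrite ge0_integral_sum//.
  rewrite (eq_bigr _ (fun j _ => visit_meanE srw x h0 gam g0 j)).
  by rewrite sumEFin.
rewrite !IE -EFinD lee_fin -addrA lerD2l.
rewrite (big_cat_nat (n := m))//= mulrDr lerD2l.
exact: visit_mean_tail.
Qed.

End overlap.

(** * The discretized partition function *)

Lemma sum_initial (R : realType) (F : nat -> R) m n : (m <= n)%N ->
  \sum_(0 <= i < n) (i < m)%:R * F i = \sum_(0 <= i < m) F i.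
Proof.
move=> mn; rewrite (big_cat_nat (n := m))//= [X in _ + X]big_nat_cond.
rewrite [X in _ + X]big1 ?addr0.
  by apply: eq_big_nat => i /andP[_ ->]; rewrite mul1r.
by move=> i; rewrite andbT => /andP[mi _]; rewrite ltnNge mi mul0r.
Qed.

Lemma measurable_integral2 (R : realType) (d1 d2 : measure_display)
    (T1 : measurableType d1) (T2 : measurableType d2) (P : probability T1 R)
    (f : T1 -> T2 -> R) : (forall w om, 0 <= f w om) ->
  measurable_fun setT (fun p : T1 * T2 => f p.1 p.2) ->
  measurable_fun setT (fun om => \int[P]_w (f w om)%:E)%E.
Proof.
move=> f0 mf.
apply: (@measurable_fun_fubini_tonelli_G _ _ T1 T2 R P (fun p => (f p.1 p.2)%:E)).
  exact/measurable_EFinP.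
by move=> p; rewrite lee_fin.
Qed.

Lemma fubini_real (R : realType) (d1 d2 : measure_display)
    (T1 : measurableType d1) (T2 : measurableType d2) (P : probability T1 R)
    (Q : probability T2 R) (f : T1 -> T2 -> R) : (forall w om, 0 <= f w om) ->
  measurable_fun setT (fun p : T1 * T2 => f p.1 p.2) ->
  (\int[Q]_om \int[P]_w (f w om)%:E = \int[P]_w \int[Q]_om (f w om)%:E)%E.
Proof.
move=> f0 mf; rewrite -(fubini_tonelli (fun p => (f p.1 p.2)%:E))//.
  exact/measurable_EFinP.
by move=> p; rewrite lee_fin.
Qed.

Section section_measurability.
Context {R : realType} {d1 d2 : measure_display} {T1 : measurableType d1}
  {T2 : measurableType d2} (f : T1 -> T2 -> R).
Hypothesis mf : measurable_fun setT (fun p : T1 * T2 => f p.1 p.2).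

Lemma measurable_section1 om : measurable_fun setT (fun w => f w om).
Proof. exact: (measurableT_comp mf (pair2_measurable om)). Qed.

Lemma measurable_section2 w : measurable_fun setT (fun om => f w om).
Proof. exact: (measurableT_comp mf (pair1_measurable w)). Qed.

End section_measurability.

Lemma ae_fin_section (R : realType) (d1 d2 : measure_display)
    (T1 : measurableType d1) (T2 : measurableType d2) (P : probability T1 R)
    (Q : probability T2 R) (f : T1 -> T2 -> R) : (forall w om, 0 <= f w om) ->
  measurable_fun setT (fun p : T1 * T2 => f p.1 p.2) ->
  (\int[P]_w \int[Q]_om (f w om)%:E < +oo)%E ->
  {ae Q, forall om, (\int[P]_w (f w om)%:E)%E \is a fin_num}.
Proof.
move=> f0 mf ffin.
have I0 om : (0 <= \int[P]_w (f w om)%:E)%E by apply: integral_ge0 => w _; rewrite lee_fin.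
have : Q.-integrable setT (fun om => \int[P]_w (f w om)%:E)%E.
  apply/integrableP; split; first exact: measurable_integral2.
  rewrite (eq_integral (fun om => \int[P]_w (f w om)%:E)%E); last first.
    by move=> om _; rewrite gee0_abs.
  by rewrite fubini_real.
by move=> /(integrable_ae measurableT); apply: filterS => om; apply.
Qed.

(** Expansion of the square, with the negative term moved to the left so that
    all integrals are of nonnegative functions and may be infinite. *)
Lemma integral_sqr_dist (R : realType) (dT : measure_display) (T : measurableType dT)
    (Q : probability T R) (u v : T -> R) :
  measurable_fun setT u -> measurable_fun setT v ->
  (forall om, 0 <= u om) -> (forall om, 0 <= v om) ->
  (\int[Q]_om ((u om - v om) ^+ 2)%:E +
     (\int[Q]_om (u om * v om)%:E + \int[Q]_om (u om * v om)%:E) =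
   \int[Q]_om (u om * u om)%:E + \int[Q]_om (v om * v om)%:E)%E.
Proof.
move=> mu mv u0 v0.
have DD (f1 f2 : T -> R) (m1 : measurable_fun setT f1) (m2 : measurable_fun setT f2)
    (p1 : forall om, 0 <= f1 om) (p2 : forall om, 0 <= f2 om) :
    (\int[Q]_om (f1 om)%:E + \int[Q]_om (f2 om)%:E = \int[Q]_om (f1 om + f2 om)%:E)%E.
  rewrite -ge0_integralD//; do ?exact/measurable_EFinP;
  by move=> om _; rewrite lee_fin.
have muv := measurable_funM mu mv; have uv0 om := mulr_ge0 (u0 om) (v0 om).
rewrite (DD _ _ muv muv uv0 uv0).
rewrite (DD _ _ (measurable_funM mu mu) (measurable_funM mv mv)); last 2 first.
- by move=> om; rewrite mulr_ge0.
- by move=> om; rewrite mulr_ge0.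
rewrite (DD _ _ (measurable_funX 2 (measurable_funB mu mv)) (measurable_funD muv muv)).
- by apply: eq_integral => om _; congr EFin; rewrite /=; ring.
- by move=> om; exact: sqr_ge0.
- by move=> om; exact: addr_ge0 (uv0 om) (uv0 om).
Qed.

Section grid_partition.
Context {R : realType} {d : nat} {dE dO : measure_display}
  {E : measurableType dE} {Omega : measurableType dO}.
Variables (Q : probability Omega R) (W : 'rV[int]_d -> R -> Omega -> R).
Variables (P : probability E R) (tau : nat -> E -> R) (xi : nat -> E -> 'rV[int]_d).
Hypothesis envW : wiener_environment Q W.
Hypothesis srw : simple_random_walk P tau xi.
Hypothesis d3 : (3 <= d)%N.
Variables (x : 'rV[int]_d) (s h : R).
Hypothesis h01 : 0 < h <= 1.
Variable beta : R.
Hypothesis beta_small : 16 * (4 + 24 * d%:R ^+ 2) * beta ^+ 2 <= 1.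

Let h0 : 0 < h. Proof. by case/andP: h01. Qed.
Let site := grid_site tau xi x h.
Let g := slot_gain h beta.
Let g0 : 0 <= g. Proof. exact: (slot_gain_ge0 h01). Qed.

(** The action along the walk watched at the grid times only, and its
    exponential normalized to have mean [1] under [Q]. *)
Definition grid_action (n : nat) (w : E) (om : Omega) : R :=
  \sum_(0 <= i < n) incr W s h i (site i w) om.

Definition grid_weight (n : nat) (w : E) (om : Omega) : R :=
  expR (beta * grid_action n w om - beta ^+ 2 / 2 * (n%:R * h)).

Lemma grid_weight_ge0 n w om : 0 <= grid_weight n w om.
Proof. exact: expR_ge0. Qed.

Lemma measurable_grid_action n :
  measurable_fun setT (fun p : E * Omega => grid_action n p.1 p.2).
Proof.
apply: measurable_sum => i.
apply: (measurable_fun_countable_rv_pair (f := incr W s h i)).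
  exact: (countable_rv_grid_site srw).
by move=> z; exact: (measurable_incr envW).
Qed.

Lemma measurable_grid_weight n :
  measurable_fun setT (fun p : E * Omega => grid_weight n p.1 p.2).
Proof.
apply: measurableT_comp => //; apply: measurable_funB => //.
by apply: measurable_funM => //; exact: measurable_grid_action.
Qed.

Definition pair_overlap (m : nat) (w w' : E) : R :=
  \prod_(0 <= i < m) (1 + g * meeting tau xi x h (site^~ w') i w).

(** The diagonal part of the exponential moment cancels against the
    normalization; only shared slots remain, and only the common [m] of them. *)
Lemma grid_weight_cov n m w w' : (m <= n)%N ->
  (\int[Q]_om (grid_weight n w om * grid_weight m w' om)%:E =
   (pair_overlap m w w')%:E)%E.
Proof.
move=> mn.
pose c := expR (- (beta ^+ 2 / 2 * (n%:R * h)) - beta ^+ 2 / 2 * (m%:R * h)).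
have := two_path_exp_moment envW s h0 n (site^~ w) (site^~ w') (fun=> beta) (fun i => (i < m)%:R * beta).
set F := (X in (\int[Q]_om X om)%E) => HF.
transitivity (\int[Q]_om (c%:E * F om))%E.
  apply: eq_integral => om _; rewrite /F -EFinM -!expRD; congr (expR _)%:E.
  rewrite big_split/= -mulr_sumr.
  under [X in _ = _ + (_ + X)]eq_bigr do rewrite -mulrA.
  rewrite (sum_initial (fun i => beta * incr W s h i (site i w') om))// -mulr_sumr.
  rewrite /grid_action; ring.
rewrite ge0_integralZl ?lee_fin ?expR_ge0//; last first.
- by move=> om _; rewrite lee_fin expR_ge0.
- apply/measurable_EFinP; apply: measurableT_comp => //.
  apply: measurable_sum => i.
  by apply: measurable_funD; apply: measurable_funM => //; exact: (measurable_incr envW).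
rewrite HF -EFinM -expRD; congr EFin.
transitivity (\prod_(0 <= i < m) expR (beta ^+ 2 * h * (site i w == site i w')%:R)).
  rewrite -expR_sum; congr expR.
  have -> : \sum_(0 <= i < n) (beta ^+ 2 + ((i < m)%:R * beta) ^+ 2 +
      2 * beta * ((i < m)%:R * beta) * (site i w == site i w')%:R) =
    n%:R * beta ^+ 2 + (m%:R * beta ^+ 2 + 2 * beta ^+ 2 * \sum_(0 <= i < m) (site i w == site i w')%:R).
    transitivity (\sum_(0 <= i < n) (beta ^+ 2 + (i < m)%:R * (beta ^+ 2 + 2 * beta ^+ 2 * (site i w == site i w')%:R))).
      by apply: eq_bigr => i _; case: (i < m)%N; rewrite ?mul0r ?mul1r; ring.
    rewrite big_split/= (sum_initial (fun i => beta ^+ 2 + 2 * beta ^+ 2 * (site i w == site i w')%:R))//.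
    rewrite big_split/= !sumr_const_nat !subn0 mulr_sumr.
    by rewrite -(mulr_natl (beta ^+ 2) n) -(mulr_natl (beta ^+ 2) m).
  by rewrite -mulr_sumr; field.
apply: eq_bigr => i _; rewrite /g /slot_gain /meeting -/site.
by case: eqP => _; rewrite ?mulr1 ?mulr0 ?expR0 ?addr0// addrC subrK.
Qed.

Lemma grid_weight_mean n w : (\int[Q]_om (grid_weight n w om)%:E = 1)%E.
Proof.
have := grid_weight_cov w w (leq0n n); rewrite /pair_overlap big_geq// => <-.
apply: eq_integral => om _; rewrite /grid_weight {3}/grid_action big_geq//.
by rewrite mulr0 mul0r mulr0 subr0 expR0 mulr1.
Qed.

Lemma grid_weight_moment4 n w :
  (\int[Q]_om (grid_weight n w om ^+ 4)%:E = (expR (6 * beta ^+ 2 * (n%:R * h)))%:E)%E.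
Proof.
pose c := expR (- 2 * beta ^+ 2 * (n%:R * h)).
have := two_path_exp_moment envW s h0 n (site^~ w) (site^~ w) (fun=> 4 * beta) (fun=> 0).
set F := (X in (\int[Q]_om X om)%E) => HF.
transitivity (\int[Q]_om (c%:E * F om))%E.
  apply: eq_integral => om _; rewrite /F -EFinM -!expRD -expRM_natl; congr (expR _)%:E.
  under eq_bigr do rewrite mul0r addr0.
  by rewrite -mulr_sumr /grid_action; field.
rewrite ge0_integralZl ?lee_fin ?expR_ge0//; last first.
- by move=> om _; rewrite lee_fin expR_ge0.
- apply/measurable_EFinP; apply: measurableT_comp => //.
  apply: measurable_sum => i.
  by apply: measurable_funD; apply: measurable_funM => //; exact: (measurable_incr envW).
rewrite HF -EFinM -expRD; congr (expR _)%:E.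
under eq_bigr do rewrite expr0n/= addr0 mulr0 mul0r addr0.
by rewrite sumr_const_nat subn0 -mulr_natl; field.
Qed.

Lemma pair_overlap_ge0 m w w' : 0 <= pair_overlap m w w'.
Proof. exact: prod_meeting_ge0. Qed.

Definition grid_Z (n : nat) (om : Omega) : R := fine (\int[P]_w (grid_weight n w om)%:E)%E.

Lemma grid_Z_ge0 n om : 0 <= grid_Z n om.
Proof. by rewrite fine_ge0// integral_ge0// => w _; rewrite lee_fin grid_weight_ge0. Qed.

Lemma measurable_grid_Z n : measurable_fun setT (grid_Z n).
Proof.
apply: measurableT_comp => //; apply: measurable_integral2 => [w om|].
  exact: grid_weight_ge0.
exact: measurable_grid_weight.
Qed.

Lemma grid_Z_ae n :
  {ae Q, forall om, (\int[P]_w (grid_weight n w om)%:E = (grid_Z n om)%:E)%E}.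
Proof.
have := @ae_fin_section R _ _ E Omega P Q (grid_weight n) (grid_weight_ge0 n) (measurable_grid_weight n).
rewrite (eq_integral (cst 1%E)); last by move=> w _; exact: grid_weight_mean.
rewrite integral_prob_one => /(_ (ltry _)); apply: filterS => om /fineK.
by rewrite /grid_Z => ->.
Qed.

Definition mean_overlap (m : nat) : \bar R :=
  (\int[P]_w' \int[P]_w (pair_overlap m w w')%:E)%E.

Lemma measurable_pair_overlap m :
  measurable_fun setT (fun p : E * E => pair_overlap m p.1 p.2).
Proof.
apply: measurable_prod => i _; apply: measurable_funD => //.
apply: measurable_funM => //.
apply: (measurable_fun_countable_rv_pair (V := site i)
  (f := fun z w' => (z == site i w')%:R : R)).
  exact: (countable_rv_grid_site srw).
move=> z.
exact: (measurable_fun_countable_rv (fun z' => (z == z')%:R : R) (countable_rv_grid_site srw x h0 i)).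
Qed.

Lemma mean_overlap_tail m n : (m <= n)%N ->
  (mean_overlap n <= mean_overlap m + (5 / weight h m)%:E)%E.
Proof.
move=> mn; rewrite /mean_overlap.
have mI k : measurable_fun setT (fun w' => \int[P]_w (pair_overlap k w w')%:E)%E.
  by apply: measurable_integral2 => [w w'|]; [exact: pair_overlap_ge0|exact: measurable_pair_overlap].
have I0 k w' : (0 <= \int[P]_w (pair_overlap k w w')%:E)%E.
  by apply: integral_ge0 => w _; rewrite lee_fin pair_overlap_ge0.
have w5 : 0 <= 5 / weight h m by rewrite divr_ge0// ltW// weight_gt0.
have mc : measurable_fun [set: E] (fun _ : E => (5 / weight h m)%:E) by [].
have c0 (w' : E) : [set: E] w' -> (0 <= (5 / weight h m)%:E)%E by rewrite lee_fin.
have e := ge0_integralD P measurableT (fun w' _ => I0 m w') (mI m) c0 mc.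
rewrite integral_prob_cst in e; rewrite -e.
apply: ge0_le_integral => //; first exact: emeasurable_funD.
move=> w' _; exact: (overlap_tail srw d3 x h01 beta_small (site^~ w')).
Qed.

Lemma mean_overlap_fin m : mean_overlap m \is a fin_num.
Proof.
have I0 w' : (0 <= \int[P]_w (pair_overlap m w w')%:E)%E.
  by apply: integral_ge0 => w _; rewrite lee_fin pair_overlap_ge0.
rewrite ge0_fin_numE; last exact: integral_ge0.
apply: (@le_lt_trans _ _ (\int[P]_(w' in [set: E]) \int[P]_(w in [set: E]) ((1 + g) ^+ m)%:E)%E); last first.
  by under eq_integral do rewrite integral_prob_cst; rewrite integral_prob_cst ltry.
have c0 : 0 <= (1 + g) ^+ m by rewrite exprn_ge0// addr_ge0.
apply: ge0_le_integral => //.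
- by apply: measurable_integral2 => [w w'|]; [exact: pair_overlap_ge0|exact: measurable_pair_overlap].
move=> w' _; apply: ge0_le_integral => //.
- by move=> w _; rewrite lee_fin pair_overlap_ge0.
- apply/measurable_EFinP; exact: (measurable_section1 (measurable_pair_overlap m) w').
move=> w _; rewrite lee_fin -[m in leRHS]subn0 -prodr_const_nat.
apply: ler_prod => i _; rewrite addr_ge0 ?mulr_ge0//= lerD2l ler_piMr//.
by rewrite /meeting; case: (_ == _).
Qed.

(** Square of an average over walks as an average over pairs of walks, with the
    environment integrated first. *)
Lemma grid_Z_prod n m : (m <= n)%N ->
  (\int[Q]_om (grid_Z n om * grid_Z m om)%:E = mean_overlap m)%E.
Proof.
move=> mn.
have mW k := measurable_grid_weight k.
have w0 k w om := grid_weight_ge0 k w om.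
have mS k om : measurable_fun setT (fun w => grid_weight k w om) by exact: measurable_section1.
have mI k : measurable_fun setT (fun om => \int[P]_w (grid_weight k w om)%:E)%E.
  exact: measurable_integral2.
have I0 k om : (0 <= \int[P]_w (grid_weight k w om)%:E)%E.
  by apply: integral_ge0 => w _; rewrite lee_fin.
transitivity (\int[Q]_om ((\int[P]_w (grid_weight n w om)%:E) * \int[P]_w' (grid_weight m w' om)%:E))%E.
  apply: ae_eq_integral => //.
  - by apply/measurable_EFinP; apply: measurable_funM; exact: measurable_grid_Z.
  - exact: emeasurable_funM.
  - by apply: filterS2 (grid_Z_ae n) (grid_Z_ae m) => om hn hm _; rewrite hn hm.
transitivity (\int[Q]_om \int[P]_w' \int[P]_w (grid_weight n w om * grid_weight m w' om)%:E)%E.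
  apply: eq_integral => om _; rewrite -ge0_integralZl//; last 2 first.
  - exact/measurable_EFinP.
  - by move=> w' _; rewrite lee_fin.
  apply: eq_integral => w' _; rewrite muleC -ge0_integralZl//; last 3 first.
  - exact/measurable_EFinP.
  - by move=> w _; rewrite lee_fin.
  - by rewrite lee_fin.
  by apply: eq_integral => w _; rewrite -EFinM mulrC.
have mWW : measurable_fun setT (fun p : E * (E * Omega) =>
    grid_weight n p.1 p.2.2 * grid_weight m p.2.1 p.2.2).
  apply: measurable_funM.
    apply: (measurableT_comp (mW n) (_ : measurable_fun setT (fun p : E * (E * Omega) => (p.1, p.2.2)))).
    by apply: measurable_fun_pair => //; exact: (measurableT_comp measurable_snd measurable_snd).
  exact: (measurableT_comp (mW m) measurable_snd).
rewrite -(fubini_tonelli (m1 := P) (m2 := Q) (fun p : E * Omega => \int[P]_w (grid_weight n w p.2 * grid_weight m p.1 p.2)%:E)%E); last 2 first.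
- apply: (@measurable_integral2 _ _ _ E (E * Omega)%type P (fun w (p : E * Omega) => grid_weight n w p.2 * grid_weight m p.1 p.2)) => // w p.
  by rewrite mulr_ge0.
- by move=> p; apply: integral_ge0 => w _; rewrite lee_fin mulr_ge0.
apply: eq_integral => w' _.
rewrite fubini_real; last 2 first.
- by move=> w om; rewrite mulr_ge0.
- apply: measurable_funM; first exact: mW.
  exact: (measurableT_comp (measurable_section2 (mW m) w') measurable_snd).
by apply: eq_integral => w _; exact: grid_weight_cov.
Qed.

(** The covariance of [grid_Z n] and [grid_Z m] only depends on [m], so the
    increments are orthogonal and the second moments subtract. *)
Lemma grid_Z_dist n m : (m <= n)%N ->
  (\int[Q]_om ((grid_Z n om - grid_Z m om) ^+ 2)%:E <= (5 / weight h m)%:E)%E.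
Proof.
move=> mn; have mZ := measurable_grid_Z.
have key : (\int[Q]_om ((grid_Z n om - grid_Z m om) ^+ 2)%:E + (mean_overlap m + mean_overlap m) =
    mean_overlap n + mean_overlap m)%E.
  have := integral_sqr_dist Q (mZ n) (mZ m) (grid_Z_ge0 n) (grid_Z_ge0 m).
  by rewrite (grid_Z_prod mn) (grid_Z_prod (leqnn n)) (grid_Z_prod (leqnn m)).
have := mean_overlap_tail mn.
have := mean_overlap_fin m; have := mean_overlap_fin n; move: key.
have : (0 <= \int[Q]_om ((grid_Z n om - grid_Z m om) ^+ 2)%:E)%E.
  by apply: integral_ge0 => om _; rewrite lee_fin sqr_ge0.
move: (\int[Q]_om _)%E (mean_overlap n) (mean_overlap m) => D a b.
case: a => // a; case: b => // b; case: D => //= D _ /eqP.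
rewrite -!EFinD eqe => /eqP e _ _; rewrite !lee_fin; lra.
Qed.

End grid_partition.

(** * From the grid to the continuous-time action *)

Section ceiling.
Context {R : realType}.

(** Number of grid points [i / K], [i >= 0], before time [u]. *)
Definition grid_index (K : nat) (u : R) : nat := `|Num.ceil (u * K%:R)|%N.

Lemma lt_grid_index K u i : (0 < K)%N -> 0 <= u ->
  (i < grid_index K u)%N = (i%:R * K%:R^-1 < u).
Proof.
move=> K0 u0; have K0' : 0 < K%:R :> R by rewrite ltr0n.
rewrite ltr_pdivrMr// -[i%:R]/(i%:~R) -ceil_gt_int /grid_index.
have : 0 <= Num.ceil (u * K%:R) by rewrite ceil_ge0 (lt_le_trans (ltrN10 _))// mulr_ge0.
by case: (Num.ceil _) => // n _; rewrite ltz_nat.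
Qed.

Lemma grid_index0 K : grid_index K 0 = 0%N.
Proof. by rewrite /grid_index mul0r ceil0. Qed.

Lemma grid_index_mono K u v : 0 <= u -> u <= v -> (grid_index K u <= grid_index K v)%N.
Proof.
move=> u0 uv; rewrite /grid_index.
have h : Num.ceil (u * K%:R) <= Num.ceil (v * K%:R) by rewrite le_ceil// ler_wpM2r.
have : 0 <= Num.ceil (u * K%:R) by rewrite ceil_ge0 (lt_le_trans (ltrN10 _))// mulr_ge0.
by move: h; case: (Num.ceil _) => // n; case: (Num.ceil _).
Qed.

Lemma grid_index_itv K u : (0 < K)%N -> 0 <= u ->
  u <= (grid_index K u)%:R * K%:R^-1 <= u + K%:R^-1.
Proof.
move=> K0 u0; have K0' : 0 < K%:R :> R by rewrite ltr0n.
apply/andP; split; first by rewrite leNgt -lt_grid_index// ltnn.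
case E : (grid_index K u) => [|n]; first by rewrite mul0r addr_ge0// invr_ge0.
have : (n < grid_index K u)%N by rewrite E.
by rewrite lt_grid_index// -natr1 mulrDl mul1r lerD2r => /ltW.
Qed.

Lemma cvg_invS : (m.+1%:R^-1 : R) @[m --> \oo] --> 0.
Proof. exact: cvg_harmonic. Qed.

Lemma grid_index_cvg u : 0 <= u ->
  ((grid_index m.+1 u)%:R * m.+1%:R^-1 : R) @[m --> \oo] --> u.
Proof.
move=> u0; apply: (@squeeze_cvgr _ _ _ _ (fun=> u) (fun m => u + m.+1%:R^-1)).
- by apply: nearW => m; exact: grid_index_itv.
- exact: cvg_cst.
- by rewrite -[X in _ --> X]addr0; apply: cvgD; [exact: cvg_cst|exact: cvg_invS].
Qed.

Lemma big_nat_blocks (V : zmodType) (F : nat -> V) (c : nat -> nat) n :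
  {homo c : i j / (i <= j)%N} ->
  \sum_(c 0%N <= i < c n) F i = \sum_(0 <= j < n) \sum_(c j <= i < c j.+1) F i.
Proof.
move=> cm; elim: n => [|n IH]; first by rewrite !big_geq.
by rewrite big_nat_recr//= -IH -big_cat_nat// cm.
Qed.

End ceiling.

Section action_limit.
Context {R : realType} {d : nat} {dE dO : measure_display}
  {E : measurableType dE} {Omega : measurableType dO}.
Variables (Q : probability Omega R) (W : 'rV[int]_d -> R -> Omega -> R).
Variables (P : probability E R) (tau : nat -> E -> R) (xi : nat -> E -> 'rV[int]_d).
Hypothesis envW : wiener_environment Q W.
Hypothesis srw : simple_random_walk P tau xi.
Variables (x : 'rV[int]_d) (s t : R).
Hypothesis st : s < t.

Let PP := walk_jump_times srw.
Let u0 : 0 <= t - s. Proof. by rewrite subr_ge0 ltW. Qed.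

(* elapsed time when the walk enters its [j]-th site, capped at [t - s] *)
Let enter (w : E) (j : nat) : R :=
  if j is i.+1 then (if (i < jumps_before tau (t - s) w)%N then tau i w else t - s) else 0.

Let enter_ge0 w j : 0 <= enter w j.
Proof. by case: j => //= i; case: ifP => // _; rewrite ltW// (points_gt0 PP). Qed.

Let enter_mono w : {homo enter w : i j / (i <= j)%N >-> i <= j}.
Proof.
apply: homo_leq => //; first exact: le_trans.
case=> [|i] /=; first by case: ifP => // _; rewrite ltW// (points_gt0 PP).
have oo := count_oo (points_gt0 PP) (points_increasing PP) (points_unbounded PP).
rewrite -!oo; case: (ltP (tau i.+1 w)) => h.
  by rewrite (lt_trans _ h) ?(points_increasing PP)// ltW// (points_increasing PP).
by case: ltP => // /ltW.
Qed.

Let path_timeE w j :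
  path_time tau s t (jumps_before tau (t - s) w) w j = s + enter w j.
Proof. by case: j => [|j] /=; rewrite ?addr0//; case: ifP => // _; rewrite addrC subrK. Qed.

Let grid_jumps_block m w j i : (j <= jumps_before tau (t - s) w)%N ->
  (grid_index m.+1 (enter w j) <= i < grid_index m.+1 (enter w j.+1))%N ->
  grid_jumps tau m.+1%:R^-1 i w = j.
Proof.
move=> jn; rewrite leqNgt !lt_grid_index// -leNgt => /andP[h1 h2].
have oc := count_oc (points_gt0 PP) (points_increasing PP) (points_unbounded PP).
have before := count_oo (points_gt0 PP) (points_increasing PP) (points_unbounded PP).
apply/eqP; rewrite eqn_leq; apply/andP; split.
  rewrite leqNgt /grid_jumps -oc -ltNge; apply: (lt_le_trans h2) => /=.
  by case: ifP => // /negbT; rewrite -before -leNgt.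
case: j jn h1 {h2} => // j jn h1; rewrite /grid_jumps -oc.
by move: h1; rewrite /= jn.
Qed.

(** The increments over the cells charged to one site telescope, so the grid
    action has the shape of the action with jump times rounded up to the grid. *)
Lemma grid_action_blocks m w om :
  grid_action W tau xi x s m.+1%:R^-1 (grid_index m.+1 (t - s)) w om =
  \sum_(0 <= j < (jumps_before tau (t - s) w).+1)
    (W (site xi x j w) (s + (grid_index m.+1 (enter w j.+1))%:R * m.+1%:R^-1) om -
     W (site xi x j w) (s + (grid_index m.+1 (enter w j))%:R * m.+1%:R^-1) om).
Proof.
set n := jumps_before _ _ _; pose c j := grid_index m.+1 (enter w j).
have cm : {homo c : i j / (i <= j)%N}.
  by move=> i j ij; apply: grid_index_mono => //; exact: enter_mono.
have cn : c n.+1 = grid_index m.+1 (t - s) by rewrite /c/= ltnn.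
rewrite /grid_action -cn -[X in \sum_(X <= _ < _) _](_ : c 0%N = 0%N); last exact: grid_index0.
rewrite big_nat_blocks//; apply: eq_big_nat => j /andP[_ jn].
transitivity (\sum_(c j <= i < c j.+1) (W (site xi x j w) (s + i.+1%:R * m.+1%:R^-1) om -
    W (site xi x j w) (s + i%:R * m.+1%:R^-1) om)).
  apply: eq_big_nat => i ij; rewrite /incr /grid_site.
  by rewrite (grid_jumps_block _ ij)// -ltnS.
by rewrite (telescope_sumr (fun i => W (site xi x j w) (s + i%:R * m.+1%:R^-1) om))// cm.
Qed.

Lemma cvg_sum_nat (T : Type) (F : set_system T) (FF : Filter F) (f : nat -> T -> R) (l : nat -> R) n :
  (forall j, f j m @[m --> F] --> l j) ->
  \sum_(0 <= j < n) f j m @[m --> F] --> \sum_(0 <= j < n) l j.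
Proof.
move=> fl; elim: n => [|n IH].
  by rewrite big_geq//; under eq_fun do rewrite big_geq//; exact: cvg_cst.
rewrite big_nat_recr//=; under eq_fun do rewrite big_nat_recr//=.
exact: cvgD.
Qed.

(** Watching the walk on finer and finer grids recovers its action: only the
    grid cells containing a jump matter, and there the environment is
    continuous. *)
Lemma grid_action_cvg w om :
  grid_action W tau xi x s m.+1%:R^-1 (grid_index m.+1 (t - s)) w om @[m --> \oo] -->
  action tau xi W x s t w om.
Proof.
under eq_fun do rewrite grid_action_blocks.
rewrite /action -/(jumps_before tau (t - s) w); apply: cvg_sum_nat => j.
have Wc (z : 'rV[int]_d) (u : R) : 0 <= u -> W z (s + (grid_index m.+1 u)%:R * m.+1%:R^-1) om @[m --> \oo] --> W z (s + u) om.
  move=> u_ge0; apply: (cvg_comp (fun m => s + (grid_index m.+1 u)%:R * m.+1%:R^-1) (W z ^~ om)).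
    by apply: cvgD; [exact: cvg_cst|exact: grid_index_cvg].
  exact: (wiener_continuous (environment_wiener envW z)).
by rewrite !path_timeE; apply: cvgB; apply: Wc.
Qed.

End action_limit.

(** * Convergence in [L^2] from bounded fourth moments *)

Section fourth_moments.
Context {R : realType} {dT : measure_display} {T : measurableType dT}.
Variable mu : {measure set T -> \bar R}.

Lemma limn_einf_ub (u : (\bar R)^nat) (M : \bar R) :
  (forall n, u n <= M)%E -> (limn_einf u <= M)%E.
Proof.
move=> uM; rewrite limn_einf_lim; apply: lime_le; first exact: is_cvg_einfs.
apply: nearW => n; apply: le_trans (uM n); apply: ereal_inf_lbound.
by exists n => /=.
Qed.

(** Fatou's lemma for convergence almost everywhere. *)
Lemma fatou_bound (f_ : nat -> T -> R) (f : T -> R) (M : \bar R) :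
  (forall n, measurable_fun setT (f_ n)) -> measurable_fun setT f ->
  (forall n w, 0 <= f_ n w) ->
  {ae mu, forall w, f_ n w @[n --> \oo] --> f w} ->
  (forall n, \int[mu]_w (f_ n w)%:E <= M)%E ->
  (\int[mu]_w (f w)%:E <= M)%E.
Proof.
move=> mf_ mf f0 ff fM.
rewrite (@ae_eq_integral _ _ _ mu setT (fun w => limn_einf (fun n => (f_ n w)%:E)))//.
- apply: (le_trans (fatou mu measurableT _ _)).
  + by move=> n; exact/measurable_EFinP.
  + by move=> n w _; rewrite lee_fin.
  + exact: limn_einf_ub.
- exact/measurable_EFinP.
- have mesup : measurable_fun setT (fun w => limn_esup (fun n => (- (f_ n w)%:E)%E)).
    apply: measurable_fun_limn_esup => n.
    by apply: measurableT_comp => //; exact/measurable_EFinP.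
  exact: (measurableT_comp (@oppe_measurable _ setT) mesup).
- apply: filterS ff => w fw _.
  have : (f_ n w)%:E @[n --> \oo] --> (f w)%:E by apply: cvg_EFin; [exact: nearW|exact: fw].
  by move=> /cvg_limn_einf_sup[-> _].
Qed.

(** Truncate the squared distance [g] at a level [K]: the truncations converge
    by domination, and [g <= min g K + g^2 / K] with the fourth moments bounding
    the integral of [g^2]. *)
Lemma L2_cvg (f_ : nat -> T -> R) (f : T -> R) (M : R) : mu setT = 1%E ->
  (forall n, measurable_fun setT (f_ n)) -> measurable_fun setT f ->
  (forall w, f_ n w @[n --> \oo] --> f w) ->
  (forall n, \int[mu]_w (f_ n w ^+ 4)%:E <= M%:E)%E ->
  forall e : R, 0 < e ->
    \forall n \near \oo, (\int[mu]_w ((f_ n w - f w) ^+ 2)%:E <= e%:E)%E.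
Proof.
move=> mu1 mf_ mf ff fM e e0.
have M4 : (\int[mu]_w (f w ^+ 4)%:E <= M%:E)%E.
  apply: (@fatou_bound (fun n w => f_ n w ^+ 4)) => //.
  - by move=> n; exact: measurable_funX.
  - exact: measurable_funX.
  - by move=> n w; rewrite exprn_even_ge0.
  - by apply: aeW => w; exact: (cvg_comp _ _ (ff w) (@exprn_continuous _ 4 (f w))).
pose g n w := (f_ n w - f w) ^+ 2.
have mg n : measurable_fun setT (g n) by apply: measurable_funX; exact: measurable_funB.
have g0 n w : 0 <= g n w by exact: sqr_ge0.
have M0 : 0 <= M.
  rewrite -lee_fin; apply: le_trans M4; apply: integral_ge0 => w _.
  by rewrite lee_fin exprn_even_ge0.
have gM n : (\int[mu]_w (g n w ^+ 2)%:E <= (16 * M)%:E)%E.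
  apply: (@le_trans _ _ (\int[mu]_w (8%:E * ((f_ n w ^+ 4)%:E + (f w ^+ 4)%:E)))%E).
    apply: ge0_le_integral => //.
    - by move=> w _; rewrite lee_fin sqr_ge0.
    - by apply/measurable_EFinP; exact: measurable_funX.
    - apply: measurable_funeM; apply: emeasurable_funD; apply/measurable_EFinP; exact: measurable_funX.
    - move=> w _; rewrite -EFinD -EFinM lee_fin /g.
      have h (a b : R) : (a - b) ^+ 2 ^+ 2 <= 8 * (a ^+ 4 + b ^+ 4).
        have h1 : (a - b) ^+ 2 <= 2 * (a ^+ 2 + b ^+ 2) by have := sqr_ge0 (a + b); nra.
        have h2 := ler_pM (sqr_ge0 (a - b)) (sqr_ge0 (a - b)) h1 h1.
        rewrite -expr2 in h2; apply: (le_trans h2).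
        rewrite !(exprM _ 2 2); have := sqr_ge0 (a ^+ 2 - b ^+ 2).
        by move: (a ^+ 2) (b ^+ 2) => A B; nra.
      exact: h.
  have f4 k : (0 <= (f_ n k ^+ 4)%:E)%E by rewrite lee_fin exprn_even_ge0.
  have f4' k : (0 <= (f k ^+ 4)%:E)%E by rewrite lee_fin exprn_even_ge0.
  rewrite ge0_integralZl//; last 2 first.
  - by apply: emeasurable_funD; apply/measurable_EFinP; exact: measurable_funX.
  - by move=> w _; rewrite adde_ge0.
  rewrite ge0_integralD//; last 2 first.
  - by apply/measurable_EFinP; exact: measurable_funX.
  - by apply/measurable_EFinP; exact: measurable_funX.
  apply: (@le_trans _ _ (8%:E * (M%:E + M%:E))%E); last by rewrite -EFinD -EFinM lee_fin; lra.
  by rewrite lee_pmul2l// leeD.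
pose K := 32 * M / e + 1.
have K0 : 0 < K by rewrite ltr_wpDl// divr_ge0 ?mulr_ge0// ltW.
have mmin n : measurable_fun setT (fun w => (Num.min (g n w) K)%:E).
  by apply/measurable_EFinP; apply: measurable_minr.
have min0 n w : 0 <= Num.min (g n w) K by rewrite le_min g0 ltW.
have split n : (\int[mu]_w (g n w)%:E <= \int[mu]_w (Num.min (g n w) K)%:E + (e / 2)%:E)%E.
  apply: (@le_trans _ _ (\int[mu]_w ((Num.min (g n w) K)%:E + K^-1%:E * (g n w ^+ 2)%:E))%E).
    apply: ge0_le_integral => //.
    - by move=> w _; rewrite lee_fin.
    - exact/measurable_EFinP.
    - apply: emeasurable_funD => //; apply: measurable_funeM.
      by apply/measurable_EFinP; exact: measurable_funX.
    - move=> w _; rewrite -EFinM -EFinD lee_fin.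
      case: (leP (g n w) K) => gK; first by rewrite lerDl mulr_ge0 ?sqr_ge0// invr_ge0 ltW.
      rewrite -[leLHS]add0r lerD ?(ltW K0)// mulrC ler_pdivlMr// expr2; exact: (ler_wpM2l (g0 n w) (ltW gK)).
  rewrite ge0_integralD//; last 3 first.
  - by move=> w _; rewrite lee_fin.
  - by move=> w _; rewrite mule_ge0// lee_fin ?sqr_ge0// invr_ge0 ltW.
  - by apply: measurable_funeM; apply/measurable_EFinP; exact: measurable_funX.
  rewrite leeD2l// ge0_integralZl//; last 3 first.
  - by apply/measurable_EFinP; exact: measurable_funX.
  - by move=> w _; rewrite lee_fin sqr_ge0.
  - by rewrite lee_fin invr_ge0 ltW.
  apply: (@le_trans _ _ (K^-1%:E * (16 * M)%:E)%E).
    by apply: lee_wpmul2l => //; rewrite lee_fin invr_ge0 ltW.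
  rewrite -EFinM lee_fin mulrC ler_pdivrMr// /K mulrDr mulrCA mulrA.
  rewrite -[X in _ <= X + _](_ : 16 * M = _); last by field; rewrite gt_eqF.
  by rewrite lerDl mulr1 divr_ge0// ltW.
have icst : mu.-integrable setT (cst K%:E).
  apply/integrableP; split => //; rewrite integral_cst//.
  by rewrite mu1 mule1 ltry.
have cvg_min w : (Num.min (g n w) K)%:E @[n --> \oo] --> cst 0%E w.
  apply: cvg_EFin; first exact: nearW.
  apply: (@squeeze_cvgr _ _ _ _ (fun=> 0) (fun n => g n w)).
  - by apply: nearW => n; rewrite min0 ge_min lexx.
  - exact: cvg_cst.
  - have dist0 : f_ n w - f w @[n --> \oo] --> (0 : R).
      by rewrite -(subrr (f w)); apply: cvgB; [exact: ff|exact: cvg_cst].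
    rewrite -[X in _ --> X](expr0n R 2).
    exact: (cvg_comp _ _ dist0 (@exprn_continuous _ 2 0)).
have min_le w n : (`|(Num.min (g n w) K)%:E| <= cst K%:E w)%E.
  by rewrite gee0_abs ?lee_fin// ge_min lexx orbT.
have [_ _] := dominated_convergence measurableT mmin (measurable_cst 0%E)
  (aeW mu (fun w _ => cvg_min w)) icst (aeW mu (fun w n _ => min_le w n)).
rewrite integral_cst// mul0e => /fine_cvgP[fin /cvgrPdist_le/(_ (e / 2))].
rewrite divr_gt0// => /(_ isT) near_min.
apply: filterS2 fin near_min => n fin_n le_n.
apply: (le_trans (split n)); move: fin_n le_n => /=.
case: (\int[mu]_w _)%E => // r _; rewrite sub0r normrN -EFinD lee_fin.
by move=> /= /(le_trans (ler_norm _)); lra.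
Qed.

End fourth_moments.

(** * Mean-square distance *)

Section mean_square.
Context {R : realType} {dT : measure_display} {T : measurableType dT}.
Variable mu : {measure set T -> \bar R}.

Definition sqdist (f g : T -> R) : \bar R := (\int[mu]_w ((f w - g w) ^+ 2)%:E)%E.

Lemma integral_scale (c : R) (f : T -> R) : 0 <= c -> measurable_fun setT f ->
  (forall w, 0 <= f w) ->
  (\int[mu]_w (c * f w)%:E = c%:E * \int[mu]_w (f w)%:E)%E.
Proof.
move=> c0 mf f0; rewrite -ge0_integralZl_EFin//; last exact/measurable_EFinP.
by move=> w _; rewrite lee_fin.
Qed.

Lemma sqdist_ge0 f g : (0 <= sqdist f g)%E.
Proof. by apply: integral_ge0 => w _; rewrite lee_fin sqr_ge0. Qed.

Lemma sqdistC f g : sqdist f g = sqdist g f.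
Proof. by apply: eq_integral => w _; rewrite -sqrrN opprB. Qed.

Lemma sqdist_triangle f g k : measurable_fun setT f -> measurable_fun setT g ->
  measurable_fun setT k -> (sqdist f k <= 2%:E * (sqdist f g + sqdist g k))%E.
Proof.
move=> mf mg mk.
have mD (u v : T -> R) : measurable_fun setT u -> measurable_fun setT v ->
    measurable_fun setT (fun w => ((u w - v w) ^+ 2)%:E).
  by move=> mu' mv; apply/measurable_EFinP; apply: measurable_funX; exact: measurable_funB.
have D0 (u v : T -> R) w : (0 <= ((u w - v w) ^+ 2)%:E)%E by rewrite lee_fin sqr_ge0.
rewrite /sqdist -ge0_integralD//; do ?[exact: mD].
rewrite -ge0_integralZl//; last 2 first.
- by apply: emeasurable_funD; exact: mD.
- by move=> w _; rewrite adde_ge0.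
apply: ge0_le_integral => //; first exact: mD.
- by apply: measurable_funeM; apply: emeasurable_funD; exact: mD.
- move=> w _; rewrite -EFinD -EFinM lee_fin.
  by have := sqr_ge0 (f w - g w - (g w - k w)); nra.
Qed.

(** A sequence whose consecutive distances decay geometrically converges almost
    everywhere: [2 |D| <= 2^-k + 2^k D^2], and the series of the right-hand
    sides has a finite integral. *)
Lemma sqdist_cauchy_limit (z : nat -> T -> R) :
  (forall k, measurable_fun setT (z k)) ->
  (forall k, sqdist (z k) (z k.+1) <= (4^-1 ^+ k)%:E)%E ->
  exists2 f : T -> R, measurable_fun setT f &
    {ae mu, forall w, z k w @[k --> \oo] --> f w}.
Proof.
move=> mz zz.
pose D k w := 2 ^+ k * (z k w - z k.+1 w) ^+ 2.
have D0 k w : 0 <= D k w by rewrite mulr_ge0 ?sqr_ge0 ?exprn_ge0.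
have mD k : measurable_fun setT (D k).
  by apply: measurable_funM => //; apply: measurable_funX; exact: measurable_funB.
pose S w := (\sum_(0 <= k <oo) (D k w)%:E)%E.
have mS : measurable_fun setT S.
  by apply: ge0_emeasurable_sum => // [k w _ _|k _]; [rewrite lee_fin|exact/measurable_EFinP].
have S0 w : (0 <= S w)%E by apply: nneseries_ge0 => k _ _; rewrite lee_fin.
have half n : \sum_(0 <= k < n) (2^-1 ^+ k : R) <= 2.
  have -> : \sum_(0 <= k < n) (2^-1 ^+ k : R) = 2 - 2 * 2^-1 ^+ n.
    elim: n => [|n IH]; first by rewrite big_geq// expr0; ring.
    by rewrite big_nat_recr//= IH exprS; field.
  by rewrite lerBlDr lerDl mulr_ge0// exprn_ge0// invr_ge0.
have Sfin : (\int[mu]_w S w <= 2%:E)%E.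
  rewrite integral_nneseries//; last 2 first.
  - by move=> k; exact/measurable_EFinP.
  - by move=> k w _; rewrite lee_fin.
  apply: lime_le; first by apply: is_cvg_nneseries => k _ _; apply: integral_ge0 => w _; rewrite lee_fin.
  apply: nearW => n; apply: (@le_trans _ _ (\sum_(0 <= k < n) (2^-1 ^+ k)%:E)%E); last first.
    by rewrite sumEFin lee_fin.
  apply: lee_sum => k _; rewrite /D integral_scale ?exprn_ge0//; last 2 first.
  - by apply: measurable_funX; exact: measurable_funB.
  - by move=> w; exact: sqr_ge0.
  apply: (@le_trans _ _ ((2 ^+ k)%:E * (4^-1 ^+ k)%:E)%E).
    by apply: lee_wpmul2l; [rewrite lee_fin exprn_ge0|exact: zz].
  by rewrite -EFinM lee_fin -exprMn (_ : 2 * 4^-1 = 2^-1 :> R)//; field.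
have S_ae : {ae mu, forall w, S w \is a fin_num}.
  have : mu.-integrable setT S.
    apply/integrableP; split => //.
    rewrite (eq_integral S); last by move=> w _; rewrite gee0_abs.
    exact: le_lt_trans Sfin (ltry _).
  by move=> /(integrable_ae measurableT); apply: filterS => w; apply.
have z_cvg w : S w \is a fin_num -> cvgn (fun k => z k w).
  move=> Sw.
  have cD : cvgn (series (fun k => D k w)).
    by apply: nnseries_is_cvg => //; rewrite -ge0_fin_numE//; exact: S0.
  have cz : cvgn (series (telescope (fun k => z k w))).
    apply: normed_cvg.
    apply: (@series_le_cvg _ _ (fun k => 2^-1 ^+ k + D k w)) => [k|k|k|].
    - exact: normr_ge0.
    - by rewrite addr_ge0// exprn_ge0// invr_ge0.
    - rewrite /telescope /D; set a := z k w; set b := z k.+1 w.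
      have p0 : 0 < 2 ^+ k :> R by rewrite exprn_gt0.
      rewrite exprVn -(ler_pM2l p0) mulrDr mulfV ?gt_eqF// mulrA -expr2 -exprMn.
      rewrite -[X in X * _](gtr0_norm p0) -normrM.
      have -> : 2 ^+ k * (a - b) = - (2 ^+ k * (b - a)) by ring.
      rewrite sqrrN; move: (_ * _) => y.
      rewrite -(real_normK (num_real y)); have := sqr_ge0 (`|y| - 1).
      by have := normr_ge0 y; nra.
    - rewrite [X in cvgn X](_ : _ = series (fun k => 2^-1 ^+ k) \+ series (fun k => D k w)).
        apply: is_cvgD => //.
        rewrite (_ : (fun k => 2^-1 ^+ k) = geometric 1 2^-1).
          by apply: is_cvg_geometric_series; rewrite ger0_norm ?invr_ge0// invf_lt1// ltr1n.
        by apply/funext => k; rewrite /geometric/= mul1r.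
      by apply/funext => n; rewrite /series/= big_split.
  rewrite (_ : (fun k => z k w) = (fun k => z 0%N w + series (telescope (fun k => z k w)) k)).
    by apply: is_cvgD => //; exact: is_cvg_cst.
  by apply/funext => k; exact: eq_sum_telescope.
pose f w := fine (limn_esup (fun k => (z k w)%:E)).
exists f.
  apply: measurableT_comp => //; apply: measurable_fun_limn_esup => k.
  exact/measurable_EFinP.
apply: filterS S_ae => w /z_cvg /cvg_ex[l zl].
have : (z k w)%:E @[k --> \oo] --> l%:E by apply: cvg_EFin; [exact: nearW|exact: zl].
by move=> /cvg_limn_einf_sup[_ e]; rewrite /f e.
Qed.

End mean_square.

(** [a := E X - E Y] satisfies [2 a X <= (X - Y)^2 + 2 a Y + a^2] pointwise;
    integrate. *)
Lemma sqr_mean_le (R : realType) (dT : measure_display) (T : measurableType dT)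
    (P : probability T R) (X Y : T -> R) :
  measurable_fun setT X -> measurable_fun setT Y ->
  (forall w, 0 <= X w) -> (forall w, 0 <= Y w) ->
  (\int[P]_w (X w)%:E)%E \is a fin_num -> (\int[P]_w (Y w)%:E)%E \is a fin_num ->
  (((fine (\int[P]_w (X w)%:E) - fine (\int[P]_w (Y w)%:E))^+2)%:E <= sqdist P X Y)%E.
Proof.
wlog XY : X Y / fine (\int[P]_w (Y w)%:E)%E <= fine (\int[P]_w (X w)%:E)%E.
  move=> H mX mY X0 Y0 fX fY.
  case: (leP (fine (\int[P]_w (Y w)%:E)%E) (fine (\int[P]_w (X w)%:E)%E)) => h; first exact: H.
  by rewrite -sqrrN opprB sqdistC; apply: H => //; exact: ltW.
move=> mX mY X0 Y0 fX fY.
set a := fine (\int[P]_w (X w)%:E)%E - fine (\int[P]_w (Y w)%:E)%E.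
have a0 : 0 <= a by rewrite subr_ge0.
have mS : measurable_fun setT (fun w => ((X w - Y w) ^+ 2)%:E).
  by apply/measurable_EFinP; apply: measurable_funX; exact: measurable_funB.
have aY0 w : (0 <= ((2 * a) * Y w)%:E)%E by rewrite lee_fin !mulr_ge0.
have maY : measurable_fun setT (fun w => ((2 * a) * Y w)%:E).
  by apply/measurable_EFinP; exact: measurable_funM.
have S0 w : (0 <= ((X w - Y w) ^+ 2)%:E)%E by rewrite lee_fin sqr_ge0.
have : (\int[P]_w ((2 * a) * X w)%:E <=
        \int[P]_w (((X w - Y w) ^+ 2)%:E + (((2 * a) * Y w)%:E + (a ^+ 2)%:E)))%E.
  apply: ge0_le_integral => //.
  - by move=> w _; rewrite lee_fin !mulr_ge0.
  - by apply/measurable_EFinP; exact: measurable_funM.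
  - by apply: emeasurable_funD => //; exact: emeasurable_funD.
  - move=> w _; rewrite -!EFinD lee_fin.
    by have := sqr_ge0 (X w - Y w - a); nra.
rewrite ge0_integralD//; last 2 first.
- by move=> w _; rewrite adde_ge0// lee_fin sqr_ge0.
- exact: emeasurable_funD.
rewrite ge0_integralD//; last by move=> w _; rewrite lee_fin sqr_ge0.
rewrite integral_prob_cst.
rewrite !integral_scale ?mulr_ge0//.
rewrite -/(sqdist P X Y); move: (sqdist_ge0 P X Y); move: fX fY a0; rewrite /a.
case: (\int[P]_w (X w)%:E)%E => // p; case: (\int[P]_w (Y w)%:E)%E => // q _ _ /=.
case: (sqdist P X Y) => [r||]//=; last by move=> *; rewrite leey.
by rewrite -!EFinM -!EFinD !lee_fin; nra.
Qed.

(** * The continuous-time partition function *)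

Lemma integral_product (R : realType) (d1 d2 : measure_display)
    (T1 : measurableType d1) (T2 : measurableType d2) (P : probability T1 R)
    (Q : probability T2 R) (f : T1 -> T2 -> R) : (forall w om, 0 <= f w om) ->
  measurable_fun setT (fun p : T1 * T2 => f p.1 p.2) ->
  (\int[P \x Q]_p (f p.1 p.2)%:E = \int[P]_w \int[Q]_om (f w om)%:E)%E.
Proof.
move=> f0 mf; rewrite fubini_tonelli1//; first exact/measurable_EFinP.
by move=> p; rewrite lee_fin.
Qed.

(** The bound obtained from [grid_Z_dist] once the mesh has been sent to [0]. *)
Definition rate {R : realType} (u : R) : R := 20 / Num.sqrt (Num.sqrt (1 + u)).

Section continuous_partition.
Context {R : realType} {d : nat} {dE dO : measure_display}
  {E : measurableType dE} {Omega : measurableType dO}.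
Variables (Q : probability Omega R) (W : 'rV[int]_d -> R -> Omega -> R).
Variables (P : probability E R) (tau : nat -> E -> R) (xi : nat -> E -> 'rV[int]_d).
Hypothesis envW : wiener_environment Q W.
Hypothesis srw : simple_random_walk P tau xi.
Hypothesis d3 : (3 <= d)%N.
Variables (x : 'rV[int]_d) (s beta : R).
Hypothesis beta_small : 16 * (4 + 24 * d%:R ^+ 2) * beta ^+ 2 <= 1.

Definition path_weight (t : R) (w : E) (om : Omega) : R :=
  expR (beta * action tau xi W x s t w om - beta ^+ 2 / 2 * (t - s)).

Definition mesh_weight (t : R) (m : nat) : E -> Omega -> R :=
  grid_weight W tau xi x s m.+1%:R^-1 beta (grid_index m.+1 (t - s)).

Definition mesh_Z (t : R) (m : nat) : Omega -> R :=
  grid_Z W P tau xi x s m.+1%:R^-1 beta (grid_index m.+1 (t - s)).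

Let mesh01 m : 0 < (m.+1%:R^-1 : R) <= 1.
Proof. by rewrite invr_gt0 ltr0n/= invf_le1 ?ltr0n// ler1n. Qed.

Lemma path_weight_ge0 t w om : 0 <= path_weight t w om.
Proof. exact: expR_ge0. Qed.

Lemma mesh_weight_ge0 t m w om : 0 <= mesh_weight t m w om.
Proof. exact: grid_weight_ge0. Qed.

Lemma measurable_mesh_weight t m :
  measurable_fun setT (fun p : E * Omega => mesh_weight t m p.1 p.2).
Proof. exact: (measurable_grid_weight envW srw x s (mesh01 m)). Qed.

Lemma mesh_weight_cvg t w om : s < t ->
  mesh_weight t m w om @[m --> \oo] --> path_weight t w om.
Proof.
move=> st.
have cA : beta * grid_action W tau xi x s m.+1%:R^-1 (grid_index m.+1 (t - s)) w om -
    beta ^+ 2 / 2 * ((grid_index m.+1 (t - s))%:R * m.+1%:R^-1) @[m --> \oo] -->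
    beta * action tau xi W x s t w om - beta ^+ 2 / 2 * (t - s).
  apply: cvgB.
    by apply: cvgM; [exact: cvg_cst|exact: (grid_action_cvg envW srw)].
  by apply: cvgM; [exact: cvg_cst|apply: grid_index_cvg; rewrite subr_ge0 ltW].
exact: (cvg_comp _ _ cA (@continuous_expR _ _)).
Qed.

Lemma measurable_path_weight t : s < t ->
  measurable_fun setT (fun p : E * Omega => path_weight t p.1 p.2).
Proof.
move=> st; apply: (measurable_fun_cvg (h := fun m p => mesh_weight t m p.1 p.2)) => [m|p _].
  exact: measurable_mesh_weight.
exact: mesh_weight_cvg.
Qed.

Let M4 t := expR (6 * beta ^+ 2 * (t - s + 1)).

Lemma mesh_weight_moment4 t m : s < t ->
  (\int[P \x Q]_p (mesh_weight t m p.1 p.2 ^+ 4)%:E <= (M4 t)%:E)%E.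
Proof.
move=> st; rewrite (integral_product P Q (f := fun w om => mesh_weight t m w om ^+ 4)); last 2 first.
- by move=> w om; rewrite exprn_even_ge0.
- by apply: measurable_funX; exact: measurable_mesh_weight.
under eq_integral do rewrite (grid_weight_moment4 tau xi envW x s (mesh01 m)).
have c0 : 0 <= 6 * beta ^+ 2 by exact: mulr_ge0 (ler0n _ _) (sqr_ge0 _).
rewrite integral_prob_cst lee_fin ler_expR (ler_wpM2l c0)//.
have u0 : 0 <= t - s by rewrite subr_ge0 ltW.
have /andP[_ h] := grid_index_itv (ltn0Sn m) u0.
by apply: (le_trans h); rewrite lerD2l; case/andP: (mesh01 m).
Qed.

Lemma product_setT : ((P \x Q) [set: E * Omega] = 1)%E.
Proof. exact: probability_setT. Qed.

Lemma mesh_weight_L2 t e : s < t -> 0 < e ->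
  \forall m \near \oo, (sqdist (P \x Q) (fun p => mesh_weight t m p.1 p.2)
     (fun p => path_weight t p.1 p.2) <= e%:E)%E.
Proof.
move=> st e0; apply: (@L2_cvg _ _ _ _ _ _ (M4 t)) => //.
- exact: product_setT.
- by move=> m; exact: measurable_mesh_weight.
- exact: measurable_path_weight.
- by move=> p; exact: mesh_weight_cvg.
- by move=> m; exact: mesh_weight_moment4.
Qed.

Lemma path_weight_moment4 t : s < t ->
  (\int[P]_w \int[Q]_om (path_weight t w om ^+ 4)%:E <= (M4 t)%:E)%E.
Proof.
move=> st; rewrite -(integral_product P Q (f := fun w om => path_weight t w om ^+ 4)); last 2 first.
- by move=> w om; rewrite exprn_even_ge0.
- by apply: measurable_funX; exact: measurable_path_weight.
apply: (@fatou_bound _ _ _ _ (fun m p => mesh_weight t m p.1 p.2 ^+ 4)).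
- by move=> m; apply: measurable_funX; exact: measurable_mesh_weight.
- by apply: measurable_funX; exact: measurable_path_weight.
- by move=> m p; rewrite exprn_even_ge0.
- apply: aeW => p.
  have c1 := @mesh_weight_cvg t p.1 p.2 st.
  exact: (cvg_comp _ _ c1 (@exprn_continuous _ 4 _)).
- by move=> m; exact: mesh_weight_moment4.
Qed.

Lemma path_weight_moment k t : s < t -> (k <= 4)%N ->
  (\int[P]_w \int[Q]_om (path_weight t w om ^+ k)%:E <= (1 + M4 t)%:E)%E.
Proof.
move=> st k4.
have mk j : measurable_fun setT (fun p : E * Omega => path_weight t p.1 p.2 ^+ j).
  by apply: measurable_funX; exact: measurable_path_weight.
rewrite -(integral_product P Q (f := fun w om => path_weight t w om ^+ k))//; last first.
  by move=> w om; rewrite exprn_ge0// path_weight_ge0.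
apply: (@le_trans _ _ (\int[P \x Q]_p (1%:E + (path_weight t p.1 p.2 ^+ 4)%:E))%E).
  apply: ge0_le_integral => //.
  - by move=> p _; rewrite lee_fin exprn_ge0// path_weight_ge0.
  - exact/measurable_EFinP.
  - by apply: emeasurable_funD => //; exact/measurable_EFinP.
  - move=> p _; rewrite -EFinD lee_fin; have := path_weight_ge0 t p.1 p.2.
    case: (leP (path_weight t p.1 p.2) 1) => [h1 h0|h1 _].
      by rewrite ler_wpDr ?exprn_ge0// exprn_ile1.
    by rewrite ler_wpDl// ler_weXn2l// ltW.
rewrite ge0_integralD//; last 2 first.
- by move=> p _; rewrite lee_fin exprn_even_ge0.
- exact/measurable_EFinP.
have -> : (\int[P \x Q]__ 1 = 1)%E by rewrite integral_cst// mul1e; exact: product_setT.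
rewrite EFinD leeD2l//.
rewrite (integral_product P Q (f := fun w om => path_weight t w om ^+ 4))//.
  exact: path_weight_moment4.
by move=> w om; rewrite exprn_even_ge0.
Qed.

Definition partition_function (t : R) (om : Omega) : R :=
  fine (\int[P]_w (path_weight t w om)%:E)%E.

Lemma measurable_partition_function t : s < t -> measurable_fun setT (partition_function t).
Proof.
move=> st; apply: measurableT_comp => //; apply: measurable_integral2.
  exact: path_weight_ge0.
exact: measurable_path_weight.
Qed.

Lemma partition_function_ae t : s < t ->
  {ae Q, forall om, (\int[P]_w (path_weight t w om)%:E = (partition_function t om)%:E)%E}.
Proof.
move=> st; have := @ae_fin_section R _ _ E Omega P Q (path_weight t) (path_weight_ge0 t) (measurable_path_weight st).
move=> /(_ (le_lt_trans (@path_weight_moment 1 t st isT) (ltry _))).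
by apply: filterS => om /fineK.
Qed.

Lemma measurable_mesh_Z t m : measurable_fun setT (mesh_Z t m).
Proof. exact: (measurable_grid_Z envW srw x s (mesh01 m)). Qed.

(** Averaging over the walk does not increase mean-square distances. *)
Lemma partition_function_mesh t m : s < t ->
  (sqdist Q (mesh_Z t m) (partition_function t) <=
   sqdist (P \x Q) (fun p => mesh_weight t m p.1 p.2) (fun p => path_weight t p.1 p.2))%E.
Proof.
move=> st.
have mp := measurable_path_weight st; have mm := measurable_mesh_weight t m.
have mD : measurable_fun setT (fun p : E * Omega => (mesh_weight t m p.1 p.2 - path_weight t p.1 p.2) ^+ 2).
  by apply: measurable_funX; exact: measurable_funB.
rewrite {2}/sqdist (integral_product P Q (f := fun w om => (mesh_weight t m w om - path_weight t w om) ^+ 2))//; last first.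
  by move=> w om; exact: sqr_ge0.
rewrite -fubini_real//; last by move=> w om; exact: sqr_ge0.
apply: ae_ge0_le_integral => //.
- by move=> om _; rewrite lee_fin sqr_ge0.
- apply/measurable_EFinP; apply: measurable_funX; apply: measurable_funB.
    exact: measurable_mesh_Z.
  exact: measurable_partition_function.
- by move=> om _; apply: integral_ge0 => w _; rewrite lee_fin sqr_ge0.
- by apply: measurable_integral2 => // w om; exact: sqr_ge0.
apply: filterS2 (grid_Z_ae envW srw x s (mesh01 m) beta (grid_index m.+1 (t - s))) (partition_function_ae st).
move=> om hm hp _.
apply: (sqr_mean_le (P := P) (X := fun w => mesh_weight t m w om) (Y := fun w => path_weight t w om)).
- exact: measurable_section1.
- exact: measurable_section1.
- by move=> w; exact: mesh_weight_ge0.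
- by move=> w; exact: path_weight_ge0.
- by rewrite /mesh_weight hm.
- by rewrite hp.
Qed.

Lemma mesh_Z_dist t T m : s < t -> t <= T ->
  (sqdist Q (mesh_Z T m) (mesh_Z t m) <= (rate (t - s) / 4)%:E)%E.
Proof.
move=> st tT; have u0 : 0 <= t - s by rewrite subr_ge0 ltW.
apply: le_trans (grid_Z_dist envW srw d3 x s (mesh01 m) beta_small _) _.
  by apply: grid_index_mono => //; rewrite lerD2r.
rewrite lee_fin /rate.
have -> : 20 / Num.sqrt (Num.sqrt (1 + (t - s))) / 4 = 5 / Num.sqrt (Num.sqrt (1 + (t - s))).
  by field; rewrite gt_eqF// !sqrtr_gt0 ltr_wpDr.
have s0 : 0 < Num.sqrt (Num.sqrt (1 + (t - s))) by rewrite !sqrtr_gt0 ltr_wpDr.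
rewrite ler_pM2l// lef_pV2 ?posrE//; last first.
  by apply: weight_gt0; case/andP: (mesh01 m).
rewrite /weight !ler_sqrt ?sqrtr_ge0 ?lerD2l//.
by case/andP: (grid_index_itv (ltn0Sn m) u0).
Qed.

(** Compare both times with a common mesh, fine enough for a given error. *)
Lemma partition_function_dist t T : s < t -> t <= T ->
  (sqdist Q (partition_function T) (partition_function t) <= (rate (t - s))%:E)%E.
Proof.
move=> st tT; have sT := lt_le_trans st tT.
apply/lee_addgt0Pr => e e0.
have e8 : 0 < e / 8 by rewrite divr_gt0.
have [m [hT ht]] : exists m, (sqdist Q (mesh_Z T m) (partition_function T) <= (e / 8)%:E)%E /\
    (sqdist Q (mesh_Z t m) (partition_function t) <= (e / 8)%:E)%E.
  have [N _ hN] := filterI (mesh_weight_L2 sT e8) (mesh_weight_L2 st e8).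
  have [h1 h2] := hN N (leqnn N); exists N; split.
    exact: le_trans (partition_function_mesh _ sT) h1.
  exact: le_trans (partition_function_mesh _ st) h2.
have mpT := measurable_partition_function sT; have mpt := measurable_partition_function st.
have mT := measurable_mesh_Z T m; have mt := measurable_mesh_Z t m.
have le2 (a b : \bar R) : (a <= b -> 2%:E * a <= 2%:E * b)%E by move=> ab; exact: lee_wpmul2l.
rewrite sqdistC in hT.
apply: (le_trans (sqdist_triangle Q mpT mT mpt)).
apply: (le_trans (le2 _ _ (leeD hT (sqdist_triangle Q mT mt mpt)))).
apply: (le_trans (le2 _ _ (leeD2l _ (le2 _ _ (leeD (mesh_Z_dist m st tT) ht))))).
have r0 : 0 <= rate (t - s) by rewrite divr_ge0// sqrtr_ge0.
change ((2 * (e / 8 + 2 * (rate (t - s) / 4 + e / 8)))%:E <= (rate (t - s) + e)%:E)%E.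
by rewrite lee_fin; lra.
Qed.

Lemma partition_function_square t : s < t ->
  (\int[Q]_om (partition_function t om ^+ 2)%:E < +oo)%E.
Proof.
move=> st; apply: le_lt_trans (ltry (1 + M4 t)).
have mp := measurable_path_weight st.
apply: le_trans (@path_weight_moment 2 t st isT).
rewrite -fubini_real//; last 2 first.
- by move=> w om; exact: sqr_ge0.
- exact: measurable_funX.
apply: ae_ge0_le_integral => //.
- by move=> om _; rewrite lee_fin sqr_ge0.
- by apply/measurable_EFinP; apply: measurable_funX; exact: measurable_partition_function.
- by move=> om _; apply: integral_ge0 => w _; rewrite lee_fin sqr_ge0.
- apply: measurable_integral2 => [w om|]; [exact: sqr_ge0|exact: measurable_funX].
apply: filterS (partition_function_ae st) => om hp _.
have := @sqr_mean_le R _ E P (fun w => path_weight t w om) (fun=> 0).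
rewrite integral_prob_cst/= subr0 => h.
apply: (le_trans (h _ _ _ _ _ _)) => //.
- exact: measurable_section1.
- by move=> w; exact: path_weight_ge0.
- by rewrite hp.
- by rewrite /sqdist; under eq_integral do rewrite subr0.
Qed.

(** Mean-square limit: along rapidly growing times it exists almost surely, and
    Fatou's lemma transfers the distance bound to it. *)
Lemma partition_function_limit : exists2 f : Omega -> R, measurable_fun setT f &
  forall t, s < t -> (sqdist Q (partition_function t) f <= (rate (t - s))%:E)%E.
Proof.
(* chosen such that [rate (u k)] is below [4^-k] *)
pose u k : R := (20 * 4 ^+ k) ^+ 4.
have u0 k : 0 < u k by rewrite exprn_gt0// mulr_gt0// exprn_gt0.
have su k : s < s + u k by rewrite ltrDl.
have umono : {homo u : i j / (i <= j)%N >-> i <= j}.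
  move=> i j ij; rewrite lerXn2r ?nnegrE ?mulr_ge0 ?exprn_ge0//.
  by rewrite ler_wpM2l// ler_weXn2l// ler1n.
pose z k := partition_function (s + u k).
have mz k : measurable_fun setT (z k) by exact: measurable_partition_function.
have zz k : (sqdist Q (z k) (z k.+1) <= (4^-1 ^+ k)%:E)%E.
  rewrite sqdistC; apply: (le_trans (partition_function_dist (su k) _)).
    by rewrite lerD2l umono.
  rewrite lee_fin (_ : s + u k - s = u k); last by rewrite addrC addKr.
  rewrite /rate exprVn ler_pdivrMr; last first.
    by rewrite !sqrtr_gt0 ltr_wpDr// ltW.
  rewrite -ler_pdivrMl ?invr_gt0 ?exprn_gt0// invrK mulrC.
  have q0 : 0 <= 20 * 4 ^+ k :> R by rewrite mulr_ge0// exprn_ge0.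
  have root4 : Num.sqrt (Num.sqrt (u k)) = 20 * 4 ^+ k.
    by rewrite /u (exprM _ 2 2) sqrtr_sqr ger0_norm ?sqr_ge0// sqrtr_sqr ger0_norm.
  by rewrite -root4 !ler_sqrt ?sqrtr_ge0 ?lerDr// addr_ge0// ltW.
have [f mf zf] := sqdist_cauchy_limit mz zz.
exists f => // t st; have u0' : 0 <= t - s by rewrite subr_ge0 ltW.
pose N := grid_index 1 (t - s).
have tN n : t <= s + u (n + N)%N.
  rewrite -lerBlDl; apply: (@le_trans _ _ N%:R).
    by have /andP[+ _] := grid_index_itv (ltn0Sn 0) u0'; rewrite invr1 mulr1.
  apply: (@le_trans _ _ (4 ^+ N)).
    by rewrite -natrX ler_nat ltnW// ltn_expl.
  apply: (@le_trans _ _ (20 * 4 ^+ N)); first by rewrite ler_peMl ?exprn_ge0// ler1n.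
  apply: (@le_trans _ _ (u N)); last by rewrite umono// leq_addl.
  rewrite ler_eXnr//; apply: (@le_trans _ _ (4 ^+ N)); first by rewrite exprn_ege1// ler1n.
  by rewrite ler_peMl ?exprn_ge0// ler1n.
have mt := measurable_partition_function st.
apply: (@fatou_bound _ _ _ _ (fun n om => (partition_function t om - z (n + N)%N om) ^+ 2)).
- by move=> n; apply: measurable_funX; exact: measurable_funB.
- by apply: measurable_funX; exact: measurable_funB.
- by move=> n om; exact: sqr_ge0.
- apply: filterS zf => om zom.
  have c1 : partition_function t om - z (n + N)%N om @[n --> \oo] --> partition_function t om - f om.
    by apply: cvgB; [exact: cvg_cst|rewrite (cvg_shiftn N (fun n => z n om))].
  exact: (cvg_comp _ _ c1 (@exprn_continuous _ 2 _)).
- by move=> n; rewrite -/(sqdist Q _ _) sqdistC; exact: partition_function_dist.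
Qed.

End continuous_partition.

Lemma rate_ge0 (R : realType) (u : R) : 0 <= rate u.
Proof. by rewrite divr_ge0// sqrtr_ge0. Qed.

(** [(1 + u)^(-1/4)] beats [u^theta] for every exponent below [1/4]. *)
Lemma rate_cvg0 (R : realType) (s theta : R) : 0 <= theta < 4^-1 ->
  (t - s) `^ theta * rate (t - s) @[t --> +oo] --> (0 : R).
Proof.
move=> /andP[th0 th4]; pose delta := 4^-1 - theta.
have de0 : 0 < delta by rewrite subr_gt0.
apply/cvgrPdist_le => e e0.
pose A := (20 / e) `^ delta^-1.
near=> t.
have sA : A <= t - s by near: t; exact: (cvgry_ge (cvg_addrr (- s))).
have s0 : 0 < t - s by near: t; exact: (cvgry_gt (cvg_addrr (- s)) 0).
rewrite sub0r normrN ger0_norm ?mulr_ge0 ?powR_ge0 ?rate_ge0// /rate.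
set u := t - s in sA s0 *.
have r0 : 0 < Num.sqrt (Num.sqrt (1 + u)) by rewrite !sqrtr_gt0 ltr_wpDr// ltW.
have rE : u `^ 4^-1 <= Num.sqrt (Num.sqrt (1 + u)).
  have -> : u `^ 4^-1 = Num.sqrt (Num.sqrt u).
    rewrite -powR12_sqrt// -powR12_sqrt ?ltW// -powRrM; congr (_ `^ _); by field.
  by rewrite !ler_sqrt ?sqrtr_ge0 ?lerDr// addr_ge0// ltW.
rewrite mulrA ler_pdivrMr// mulrC -ler_pdivlMl//.
have ud : 20 / e <= u `^ delta.
  have q0 : 0 <= 20 / e by rewrite divr_ge0// ltW.
  have -> : 20 / e = A `^ delta by rewrite -powRrM mulVf ?gt_eqF// powRr1.
  by rewrite ge0_ler_powR ?nnegrE ?powR_ge0// ltW.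
apply: (le_trans (y := e / 20 * u `^ 4^-1)).
  have -> : 4^-1 = theta + delta by rewrite addrC subrK.
  rewrite powRD; last by rewrite (gt_eqF s0) implybT.
  rewrite mulrCA -[leLHS]mulr1 ler_wpM2l ?powR_ge0//.
  rewrite ler_pdivrMr// in ud.
  by rewrite -mulrAC ler_pdivlMr// mul1r mulrC.
by rewrite mulrA [20^-1 * e]mulrC ler_wpM2l// divr_ge0// ltW.
Unshelve. all: by end_near. Qed.

Section extended_partition.
Context {R : realType} {d : nat} {dE dO : measure_display}
  {E : measurableType dE} {Omega : measurableType dO}.
Variables (Q : probability Omega R) (W : 'rV[int]_d -> R -> Omega -> R).
Variables (P : probability E R) (tau : nat -> E -> R) (xi : nat -> E -> 'rV[int]_d).
Hypothesis envW : wiener_environment Q W.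
Hypothesis srw : simple_random_walk P tau xi.
Variables (x : 'rV[int]_d) (s beta : R).

Let pathw := path_weight W tau xi x s beta.

Lemma walkE t : s < t -> walk tau xi x s t = grid_site tau xi x (t - s) 1.
Proof.
by move=> st; apply/funext => w; rewrite /walk /grid_site /grid_jumps /jumps mul1r.
Qed.

(** Conditioning on the endpoint and averaging over it undo each other; an
    endpoint of probability [0] contributes nothing on either side. *)
Lemma ZE t om : s < t ->
  Z P tau xi W beta x s t om = (\int[P]_w (pathw t w om)%:E)%E.
Proof.
move=> st; have u0 : 0 < t - s by rewrite subr_gt0.
pose V := walk tau xi x s t.
have cV : countable_rv V by rewrite /V walkE//; exact: countable_rv_grid_site srw x _ u0 1.
have mw : measurable_fun setT (fun w => pathw t w om).
  exact: (measurable_section1 (measurable_path_weight envW srw x beta st)).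
rewrite (ge0_integral_countable_rv P cV)//; last 2 first.
- exact/measurable_EFinP.
- by move=> w; rewrite lee_fin; exact: path_weight_ge0.
rewrite /Z; apply: eq_esum => y _; rewrite /Zpp /bridge_expectation.
rewrite -[[set w | walk _ _ _ _ _ _ = y]]/(V @^-1` [set y]).
have -> : transition P tau xi (t - s) (y - x) = P (V @^-1` [set y]).
  rewrite /transition; congr (P _); apply/seteqP; split => w /=;
    rewrite /V /walk /site subr0 add0r.
    by move=> ->; rewrite addrC subrK.
  by move=> <-; rewrite [RHS]addrC addKr.
set A := V @^-1` [set y]; have mA : measurable A := cV y.
pose F w := expR (beta * action tau xi W x s t w om).
pose c := expR (- (beta ^+ 2 / 2) * (t - s)).
have pathE w : pathw t w om = c * F w.
  by rewrite /pathw /path_weight /c /F -expRD; congr expR; ring.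
have mF : measurable_fun setT F.
  rewrite (_ : F = fun w => c^-1 * pathw t w om); first exact: measurable_funM.
  by apply/funext => w; rewrite pathE mulKf// gt_eqF// expR_gt0.
have mFA : measurable_fun A (fun w => (F w)%:E).
  by apply/measurable_EFinP; apply: measurable_funS mF.
have -> : (\int[P]_(w in A) (pathw t w om)%:E = c%:E * \int[P]_(w in A) (F w)%:E)%E.
  rewrite -ge0_integralZl_EFin//.
  - by apply: eq_integral => w _; rewrite pathE EFinM.
  - by move=> w _; rewrite lee_fin expR_ge0.
  - exact: expR_ge0.
have [PA0|PA0] := eqVneq (P A) 0%E.
  by rewrite (null_set_integral mA mFA PA0) PA0 !mule0 !mul0e.
have PAfin : P A \is a fin_num by exact: fin_num_measure.
rewrite -muleA; congr (_ * _)%E.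
by rewrite muleCA divee// mule1.
Qed.

Lemma measurable_Z t : s < t -> measurable_fun setT (Z P tau xi W beta x s t).
Proof.
move=> st; rewrite (_ : Z _ _ _ _ _ _ _ _ = fun om => \int[P]_w (pathw t w om)%:E)%E.
  apply: measurable_integral2; first exact: path_weight_ge0.
  exact: (measurable_path_weight envW srw x beta st).
by apply/funext => om; exact: ZE.
Qed.

Lemma mean_square_distE t (f : Omega -> R) : s < t -> measurable_fun setT f ->
  mean_square_dist Q (Z P tau xi W beta x s t) f =
  sqdist Q (partition_function W P tau xi x s beta t) f.
Proof.
move=> st mf; apply: ae_eq_integral => //.
- have mD : measurable_fun setT (fun om => Z P tau xi W beta x s t om - (f om)%:E)%E.
    by apply: emeasurable_funB; [exact: measurable_Z|exact/measurable_EFinP].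
  exact: emeasurable_funM.
- apply/measurable_EFinP; apply: measurable_funX; apply: measurable_funB => //.
  exact: (measurable_partition_function envW srw).
- have := partition_function_ae envW srw x beta st; apply: filterS => om e _.
  by rewrite ZE// /pathw e -EFinB -EFin_expe.
Qed.

Hypothesis d3 : (3 <= d)%N.
Hypothesis beta_small : 16 * (4 + 24 * d%:R ^+ 2) * beta ^+ 2 <= 1.

Let Zt := Z P tau xi W beta x s.
Let Zoo := Zinf P tau xi Q W beta x s.

Lemma Z_L2_limit_nonempty : exists2 f, Z_L2_limit P tau xi Q W beta x s f &
  forall t, s < t -> (mean_square_dist Q (Zt t) f <= (rate (t - s))%:E)%E.
Proof.
have [f mf zf] := partition_function_limit envW srw d3 x s beta_small.
have msd t : s < t -> (mean_square_dist Q (Zt t) f <= (rate (t - s))%:E)%E.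
  by move=> st; rewrite mean_square_distE//; exact: zf.
exists f => //; split => //.
- pose t := s + 1; have st : s < t by rewrite ltrDl.
  have mz := measurable_partition_function envW srw x beta st.
  have := sqdist_triangle Q mf mz (measurable_cst (0 : R)).
  rewrite {1 3}/sqdist; under eq_integral do rewrite subr0.
  under [X in (_ <= _ * (_ + X))%E -> _]eq_integral do rewrite subr0.
  move=> /le_lt_trans; apply; apply: lte_mul_pinfty => //.
  apply: lte_add_pinfty; last exact: (partition_function_square envW srw x beta st).
  by rewrite sqdistC; exact: le_lt_trans (zf t st) (ltry _).
- apply: (@squeeze_cvge _ _ _ _ (fun=> 0%E) _ (fun t => (rate (t - s))%:E)).
  + near=> t; have st : s < t by near: t; apply: nbhs_pinfty_gt; exact: num_real.
    by rewrite msd// andbT mean_square_distE// sqdist_ge0.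
  + exact: cvg_cst.
  + apply: cvg_EFin; first exact: nearW.
    have th0 : 0 <= (0 : R) < 4^-1 by rewrite lexx invr_gt0 ltr0n.
    by have := rate_cvg0 s th0; under eq_fun do rewrite powRr0 mul1r.
Unshelve. all: by end_near. Qed.

(** Any two mean-square limits coincide almost surely, so the bound holds for
    the chosen version. *)
Lemma Zinf_dist t : s < t -> (mean_square_dist Q (Zt t) Zoo <= (2 * rate (t - s))%:E)%E.
Proof.
move=> st; have [f fL fdist] := Z_L2_limit_nonempty.
have [mf _ _] := fL.
have [mg _ gcvg] : Z_L2_limit P tau xi Q W beta x s Zoo by apply: xgetPex; exists f.
have mz T : s < T -> measurable_fun setT (partition_function W P tau xi x s beta T).
  exact: measurable_partition_function envW srw x s beta T.
have fg : (sqdist Q f Zoo <= 0)%E.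
  apply/lee_addgt0Pr => e e0; rewrite add0e.
  have e4 : 0 < e / 4 by rewrite divr_gt0.
  have [_ _ fcvg] := fL.
  have small h : Z_L2_limit P tau xi Q W beta x s h ->
      \forall T \near +oo, (mean_square_dist Q (Zt T) h <= (e / 4)%:E)%E.
    move=> [_ _] /fine_cvgP[fin /cvgrPdist_le/(_ _ e4)] hT.
    apply: filterS2 fin hT => T fT; rewrite sub0r normrN => /(le_trans (ler_norm _)).
    by rewrite -lee_fin /= fineK.
  have gL : Z_L2_limit P tau xi Q W beta x s Zoo by apply: xgetPex; exists f.
  have [T [sT [hf hg]]] : exists T, s < T /\ (mean_square_dist Q (Zt T) f <= (e / 4)%:E)%E /\
      (mean_square_dist Q (Zt T) Zoo <= (e / 4)%:E)%E.
    apply: (@filter_ex _ +oo).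
    apply: filterS3 (nbhs_pinfty_gt (num_real s)) (small f fL) (small _ gL) => T h1 h2 h3.
    by split.
  rewrite mean_square_distE// in hf; rewrite mean_square_distE// in hg.
  rewrite sqdistC in hf.
  apply: (le_trans (sqdist_triangle Q mf (mz T sT) mg)).
  apply: (@le_trans _ _ (2%:E * ((e / 4)%:E + (e / 4)%:E))%E).
    by apply: lee_wpmul2l => //; exact: leeD.
  change ((2 * (e / 4 + e / 4))%:E <= e%:E)%E.
  by rewrite lee_fin; lra.
rewrite mean_square_distE//.
apply: (le_trans (sqdist_triangle Q (mz t st) mf mg)).
rewrite EFinM; apply: lee_wpmul2l => //.
rewrite -[leRHS]adde0; apply: leeD => //.
by rewrite -mean_square_distE//; exact: fdist.
Qed.

Lemma Z_dist_cvg0 theta : 0 < theta < 4^-1 ->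
  (((t - s) `^ theta)%:E * mean_square_dist Q (Zt t) Zoo)%E @[t --> +oo] --> 0%E.
Proof.
move=> /andP[th0 th4].
apply: (@squeeze_cvge _ _ _ _ (fun=> 0%E) _ (fun t => (2 * ((t - s) `^ theta * rate (t - s)))%:E)).
- near=> t; have st : s < t by near: t; apply: nbhs_pinfty_gt; exact: num_real.
  apply/andP; split.
    apply: mule_ge0; first by rewrite lee_fin powR_ge0.
    by apply: integral_ge0 => om _; rewrite -[(_ ^+ 2)%E]/(_ * _)%E sqre_ge0.
  rewrite mulrCA EFinM; apply: lee_wpmul2l; first by rewrite lee_fin powR_ge0.
  exact: Zinf_dist.
- exact: cvg_cst.
- apply: cvg_EFin; first exact: nearW.
  rewrite -[X in _ --> X](mulr0 2); apply: cvgM; first exact: cvg_cst.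
  by apply: rate_cvg0; rewrite (ltW th0).
Unshelve. all: by end_near. Qed.

End extended_partition.

Theorem theorem2p2 (R : realType) (d : nat) (hd : (3 <= d)%N) :
  exists2 beta0 : R, 0 < beta0 &
  forall beta : R, 0 < beta < beta0 ->
  exists2 theta : R,
    0 < theta < Num.min (d%:R / 2 - 1)
                        (- ln (fine (alpha R d) * fine (lambda beta))) &
  forall (dO : measure_display) (Omega : measurableType dO)
    (Q : probability Omega R) (W : 'rV[int]_d -> R -> Omega -> R)
    (dE : measure_display) (E : measurableType dE) (P : probability E R)
    (tau : nat -> E -> R) (xi : nat -> E -> 'rV[int]_d),
  wiener_environment Q W ->
  simple_random_walk P tau xi ->
  forall (x : 'rV[int]_d) (s : R),
  (((t - s) `^ theta)%:E *
    mean_square_dist Q (Z P tau xi W beta x s t)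
                       (Zinf P tau xi Q W beta x s))%E
    @[t --> +oo] --> 0%E.

Proof.
have d1 : 0 < d%:R :> R by rewrite ltr0n; apply: leq_trans hd.
have [_ a0] := @alpha_fin_gt0 R d hd; set a := fine (alpha R d) in a0 *.
pose C : R := 16 * (4 + 24 * d%:R ^+ 2).
have C0 : 0 < C by rewrite mulr_gt0// ltr_wpDr// mulr_ge0// sqr_ge0.
have D0 : 0 < C + 2 * a + 2 by rewrite !addr_gt0// mulr_gt0.
(* [C] for the contraction of the renewal inequality, [2 a] for
   [alpha lambda < 1], and [2] for [beta < 1 / 2] *)
exists (C + 2 * a + 2)^-1; first by rewrite invr_gt0.
move=> beta /andP[b0 bD].
have bprod : beta * (C + 2 * a + 2) < 1 by rewrite -ltr_pdivlMr// mul1r.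
have Cb : 0 < C * beta by rewrite mulr_gt0.
have ab : 0 < a * beta by rewrite mulr_gt0.
have bhalf : 2 * beta < 1 by nra.
have beta_small : 16 * (4 + 24 * d%:R ^+ 2) * beta ^+ 2 <= 1 by rewrite -/C; nra.
have lamE : lambda beta = (beta ^+ 2 / (1 - beta ^+ 2))%:E by apply: lambdaE; nra.
pose l := beta ^+ 2 / (1 - beta ^+ 2).
have q0 : 0 < 1 - beta ^+ 2 by nra.
have al01 : 0 < a * l < 1.
  rewrite /l mulrA divr_gt0 ?mulr_gt0 ?exprn_gt0//= ltr_pdivrMr// mul1r; nra.
set m : R := Num.min _ _.
have m0 : 0 < m.
  rewrite lt_min; apply/andP; split.
    have : 3 <= d%:R :> R by rewrite ler_nat.
    lra.
  by rewrite lamE/= oppr_gt0 ln_lt0.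
have m4 : 0 < Num.min m 4^-1 by rewrite lt_min m0 invr_gt0 ltr0n.
exists (Num.min m 4^-1 / 2).
  have : Num.min m 4^-1 <= m by rewrite ge_min lexx.
  lra.
move=> dO Omega Q W dE E P tau xi envW srw x s.
have th4 : 0 < Num.min m 4^-1 / 2 < 4^-1.
  have : Num.min m 4^-1 <= 4^-1 by rewrite ge_min lexx orbT.
  lra.
exact: (Z_dist_cvg0 envW srw x s hd beta_small th4).
Qed.
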